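(* Let $d\ge2$. Suppose that the element-averaged Steklov eigenfunctions decay in the following sense: there are $c_0>0$ independent of $H,\ell$ and $C_{\mathrm{sd}}(H,\ell)>0$ depending polynomially on $H,\ell$ (possibly with negative powers of $H$) such that for all patches $\mathsf N^\ell(T)$, $T\in\mathcal T_H$, the Steklov eigenfunctions $\psi_k$ of the patch $\mathsf N^\ell(T)$ satisfy, for all $k\in\mathbb N_0$, $$\|\Pi_{H,\mathsf N^\ell(T)}\psi_k\|_{L^2(\mathsf N^{\lfloor \ell/2\rfloor}(T))}\le C_{\mathrm{sd}}(H,\ell)\exp\!\big(-c_0\,k^{\frac1{d-1}}\big).$$ Let $L\in\mathbb N$ be the largest number such that, for all $\ell\le L$ and all patches, the number of patch elements scales like $\ell^d$ (i.e. it is bounded from below and above by multiples of $\ell^d$ with fixed positive constants independent of $H$ and $\ell$). Then there are $c,C>0$ independent of $H,\ell$ such that, for all $\ell\le L$, $$\sigma(H,\ell)\le C\,C_{\mathrm{sd}}(H,\ell)\,\ell^{\,d-\frac{d}{d-1}}\,H^{-1/2}\exp\!\big(-c\,\ell^{\frac{d}{d-1}}\big).$$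
   Context: Model problem. $\Omega\subset\mathbb R^d$ is a polygonal (polyhedral) Lipschitz domain with diameter of order one. $A\in L^\infty(\Omega,\mathbb R^{d\times d})$ is symmetric and satisfies $\alpha|\eta|^2\le (A(x)\eta)\cdot\eta\le\beta|\eta|^2$ for almost all $x\in\Omega$ and all $\eta\in\mathbb R^d$, with $0<\alpha\le\beta<\infty$. Put $\mathcal V=H^1_0(\Omega)$. Mesh. $\mathcal T_H$ is taken from a quasi-uniform family of finite subdivisions of $\Omega$ into closed, convex, shape-regular elements of diameter at most $H>0$. For a union of elements $S$, $\mathsf N^1(S)=\bigcup\{T\in\mathcal T_H\mid T\cap S\ne\emptyset\}$; $\mathsf N^0(T)=T$ and $\mathsf N^\ell(T)=\mathsf N^1(\mathsf N^{\ell-1}(T))$. For a patch $\omega=\mathsf N^\ell(T)$ (assumed not to coincide with $\Omega$), $\mathcal T_{H,\omega}$ is the submesh of elements contained in $\omega$, $\mathbb P^0(\mathcal T_{H,\omega})$ the space of $\mathcal T_{H,\omega}$-piecewise constant functions and $\Pi_{H,\omega}:L^2(\omega)\to\mathbb P^0(\mathcal T_{H,\omega})$ the $L^2(\omega)$-orthogonal projection. Quantity $\sigma$. For $\omega=\mathsf N^\ell(T)$ let $a_\omega(u,v)=\int_\omega(A\nabla u)\cdot\nabla v\,dx$, $\mathcal V_\omega=\{v|_\omega\mid v\in\mathcal V\}\subset H^1(\omega)$, and $$Y=\{v\in\mathcal V_\omega\mid a_\omega(v,w)=0\ \text{for all } w\in H^1_0(\omega)\}.$$ Define $$\sigma_T(H,\ell)=\min_{g\in\mathbb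 P^0(\mathcal T_{H,\omega}):\ \|g\|_{L^2(\omega)}=1}\ \sup_{v\in Y:\ \|v\|_{H^1(\omega)}=1}(g,v)_{L^2(\omega)},\qquad \sigma(H,\ell)=\max_{T\in\mathcal T_H}\sigma_T(H,\ell).$$ Steklov eigenfunctions. For $\omega=\mathsf N^\ell(T)$ put $\Gamma_1=\partial\omega\setminus\partial\Omega$ and $\Gamma_2=\partial\omega\setminus\Gamma_1$. The Steklov eigenpairs of $\omega$ are the pairs $(\psi,\lambda)\in\mathcal V_\omega\times\mathbb R$, $\psi\neq0$, with $a_\omega(\psi,v)=\lambda(\psi,v)_{L^2(\Gamma_1)}$ for all $v\in\mathcal V_\omega$ (weak form of $\operatorname{div}A\nabla\psi=0$ in $\omega$, $A\nabla\psi\cdot n=\lambda\psi$ on $\Gamma_1$, $\psi=0$ on $\Gamma_2$). $\{\psi_k\mid k\in\mathbb N_0\}$ denotes an $L^2(\Gamma_1)$-orthonormal and $a_\omega$-orthogonal set of eigenfunctions which is complete in $Y$, numbered so that the corresponding eigenvalues satisfy $0\le\lambda_0\le\lambda_1\le\cdots$. Constants. Constants may depend on $\alpha,\beta$ (and on $d$, $\Omega$ and the mesh regularity parameters). *)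

(* Defs.v *)
From HB Require Import structures.
From mathcomp Require Import all_boot all_order all_algebra.
From mathcomp Require Import all_classical all_reals all_analysis.
Set Implicit Arguments.
Unset Strict Implicit.
Unset Printing Implicit Defensive.
Import Order.TTheory GRing.Theory Num.Theory.
Import numFieldNormedType.Exports.
Local Open Scope classical_set_scope.
Local Open Scope ring_scope.

(* 'rV[R]_n carries the product sigma-algebra, generated by the coordinates;
   lebesgue_rV below is the n-fold product of the Lebesgue measure. *)
Definition rV_display : measure_display -> measure_display.
Proof. exact. Qed.

Section measurable_rV.
Variables (R : realType) (n : nat).

Let coord (i : 'I_n) (x : 'rV[R]_n) : R := x 0 i.

Let rV_set0 : g_sigma_preimage coord set0.
Proof. exact: sigma_algebra0. Qed.

Let rV_setC A : g_sigma_preimage coord A -> g_sigma_preimage coord (~` A).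
Proof. exact: sigma_algebraC. Qed.

Let rV_bigcup (F : _^nat) : (forall i, g_sigma_preimage coord (F i)) ->
  g_sigma_preimage coord (\bigcup_i (F i)).
Proof. exact: sigma_algebra_bigcup. Qed.

HB.instance Definition _ := @isMeasurable.Build
  (rV_display default_measure_display) 'rV[R]_n (g_sigma_preimage coord)
  rV_set0 rV_setC rV_bigcup.

End measurable_rV.

Lemma sigma_finite_product d1 d2 (T1 : measurableType d1)
    (T2 : measurableType d2) (R : realType)
    (m1 : {sigma_finite_measure set T1 -> \bar R})
    (m2 : {sigma_finite_measure set T2 -> \bar R}) :
  sigma_finite setT (m1 \x m2)%E.
Proof.
have /sigma_finiteP[F [TF ndF Foo]] := sigma_finiteT m1.
have /sigma_finiteP[G [TG ndG Goo]] := sigma_finiteT m2.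
exists (fun n => F n `*` G n).
  rewrite -setXTT TF TG predeqE => -[x y]; split.
    move=> [/= [n _ Fnx] [k _ Gky]]; exists (maxn n k) => //; split.
    - by move: x Fnx; exact/subsetPset/ndF/leq_maxl.
    - by move: y Gky; exact/subsetPset/ndG/leq_maxr.
  by move=> [n _ []/= ? ?]; split; exists n.
move=> k; have [? ?] := Foo k; have [? ?] := Goo k.
split; first exact: measurableX.
by rewrite product_measure1E// lte_mul_pinfty// ge0_fin_numE.
Qed.

Section lebesgue_rV.
Variable R : realType.

Definition rV_cons n (p : R * 'rV[R]_n) : 'rV[R]_n.+1 :=
  row_mx (const_mx p.1 : 'rV[R]_1) p.2.

Lemma rV_consEl n p (j : 'I_1) : rV_cons p 0 (lshift n j) = p.1.
Proof. by rewrite /rV_cons (@row_mxEl _ 1 1 n) mxE. Qed.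

Lemma rV_consEr n p (j : 'I_n) : rV_cons p 0 (rshift 1 j) = p.2 0 j.
Proof. by rewrite /rV_cons (@row_mxEr _ 1 1 n). Qed.

Lemma measurable_rV_coord n (i : 'I_n) :
  measurable_fun setT (fun x : 'rV[R]_n => x 0 i).
Proof.
move=> _ Y mY; rewrite setTI; apply: sub_sigma_algebra => /=.
rewrite -bigcup_seq/=; exists i => /=; first by rewrite mem_index_enum.
by exists Y => //; rewrite setTI.
Qed.

Lemma measurable_fun_rV d (T : measurableType d) n (f : T -> 'rV[R]_n) :
  (forall i, measurable_fun setT (fun x => f x 0 i)) -> measurable_fun setT f.
Proof.
move=> mf _ A mA; rewrite setTI.
have : image_set_system setT f measurable A.
  move: A mA; apply: smallest_sub.
    exact/sigma_algebra_image/sigma_algebra_measurable.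
  rewrite -bigcup_seq; apply: bigcup_sub => i _ _ [B mB <-].
  rewrite /image_set_system/=.
  by have := mf i measurableT B mB; rewrite !setTI.
by rewrite /image_set_system/= setTI.
Qed.

Lemma measurable_rV_cons n : measurable_fun setT (@rV_cons n).
Proof.
apply: measurable_fun_rV => i; case: (split_ordP (i : 'I_(1 + n))) => j ->.
  rewrite (_ : (fun x => _) = fst); first exact: measurable_fst.
  by apply/funext => x; exact: rV_consEl.
rewrite (_ : (fun x => _) = (fun y : 'rV[R]_n => y 0 j) \o snd).
  exact: measurableT_comp (measurable_rV_coord j) measurable_snd.
by apply/funext => x; exact: rV_consEr.
Qed.

Definition rV_uncons n (x : 'rV[R]_n.+1) : R * 'rV[R]_n :=
  (x 0 0, @rsubmx _ 1 1 n x).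

Lemma rV_consK n : cancel (@rV_cons n) (@rV_uncons n).
Proof.
move=> [a x]; rewrite /rV_uncons /rV_cons/= row_mxKr; congr pair.
have -> : 0 = lshift n (0 : 'I_1) by exact: val_inj.
exact: rV_consEl (a, x) 0.
Qed.

Lemma measurable_rV_uncons n : measurable_fun setT (@rV_uncons n).
Proof.
apply: measurable_fun_pair; first exact: measurable_rV_coord.
apply: measurable_fun_rV => i.
rewrite (_ : (fun x => _) = fun x : 'rV[R]_n.+1 => x 0 (rshift 1 i)).
  exact: measurable_rV_coord.
by apply/funext => x; rewrite mxE.
Qed.

Lemma rV_unconsK n : cancel (@rV_uncons n) (@rV_cons n).
Proof.
move=> x; apply/rowP => i; case: (split_ordP (i : 'I_(1 + n))) => j ->.
  by rewrite rV_consEl !ord1; congr (x _ _); exact: val_inj.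
by rewrite rV_consEr mxE.
Qed.

Section step.
Local Open Scope ereal_scope.
Variables (n : nat) (m : {sigma_finite_measure set 'rV[R]_n -> \bar R}).

Let leb : {sigma_finite_measure set (measurableTypeR R) -> \bar R} :=
  lebesgue_measure.

Definition lebesgue_rV_step : set 'rV[R]_n.+1 -> \bar R :=
  pushforward (leb \x m) (@rV_cons n).

Let mpreimage A : measurable A -> measurable (@rV_cons n @^-1` A).
Proof.
by move=> mA; rewrite -[X in measurable X]setTI; exact: measurable_rV_cons.
Qed.

Let step0 : lebesgue_rV_step set0 = 0.
Proof. by rewrite /lebesgue_rV_step /pushforward preimage_set0 measure0. Qed.

Let step_ge0 A : 0 <= lebesgue_rV_step A.
Proof. exact: (measure_ge0 (leb \x m)%E). Qed.

Let step_sigma_additive : semi_sigma_additive lebesgue_rV_step.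
Proof.
move=> F mF tF mUF; rewrite /lebesgue_rV_step /pushforward preimage_bigcup.
apply: measure_semi_sigma_additive.
- by move=> k; exact: mpreimage.
- apply/trivIsetP => /= i j _ _ ij; rewrite -preimage_setI.
  by move/trivIsetP : tF => /(_ _ _ _ _ ij) ->//; rewrite preimage_set0.
- by rewrite -preimage_bigcup; exact: mpreimage.
Qed.

HB.instance Definition _ := isMeasure.Build _ _ _
  lebesgue_rV_step step0 step_ge0 step_sigma_additive.

Let step_sigma_finite : sigma_finite setT lebesgue_rV_step.
Proof.
have [F TF Foo] := sigma_finite_product leb m.
exists (fun k => @rV_uncons n @^-1` F k).
  by rewrite -preimage_bigcup -TF preimage_setT.
move=> k; have [mF Fk] := Foo k; split.
  by rewrite -[X in measurable X]setTI; exact: measurable_rV_uncons.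
rewrite /lebesgue_rV_step /pushforward -comp_preimage.
by rewrite (_ : _ \o _ = id)//; apply/funext => x /=; rewrite rV_consK.
Qed.

HB.instance Definition _ := Measure_isSigmaFinite.Build _ _ _
  lebesgue_rV_step step_sigma_finite.

End step.

Fixpoint lebesgue_rV n : {sigma_finite_measure set 'rV[R]_n -> \bar R} :=
  match n with
  | 0 => \d_(0 : 'rV[R]_0)
  | n'.+1 => lebesgue_rV_step (lebesgue_rV n')
  end.
End lebesgue_rV.

Section euclidean.
Variables (R : realType) (d : nat).
Implicit Types (x y : 'rV[R]_d) (S : set 'rV[R]_d).

Definition dotv x y : R := \sum_i x 0 i * y 0 i.

(* The library norm of 'rV[R]_d is the maximum norm. *)
Definition enorm x : R := Num.sqrt (dotv x x).

(* [diam set0] is -oo. *)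
Definition diam S : \bar R :=
  ereal_sup [set (enorm (p.1 - p.2))%:E | p in S `*` S].

Definition bdry S := closure S `\` S°.

Definition half_space (h : 'rV[R]_d * R) : set 'rV[R]_d :=
  [set x | dotv h.1 x <= h.2].

Definition polyhedron (s : seq ('rV[R]_d * R)) : set 'rV[R]_d :=
  [set x | forall h, h \in s -> half_space h x].

(* Near each boundary point the set is, in suitable orthonormal coordinates,
   the part of space above the graph of a Lipschitz function; the graph
   function is evaluated at the component of y orthogonal to e. *)
Definition lipschitz_boundary S := forall x, bdry S x ->
  exists (r M : R) (e : 'rV[R]_d) (h : 'rV[R]_d -> R),
    [/\ 0 < r, enorm e = 1,
        forall y z, `|h y - h z| <= M * enorm (y - z) &
        forall y, enorm (y - x) < r ->
          (S y <-> h (y - dotv y e *: e) < dotv y e)].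

Definition polyhedral_lipschitz_domain S :=
  [/\ [/\ open S, S !=set0, connected S & bounded_set S],
      lipschitz_boundary S &
      exists ss : seq (seq ('rV[R]_d * R)),
        closure S = \bigcup_(s in [set` ss]) polyhedron s].

End euclidean.

Section hausdorff.
Variables (R : realType) (d : nat).
Local Open Scope ereal_scope.

(* The volume of the unit ball of R^s divided by 2^s makes the s-dimensional
   Hausdorff measure agree with the usual s-dimensional surface area. *)
Definition hausdorff_cst (s : nat) : R :=
  (fine (lebesgue_rV R s [set x | enorm x <= 1]%R) / 2 ^+ s)%R.

Definition hausdorff_gauge (s : nat) (delta : R) (S : set 'rV[R]_d) : \bar R :=
  if S == set0 then 0
  else if diam S <= delta%:E then (hausdorff_cst s * fine (diam S) ^+ s)%:E
  else +oo.

Definition hausdorff (s : nat) : set 'rV[R]_d -> \bar R := fun S =>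
  ereal_sup [set mu_ext (hausdorff_gauge s delta) S |
    delta in [set r : R | (0 < r)%R]].

Let gauge0 s delta : hausdorff_gauge s delta (set0 : set 'rV[R]_d) = 0.
Proof. by rewrite /hausdorff_gauge eqxx. Qed.

Let diam_ge0 (S : set 'rV[R]_d) : S !=set0 -> 0 <= diam S.
Proof.
move=> [x Sx]; apply: le_trans (ereal_sup_ubound _); last by exists (x, x).
by rewrite lee_fin sqrtr_ge0.
Qed.

Let gauge_ge0 s delta (S : set 'rV[R]_d) : 0 <= hausdorff_gauge s delta S.
Proof.
rewrite /hausdorff_gauge; case: eqVneq => // /set0P S0; case: ifP => // _.
rewrite lee_fin mulr_ge0 ?divr_ge0 ?exprn_ge0 ?fine_ge0//.
exact: diam_ge0.
Qed.

Let hausdorff0 s : hausdorff s (set0 : set 'rV[R]_d) = 0.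
Proof.
rewrite /hausdorff (_ : [set _ | _ in _] = [set 0]) ?ereal_sup1//.
apply/seteqP; split => [_ [r _ <-]|_ ->] /=; last exists 1%R => //=.
  by rewrite mu_ext0.
by rewrite mu_ext0.
Qed.

Let hausdorff_ge0 s (S : set 'rV[R]_d) : 0 <= hausdorff s S.
Proof.
apply: le_trans (ereal_sup_ubound _); last by exists 1%R => /=.
exact: mu_ext_ge0.
Qed.

Let le_hausdorff s : {homo hausdorff s : A B / A `<=` B >-> A <= B}.
Proof.
move=> A B AB; apply: ge_ereal_sup => _ [r r0 <-].
apply: le_trans (ereal_sup_ubound _); last by exists r.
exact: le_mu_ext.
Qed.

Let hausdorff_sigma_subadditive s : sigma_subadditive (hausdorff s).
Proof.
move=> F; apply: ge_ereal_sup => _ [r r0 <-].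
apply: (le_trans (mu_ext_sigma_subadditive (gauge_ge0 s r) F)).
apply: lee_nneseries => [i _ _|i _]; first exact: mu_ext_ge0.
by rewrite /hausdorff; apply: ereal_sup_ubound; exists r.
Qed.

HB.instance Definition _ s := isOuterMeasure.Build R 'rV[R]_d (hausdorff s)
  (hausdorff0 s) (hausdorff_ge0 s) (@le_hausdorff s)
  (@hausdorff_sigma_subadditive s).

End hausdorff.

Section L2.
Context dd (T : measurableType dd) (R : realType).
Variables (mu : {measure set T -> \bar R}) (D : set T).
Implicit Types u v : T -> R.

Definition L2fun u :=
  measurable_fun D u /\ (\int[mu]_(x in D) (u x ^+ 2)%:E < +oo)%E.

Definition L2dot u v : R := \int[mu]_(x in D) (u x * v x).

Definition L2norm u : R := Num.sqrt (L2dot u u).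

Definition is_L2proj (V : set (T -> R)) u p :=
  V p /\ forall q, V q -> L2dot (u \- p) q = 0.

Definition L2proj (V : set (T -> R)) u : T -> R :=
  xget (cst 0) [set p | is_L2proj V u p].

End L2.

Section sobolev.
Variables (R : realType) (d : nat).
Local Notation E := 'rV[R]_d.
Local Notation leb := (lebesgue_rV R d).
Implicit Types (U : set E) (u v : E -> R).

Definition partial (i : 'I_d) (f : E -> R) : E -> R :=
  'D_(delta_mx 0 i : E) f.

Fixpoint Ck (k : nat) (f : E -> R) : Prop :=
  continuous f /\
  if k is k'.+1 then
    forall i, (forall x, derivable f x (delta_mx 0 i)) /\ Ck k' (partial i f)
  else True.

Definition smooth (f : E -> R) := forall k, Ck k f.

Definition test U (f : E -> R) :=
  [/\ smooth f, compact (closure [set x | f x != 0]) &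
      closure [set x | f x != 0] `<=` U].

Definition is_weak_gradient U v (G : E -> E) := forall i : 'I_d,
  L2fun leb U (fun x => G x 0 i) /\
  forall f, test U f ->
    L2dot leb U v (partial i f) = - L2dot leb U (fun x => G x 0 i) f.

Definition wgrad U v : E -> E := xget (cst 0) [set G | is_weak_gradient U v G].

Definition H1 U : set (E -> R) :=
  [set v | L2fun leb U v /\ exists G, is_weak_gradient U v G].

Definition H1norm U v : R :=
  Num.sqrt (L2dot leb U v v +
            \int[leb]_(x in U) dotv (wgrad U v x) (wgrad U v x)).

Definition H10 U : set (E -> R) :=
  [set v | H1 U v /\ exists f : (E -> R)^nat,
    (forall n, test U (f n)) /\ H1norm U (f n \- v) @[n --> \oo] --> 0].

Definition surface_outer : {outer_measure set E -> \bar R} :=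
  hausdorff d.-1.

Definition surface :
    {measure set (caratheodory_type surface_outer) -> \bar R} :=
  surface_outer.

(* The trace extends by continuity the restriction of smooth functions; like
   wgrad and L2proj it is determined up to null sets. *)
Definition is_trace U (G : set E) v (t : E -> R) :=
  L2fun surface G t /\ exists f : (E -> R)^nat,
    [/\ forall n, smooth (f n) /\ H1 U (f n \- v),
        forall n, L2fun surface G (f n \- t),
        H1norm U (f n \- v) @[n --> \oo] --> 0 &
        L2norm surface G (f n \- t) @[n --> \oo] --> 0].

Definition trace U (G : set E) v : E -> R :=
  xget (cst 0) [set t | is_trace U G v t].

Definition trace_dot U (G : set E) u v : R :=
  L2dot surface G (trace U G u) (trace U G v).

End sobolev.

Section model_problem.
Variables (R : realType) (d : nat).
Local Notation E := 'rV[R]_d.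
Local Notation leb := (lebesgue_rV R d).
Variables (A : E -> 'M[R]_d) (Om : set E).

(* Vectors are rows, so that the product of the matrix M and the vector x
   is x *m M^T. *)
Definition coefficient (alpha beta : R) :=
  [/\ forall i j, measurable_fun Om (fun x => A x i j),
      exists B : R, {ae leb, forall x, Om x -> forall i j, `|A x i j| <= B},
      {ae leb, forall x, Om x -> A x = (A x)^T} &
      {ae leb, forall x, Om x -> forall y : E,
         alpha * enorm y ^+ 2 <= dotv (y *m (A x)^T) y <= beta * enorm y ^+ 2}].

(* In the following definitions w is a patch, which is a closed set; function
   spaces and integrals on it refer to its interior. *)
Definition energy (w : set E) (u v : E -> R) : R :=
  \int[leb]_(x in w°) dotv (wgrad w° u x *m (A x)^T) (wgrad w° v x).

Definition V_patch (w : set E) : set (E -> R) :=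
  [set v | exists2 u, H10 Om u & forall x, (w°) x -> v x = u x].

Definition Y_patch (w : set E) : set (E -> R) :=
  [set v | V_patch w v /\ forall z, H10 w° z -> energy w v z = 0].

Definition Gamma1 (w : set E) : set E := bdry w `\` bdry Om.

Definition steklov_eigenpair (w : set E) (f : E -> R) (lambda : R) :=
  [/\ V_patch w f, H1norm w° f != 0 &
      forall v, V_patch w v ->
        energy w f v = lambda * trace_dot w° (Gamma1 w) f v].

Definition steklov_basis (w : set E) (psi : nat -> E -> R) :=
  exists lambda : nat -> R,
    [/\ forall k, steklov_eigenpair w (psi k) (lambda k),
        forall j k, trace_dot w° (Gamma1 w) (psi j) (psi k) = (j == k)%:R,
        forall j k, j != k -> energy w (psi j) (psi k) = 0,
        forall v, Y_patch w v -> forall e : R, 0 < e ->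
          exists (n : nat) (a : nat -> R),
            H1norm w° (fun x => v x - \sum_(k < n) a k * psi k x) < e &
        0 <= lambda 0%N /\ forall k, lambda k <= lambda k.+1].

End model_problem.

Section mesh.
Variables (R : realType) (d : nat).
Local Notation E := 'rV[R]_d.
Local Notation leb := (lebesgue_rV R d).
Variables (I : finType) (K : I -> set E).

(* gamma is the shape regularity parameter, kappa the quasi-uniformity one. *)
Definition mesh (Om : set E) (gamma kappa H : R) :=
  [/\ [/\ 0 < H, (0 < #|I|)%N & closure Om = \bigcup_(i : I) K i],
      forall i j, i != j -> (K i)° `&` (K j)° = set0,
      forall i, closed (K i) /\ convex_set (K i : set (convex_lmodType E)),
      forall i, (diam (K i) <= H%:E)%E /\ ((kappa * H)%:E <= diam (K i))%E &
      forall i, exists x,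
        [set y | enorm (y - x) <= gamma * fine (diam (K i))] `<=` K i].

Definition N1 (S : set E) : set E :=
  \bigcup_(i in [set i | K i `&` S !=set0]) K i.

Definition mesh_patch (l : nat) (i : I) : set E := iter l N1 (K i).

Definition submesh (w : set E) : {set I} := [set i | `[< K i `<=` w >]]%SET.

Definition P0 (w : set E) : set (E -> R) :=
  [set g | L2fun leb w° g /\
    forall i, i \in submesh w -> exists c : R, forall x, ((K i)°) x -> g x = c].

Definition Pi (w : set E) (v : E -> R) : E -> R := L2proj leb w° (P0 w) v.

Variables (A : E -> 'M[R]_d) (Om : set E).

(* The infimum is attained, since P0 w is finite dimensional. *)
Definition sigmaT (l : nat) (i : I) : \bar R :=
  let w := mesh_patch l i in
  ereal_inf
    [set ereal_sup
       [set (L2dot leb w° g v)%:E |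
         v in [set v | Y_patch A Om w v /\ H1norm w° v = 1]] |
      g in [set g | P0 w g /\ L2norm leb w° g = 1]].

Definition sigma (l : nat) : \bar R := \big[maxe/-oo%E]_(i : I) sigmaT l i.

(* For l = 0 and d > 2 the factor l ^ (d - d / (d - 1)) vanishes: the number of
   layers ranges over the positive integers. *)
Definition admissible_patch (l : nat) (i : I) :=
  (0 < l)%N /\ mesh_patch l i <> closure Om.

Definition steklov_decay (c0 : R) (Csd : nat -> R)
    (psi : nat -> I -> nat -> E -> R) :=
  forall l i, admissible_patch l i -> forall k,
    L2norm leb (mesh_patch l./2 i)° (Pi (mesh_patch l i) (psi l i k)) <=
    Csd l * expR (- (c0 * k%:R `^ ((d%:R - 1)^-1))).

Definition layers_scale (m M : R) (L : nat) :=
  forall l i, (0 < l <= L)%N ->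
    m * l%:R ^+ d <= #|submesh (mesh_patch l i)|%:R <= M * l%:R ^+ d.

Definition largest_scaling_layer (m M : R) (L : nat) :=
  layers_scale m M L /\ forall L', layers_scale m M L' -> (L' <= L)%N.

End mesh.

(* Polynomial in H, 1/H and l. *)
Definition polynomial_dependence (R : realType) (C : R -> nat -> R) :=
  exists (n : nat) (p : {poly {poly R}}), forall (H : R) (l : nat),
    0 < H -> (0 < l)%N -> C H l = p.[(l%:R)%:P].[H] / H ^+ n.

(* Main.v *)
Require Import Defs.
From mathcomp Require Import all_boot all_order all_algebra.
From mathcomp Require Import all_classical all_reals all_analysis.
From mathcomp Require Import measurable_realfun ring lra.
Set Implicit Arguments.
Unset Strict Implicit.
Unset Printing Implicit Defensive.
Import Order.TTheory GRing.Theory Num.Theory.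
Import numFieldNormedType.Exports.
Local Open Scope classical_set_scope.
Local Open Scope ring_scope.

(* Let N be the number of elements of N^{l/2}(T), of order l^d. Among the unit
   piecewise constants g supported in N^{l/2}(T) there is one orthogonal to the
   first N - 1 Steklov eigenfunctions. Expanding a unit v of Y in the
   eigenfunctions, (g, v) only sees the coefficients a_k with k >= N - 1; each
   (g, psi_k) is at most the norm of the averaged psi_k on N^{l/2}(T), which
   decays by hypothesis, while |a_k| is bounded by the L^2(Gamma1)-norm of the
   trace of v, hence by a multiple of H^(-1/2). Splitting the decay factor in two
   halves, one gives exp(-c l^(d/(d-1))) and the other a convergent series.

   The trace inequality on a patch is proved element by element from weak
   gradients alone: a boundary value f(y) is the limit of averages of f over cubes
   shrinking to y along the cone joining y to an inner cube of the element, and the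
   difference of two consecutive averages is a weak gradient tested against a
   compactly supported function. Integrating over y requires the (d-1)-dimensional
   Hausdorff measure of the boundary of a convex set inside a cube of radius r to be
   O(r^(d-1)). *)

(** * Cubes and Borel sets of row vectors *)

Section rV_topology.
Variables (R : realType) (n : nat).
Implicit Types (x y p : 'rV[R]_n) (r e : R).

(** Elements are arbitrary closed convex sets and [surface] is a Hausdorff measure, so boundaries
    come with neither a parametrization nor a normal field; convexity enters through the cones and
    through nearest-point projections. In dimension n + 1, comparing two averages at scale t costs
    t^(1-n) times the gradient energy in a cube of size t around y; integration over y contributes
    t^n. The remaining factor t is geometric in the index of the scale, which leaves room for the
    weights of a Cauchy-Schwarz inequality. The trace of [v] itself is never formed. By
    orthonormality the sum of the a_k^2 is the squared boundary norm of a partial sum, which is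
    compared with combinations of smooth functions; the traces of the [psi k] exist because their
    norm is not 0. [wgrad], [trace] and [Pi] are choices with a default value. Their existence is
    proved where they are used, and linear combinations are handled through explicit gradients. The
    trace inequality carries both 1/H and H. Quasi-uniformity bounds H by some Hm depending on the
    domain, and H <= Hm^2 / H leaves a multiple of 1/H. *)

Definition cube p r : set 'rV[R]_n := [set x | forall i, `|x 0 i - p 0 i| <= r].

Lemma nbhs_cubeP x (A : set 'rV[R]_n) :
  nbhs x A <-> exists2 e, 0 < e & cube x e `<=` A.
Proof.
split=> [/nbhs_ballP[e /= e0 eA]|[e e0 eA]].
  exists (e / 2); first by rewrite divr_gt0.
  move=> y xy; apply: eA; split=> // i j; rewrite ord1 /ball/= distrC.
  by rewrite (le_lt_trans (xy j))// ltr_pdivrMr// ltr_pMr// ltr1n.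
apply/nbhs_ballP; exists e => //= y [_ xy]; apply: eA => i.
by rewrite distrC; exact/ltW/(xy 0 i).
Qed.

Lemma measurable_cube p r : measurable (cube p r).
Proof.
rewrite (_ : cube p r = \bigcap_(i in [set: 'I_n]) ((fun x : 'rV[R]_n => x 0 i) @^-1` `[p 0 i - r, p 0 i + r])).
  apply: fin_bigcap_measurable => //= i _.
  rewrite -[X in measurable X]setTI; exact: measurable_rV_coord.
apply/seteqP; split=> x /= h i => [_|]; last first.
  by have := h i Logic.I; rewrite /= in_itv/= ler_distl.
by rewrite /= in_itv/= -ler_distl.
Qed.

Lemma rat_cube x e : 0 < e ->
  exists (q : 'rV[rat]_n), cube (map_mx ratr q) e x.
Proof.
move=> e0.
have h i : exists q : rat, `|x 0 i - ratr q| <= e.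
  have /rat_in_itvoo[q] : x 0 i - e < x 0 i + e by rewrite ltrBlDr -addrA ltrDl addr_gt0.
  rewrite in_itv/= => /andP[h1 h2]; exists q.
  by rewrite distrC ler_distl !ltW.
exists (\row_i projT1 (cid (h i))) => i; rewrite !mxE.
by case: cid.
Qed.

(** The sigma-algebra is generated by the coordinates, so openness has to be reduced to countably
    many boxes: an open set is the union of the cubes with rational centre and radius 1/(k+1) that
    it contains. *)
Lemma open_measurable_rV (A : set 'rV[R]_n) : open A -> measurable A.
Proof.
move=> oA.
rewrite (_ : A = \bigcup_(i in [set: 'rV[rat]_n * nat])
   (if pselect (cube (map_mx ratr i.1) i.2.+1%:R^-1 `<=` A)
    then cube (map_mx ratr i.1) i.2.+1%:R^-1 else set0)); last first.
  apply/seteqP; split=> [x Ax|x [[q k] _]/=]; last by case: pselect => //= sub; apply: sub.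
  have /nbhs_cubeP[e e0 eA] : nbhs x A by exact: open_nbhs_nbhs.
  (* A cube of radius below e / 2 that contains x lies in the cube of radius e around x. *)
  have [k ke] : exists k : nat, k.+1%:R^-1 < e / 2.
    exists (Num.truncn (e / 2)^-1).
    rewrite -[ltRHS]invrK ltf_pV2 ?posrE ?invr_gt0 ?divr_gt0//.
    exact: truncnS_gt.
  have [q qx] : exists q : 'rV[rat]_n, cube (map_mx ratr q) k.+1%:R^-1 x.
    by apply: rat_cube; rewrite invr_gt0.
  exists (q, k) => //=; case: pselect => // -[].
  move=> y qy; apply: eA => i.
  have -> : y 0 i - x 0 i = (y 0 i - ratr (q 0 i)) - (x 0 i - ratr (q 0 i)).
    by rewrite opprB addrA subrK.
  rewrite (le_trans (ler_normB _ _))// [leRHS](splitr e) lerD//.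
    by have := qy i; rewrite mxE => /le_trans; apply; exact: ltW.
  by have := qx i; rewrite mxE => /le_trans; apply; exact: ltW.
apply: countable_bigcupT_measurable => // i.
by case: pselect => [?|?]/=; [exact: measurable_cube|exact: measurable0].
Qed.

Lemma continuous_measurable_rV (f : 'rV[R]_n -> R) :
  continuous f -> measurable_fun setT f.
Proof.
move=> cf; apply: (measurability _ (RGenOInfty.measurableE R)) => //.
move=> _ [_ [a ->] <-]; rewrite setTI; apply: open_measurable_rV.
by apply: open_comp => //= x _; exact: cf.
Qed.

End rV_topology.

(** * Tonelli's theorem for product functions and the volume of cubes *)

Section tensor.
Variable R : realType.
Local Open Scope ereal_scope.

(** The measure in dimension [n.+1] is by construction the image of a product measure under
    [rV_cons]: a change of variables, then Tonelli. *)
Lemma integral_lebesgue_rVS n (f : 'rV[R]_n.+1 -> \bar R) :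
  measurable_fun setT f -> (forall x, 0 <= f x) ->
  \int[lebesgue_rV R n.+1]_x f x =
  \int[lebesgue_measure]_a \int[lebesgue_rV R n]_x f (rV_cons (a, x)).
Proof.
move=> mf f0.
pose h (p : measurableTypeR R * 'rV[R]_n) := f (rV_cons p).
have mh : measurable_fun setT h.
  by apply: measurableT_comp => //; exact: measurable_rV_cons.
pose leb : {sigma_finite_measure set (measurableTypeR R) -> \bar R} := lebesgue_measure.
transitivity (\int[leb \x lebesgue_rV R n]_p h p); last first.
  by rewrite fubini_tonelli1//= => x; exact: f0.
have := @ge0_integral_pushforward _ _ (measurableTypeR R * 'rV[R]_n)%type _ R
  (@rV_cons R n) (@measurable_rV_cons R n) (leb \x lebesgue_rV R n)%E setT f measurableT mf (fun y _ => f0 y).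
by rewrite preimage_setT => <-.
Qed.

Lemma integral_rV_prod n (g : 'I_n -> R -> R) :
  (forall i, measurable_fun setT (g i)) -> (forall i x, (0 <= g i x)%R) ->
  \int[lebesgue_rV R n]_x (\prod_i g i (x ord0 i))%:E =
  \prod_i \int[lebesgue_measure]_t (g i t)%:E.
Proof.
elim: n g => [|n IH] g mg g0.
  (* In dimension 0 the measure is a Dirac mass, whose total mass 1 matches the empty product. *)
  rewrite big_ord0 (_ : (fun _ => _) = cst 1); last first.
    by apply/funext => x; rewrite big_ord0.
  by rewrite integral_cst//= diracE/= mul1e mem_setT.
have mP k (h : 'I_k -> R -> R) : (forall i, measurable_fun setT (h i)) ->
   measurable_fun setT (fun x : 'rV[R]_k => (\prod_i h i (x ord0 i))%:E).
  move=> mh; apply/measurable_EFinP.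
  rewrite (_ : (fun _ => _) = fun x : 'rV[R]_k => (\prod_(i <- index_enum 'I_k) h i (x ord0 i))%R)//.
  apply: measurable_prod => i _ _.
  exact: (measurableT_comp (mh i) (@measurable_rV_coord R k i)).
rewrite integral_lebesgue_rVS//; last 2 first.
- exact: mP.
- by move=> x; rewrite lee_fin prodr_ge0.
rewrite big_ord_recl -IH//.
rewrite -ge0_integralZr//; last 3 first.
- by apply/measurable_EFinP; exact: mg.
- by move=> x _; rewrite lee_fin.
- by apply: integral_ge0 => x _; rewrite lee_fin prodr_ge0.
apply: eq_integral => a _.
rewrite -ge0_integralZl_EFin//; last 2 first.
- by move=> x _; rewrite lee_fin prodr_ge0.
- by apply: (mP n (fun i => g (lift ord0 i))).
apply: eq_integral => x _; rewrite -EFinM big_ord_recl; congr (_ * _)%:E.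
  by rewrite -[X in g _ (rV_cons _ _ X)](_ : lshift n (ord0 : 'I_1) = ord0) ?rV_consEl//; exact: val_inj.
apply: eq_bigr => i _; congr (g _ _).
by rewrite -(rV_consEr (a,x)); congr (rV_cons _ _ _); exact: val_inj.
Qed.

Lemma lebesgue_cube n (p : 'rV[R]_n) r : (0 <= r)%R ->
  lebesgue_rV R n (cube p r) = ((r *+ 2) ^+ n)%:E.
Proof.
move=> r0.
rewrite -[LHS]mul1e -integral_cst; last exact: measurable_cube.
rewrite integral_mkcond.
rewrite (_ : (_ \_ _) = fun x : 'rV[R]_n => (\prod_i (\1_(`[p ord0 i - r, p ord0 i + r]) (x ord0 i) : R))%:E); last first.
  apply/funext => x; rewrite patchE; case: ifPn => [/set_mem h|h].
    rewrite big1// => i _; rewrite indicE mem_set//= in_itv/= -ler_distl; exact: h.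
  have [i hi] : exists i, ~~ (`|x ord0 i - p ord0 i| <= r)%R.
    apply/existsP; rewrite -negb_forall; apply: contra h => /forallP h; apply/mem_set.
    by move=> i; exact: h.
  rewrite (bigD1 i)//= indicE memNset ?mul0r//= in_itv/= -ler_distl; exact/negP.
rewrite (@integral_rV_prod n (fun i => \1_([set` `[(p ord0 i - r)%R, (p ord0 i + r)%R]] : set R)))//.
rewrite (eq_bigr (fun=> (r *+ 2)%:E)) => [|i _].
  by rewrite prodEFin prodr_const card_ord.
rewrite integral_indic// setIT.
have := @lebesgue_measure_itv R `[(p ord0 i - r)%R, (p ord0 i + r)%R].
rewrite /= lte_fin => ->.
have [r00|r00] := ltP (p ord0 i - r)%R (p ord0 i + r)%R.
  by rewrite -EFinB; congr EFin; ring.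
by rewrite (_ : r = 0%R) ?mul0rn//; lra.
Qed.

End tensor.

(** * Borel sets are Caratheodory measurable for Hausdorff measures *)

Section hausdorff_metric.
Variables (R : realType) (d : nat).
Local Open Scope ereal_scope.
Implicit Types (S A B X : set 'rV[R]_d).

Lemma hausdorff_gauge0 s delta : hausdorff_gauge s delta (set0 : set 'rV[R]_d) = 0.
Proof. by rewrite /hausdorff_gauge eqxx. Qed.

Lemma hausdorff_cst_ge0 s : (0 <= hausdorff_cst R s)%R.
Proof. by rewrite /hausdorff_cst divr_ge0 ?exprn_ge0 ?fine_ge0. Qed.

Lemma enorm_ge0 (x : 'rV[R]_d) : (0 <= enorm x)%R.
Proof. exact: sqrtr_ge0. Qed.

Lemma dotv_ge0 (x : 'rV[R]_d) : (0 <= dotv x x)%R.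
Proof. by apply: sumr_ge0 => i _; rewrite -expr2 sqr_ge0. Qed.

Lemma diam_ge0 S : S !=set0 -> 0 <= diam S.
Proof.
move=> [x Sx]; apply: le_trans (ereal_sup_ubound _); last by exists (x, x).
by rewrite lee_fin enorm_ge0.
Qed.

Lemma hausdorff_gauge_ge0 s delta S : 0 <= hausdorff_gauge s delta S.
Proof.
rewrite /hausdorff_gauge; case: eqVneq => // /set0P S0; case: ifP => // _.
rewrite lee_fin mulr_ge0 ?hausdorff_cst_ge0// exprn_ge0// fine_ge0//.
exact: diam_ge0.
Qed.

Lemma le_hausdorff_gauge s delta1 delta2 S : (delta1 <= delta2)%R ->
  hausdorff_gauge s delta2 S <= hausdorff_gauge s delta1 S.
Proof.
move=> dd; rewrite /hausdorff_gauge; case: eqVneq => // _.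
have [h1|_] := leP (diam S) delta1%:E; last by rewrite leey.
by rewrite (le_trans h1)// lee_fin.
Qed.

Lemma enorm_le_diam S x y : S x -> S y -> (enorm (x - y))%:E <= diam S.
Proof. by move=> Sx Sy; apply: ereal_sup_ubound; exists (x, y). Qed.

(** At scales below [delta] a covering set meeting both A and B has diameter above the scale, hence
    gauge +oo. A cover of finite cost therefore splits into a cover of A and one of B. *)
Lemma hausdorff_metric s A B (delta : R) : (0 < delta)%R ->
  (forall x y, A x -> B y -> (delta <= enorm (x - y))%R) ->
  hausdorff s A + hausdorff s B <= hausdorff s (A `|` B).
Proof.
move=> delta0 sepAB.
(* The two scales stay independent, so that the suprema defining the two terms can be taken one
   after the other. *)
have key d1 d2 : (0 < d1)%R -> (0 < d2)%R ->
    mu_ext (hausdorff_gauge s d1) A + mu_ext (hausdorff_gauge s d2) B <=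
    hausdorff s (A `|` B).
  move=> d10 d20; pose m := Num.min d1 (Num.min d2 (delta / 2)%R).
  have m0 : (0 < m)%R by rewrite !lt_min d10 d20 divr_gt0.
  apply: le_trans (ereal_sup_ubound _); last by exists m.
  apply: le_ereal_inf_tmp => _ [E [mE AE] <-].
  pose restr S k := if `[< E k `&` S !=set0 >] then E k else set0.
  have mr S k : measurable (restr S k).
    by rewrite /restr; case: ifP => _; [exact: mE|exact: measurable0].
  have cr S : S `<=` A `|` B -> S `<=` \bigcup_k restr S k.
    move=> SAB x Sx; have [k _ Ek] := AE _ (SAB _ Sx); exists k => //.
    by rewrite /restr ifT//; apply/asboolP; exists x.
  have h1 : mu_ext (hausdorff_gauge s d1) A <= \sum_(0 <= k <oo) hausdorff_gauge s m (restr A k).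
    apply: (@le_trans _ _ (\sum_(0 <= k <oo) hausdorff_gauge s d1 (restr A k))).
      by apply: ereal_inf_lbound; exists (restr A) => //; split => //; apply: cr; left.
    apply: lee_nneseries => [k _ _|k _]; first exact: hausdorff_gauge_ge0.
    by apply: le_hausdorff_gauge; rewrite ge_min lexx.
  have h2 : mu_ext (hausdorff_gauge s d2) B <= \sum_(0 <= k <oo) hausdorff_gauge s m (restr B k).
    apply: (@le_trans _ _ (\sum_(0 <= k <oo) hausdorff_gauge s d2 (restr B k))).
      by apply: ereal_inf_lbound; exists (restr B) => //; split => //; apply: cr; right.
    apply: lee_nneseries => [k _ _|k _]; first exact: hausdorff_gauge_ge0.
    by apply: le_hausdorff_gauge; rewrite !ge_min lexx orbT.
  apply: le_trans (leeD h1 h2) _.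
  rewrite -nneseriesD; [|by move=> *; exact: hausdorff_gauge_ge0..].
  apply: lee_nneseries => [k _ _|k _].
    by rewrite adde_ge0// hausdorff_gauge_ge0.
  rewrite /restr; case: ifPn => [/asboolP hA|_]; last first.
    rewrite hausdorff_gauge0 add0e; case: ifP => // _.
    by rewrite hausdorff_gauge0 hausdorff_gauge_ge0.
  case: ifPn => [/asboolP hB|_]; last by rewrite hausdorff_gauge0 adde0.
  suff -> : hausdorff_gauge s m (E k) = +oo by rewrite leey.
  have [x [Ex Ax]] := hA; have [y [Ey By]] := hB.
  rewrite /hausdorff_gauge ifN; last by apply/set0P; exists x.
  rewrite ifN// -ltNge; apply: lt_le_trans (enorm_le_diam Ex Ey).
  rewrite lte_fin (lt_le_trans _ (sepAB _ _ Ax By))//.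
  rewrite !gt_min [X in [|| _, _ | X]](_ : _ = true) ?orbT//.
  by rewrite ltr_pdivrMr// ltr_pMr// ltr1n.
have nneg S : 0 <= hausdorff s S by exact: outer_measure_ge0.
have [fAB|] := ltP (hausdorff s (A `|` B)) +oo; last by rewrite leye_eq => /eqP ->; rewrite leey.
have fB : hausdorff s B \is a fin_num.
  rewrite ge0_fin_numE//; apply: le_lt_trans fAB.
  by apply: le_outer_measure => x; right.
rewrite -leeBrDr//; apply: ge_ereal_sup => _ [d1 /= d10 <-].
rewrite leeBrDr// addeC -leeBrDr; last first.
  rewrite ge0_fin_numE; last exact: (mu_ext_ge0 (hausdorff_gauge_ge0 s d1)).
  apply: le_lt_trans fAB; apply: le_trans (key d1 1%R d10 _) => //.
  by rewrite leeDl// (mu_ext_ge0 (hausdorff_gauge_ge0 s _)).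
apply: ge_ereal_sup => _ [d2 /= d20 <-].
rewrite leeBrDr; first by rewrite addeC; exact: key.
rewrite ge0_fin_numE; last exact: (mu_ext_ge0 (hausdorff_gauge_ge0 s d1)).
apply: le_lt_trans fAB; apply: le_trans (key d1 1%R d10 _) => //.
by rewrite leeDl// (mu_ext_ge0 (hausdorff_gauge_ge0 s _)).
Qed.

(** Caratheodory's criterion, with a 1-Lipschitz [phi] in the place of the distance to a closed set.
    The sets [Bn] keep a positive distance from the sublevel set and exhaust its complement in X;
    the shells [Rg] between them have summable measure, so the measures of the [Bn] tend to that of
    [B]. *)
Lemma hausdorff_sublevel_caratheodory s (phi : 'rV[R]_d -> R) :
  (forall x y, `|phi x - phi y| <= enorm (x - y))%R ->
  (hausdorff s).-caratheodory [set x | (phi x <= 0)%R].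
Proof.
move=> lip; apply: le_caratheodory_measurable => X.
have nneg S : 0 <= hausdorff s S by exact: outer_measure_ge0.
have [fX|] := ltP (hausdorff s X) +oo; last by rewrite leye_eq => /eqP XE; rewrite [leRHS]XE leey.
have fin S : S `<=` X -> hausdorff s S \is a fin_num.
  by move=> SX; rewrite ge0_fin_numE//; apply: le_lt_trans fX; exact: le_outer_measure.
set A := X `&` _; set B := X `&` _.
pose Bn n : set 'rV[R]_d := X `&` [set x | (n.+1%:R^-1 <= phi x)%R].
pose Rg n := Bn n.+1 `\` Bn n.
have BnX n : Bn n `<=` X by move=> x [].
have RgX n : Rg n `<=` X by move=> x [[]].
pose a n := fine (hausdorff s (Bn n)).
have aE n : hausdorff s (Bn n) = (a n)%:E by rewrite fineK// fin.
have invS n : (n.+2%:R^-1 < n.+1%:R^-1 :> R)%R by rewrite ltf_pV2 ?posrE// ltr_nat.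
have Bnm n : Bn n `<=` Bn n.+1.
  by move=> x [Xx /= h]; split => //=; rewrite (le_trans _ h)// ltW.
(* [Rg n.+1] and [Bn n] are separated by the shell in between, so their measures add up inside
   [Bn n.+2]. *)
have ring n : hausdorff s (Rg n.+1) <= (a n.+2 - a n)%:E.
  rewrite EFinB leeBrDr// -!aE.
  apply: (le_trans (@hausdorff_metric s (Rg n.+1) (Bn n) (n.+1%:R^-1 - n.+2%:R^-1)%R _ _)).
  - by rewrite subr_gt0.
  - move=> x y [[Xx /= h1] h2] [Xy /= h3].
    apply: le_trans (lip x y); rewrite distrC (le_trans _ (ler_norm _))// lerB//.
    by rewrite leNgt; apply/negP => h4; apply: h2; split => //=; exact: ltW.
  - by apply: le_outer_measure => x [[]//|/Bnm/Bnm].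
have a_le n : (a n <= fine (hausdorff s X))%R.
  by rewrite fine_le ?fin//; exact: le_outer_measure.
have BE N : B `<=` Bn N.+1 `|` \bigcup_n Rg (n + N).+1.
  move=> x [Xx /= /negP]; rewrite -ltNge => px.
  have [k kx] : exists k : nat, (k.+1%:R^-1 <= phi x)%R.
    exists (Num.truncn (phi x)^-1); rewrite -[leRHS]invrK lef_pV2 ?posrE ?invr_gt0//.
    exact/ltW/truncnS_gt.
  have [kN|Nk] := leqP k N.+1.
    left; split=> //=; rewrite (le_trans _ kx)// lef_pV2 ?posrE//.
    by rewrite ler_nat ltnS.
  have ex : exists k, (k.+1%:R^-1 <= phi x)%R by exists k.
  case: (ex_minnP ex) => j jx jmin.
  have [jN|Nj] := leqP j N.+1.
    left; split=> //=; rewrite (le_trans _ jx)// lef_pV2 ?posrE//.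
    by rewrite ler_nat ltnS.
  right; exists (j - N.+2)%N => //.
  case: j jx jmin Nj => // j jx jmin Nj.
  have -> : (j.+1 - N.+2 + N).+1 = j by rewrite subSS -addnS subnK.
  split; first by split.
  by case=> _ /= /jmin; rewrite ltnn.
pose sa := sup (range a).
have hsa : has_sup (range a).
  split; first by exists (a 0%N), 0%N.
  by exists (fine (hausdorff s X)) => _ [n _ <-].
have le_sa n : (a n <= sa)%R by apply: sup_ubound; [exact: hsa.2|exists n].
have psum N m : (\sum_(0 <= n < m) (a (n + N).+2 - a (n + N)) = a (m + N).+1 + a (m + N) - a N.+1 - a N)%R.
  elim: m => [|m IH]; first by rewrite big_geq// add0n; ring.
  by rewrite big_nat_recr//= IH addSn; ring.
(* Steps of length two telescope to two end terms, each at most [sa]. Since [a N] tends to [sa], so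
   does this bound. *)
have Bbound N : hausdorff s B <= (sa *+ 2 - a N)%:E.
  apply: (@le_trans _ _ (hausdorff s (Bn N.+1) + \sum_(0 <= n <oo) hausdorff s (Rg (n + N).+1))).
    apply: le_trans (le_outer_measure _ _ _ (BE N)) _.
    apply: le_trans (outer_measureU2 _ _ _) _.
    by rewrite leeD2l//; exact: outer_measure_sigma_subadditive.
  rewrite aE (_ : (sa *+ 2 - a N)%:E = (a N.+1)%:E + (sa *+ 2 - a N.+1 - a N)%:E); last first.
    by rewrite -EFinD; congr EFin; ring.
  rewrite leeD2l//.
  apply: lime_le; first exact: is_cvg_nneseries.
  apply: nearW => m.
  apply: (@le_trans _ _ (\sum_(0 <= n < m) (a (n + N).+2 - a (n + N))%:E)).
    by apply: lee_sum => n _; exact: ring.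
  rewrite sumEFin lee_fin psum.
  have := le_sa (m + N)%N; have := le_sa (m + N).+1; lra.
apply/lee_addgt0Pr => e e0.
have e20 : (0 < e / 2)%R by rewrite divr_gt0.
have [_ [N _ <-] aN] := sup_adherent e20 hsa.
apply: (@le_trans _ _ (hausdorff s A + ((a N)%:E + e%:E))).
  rewrite leeD2l// (le_trans (Bbound N))// -EFinD lee_fin.
  move: aN; rewrite -/sa => aN; lra.
rewrite addeA leeD2r// -aE.
apply: (le_trans (@hausdorff_metric s A (Bn N) N.+1%:R^-1 _ _)).
- by rewrite invr_gt0.
- move=> x y [Xx /= h1] [Xy /= h2]; apply: le_trans (lip x y).
  by rewrite distrC (le_trans _ (ler_norm _))// lerBrDr (le_trans _ h2)// gerDl.
- by apply: le_outer_measure => x [[]|[]].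
Qed.

Lemma enorm_coord (x : 'rV[R]_d) i : (`|x ord0 i| <= enorm x)%R.
Proof.
rewrite -sqrtr_sqr ler_sqrt ?dotv_ge0// /dotv (bigD1 i)//= -expr2 lerDl.
by apply: sumr_ge0 => j _; rewrite -expr2 sqr_ge0.
Qed.

(** Coordinates are 1-Lipschitz, so the identity is measurable from the Caratheodory sigma-algebra
    to the one generated by the coordinates. *)
Lemma measurable_hausdorff s (A : set 'rV[R]_d) :
  measurable A -> (hausdorff s).-caratheodory A.
Proof.
have m : measurable_fun setT (id : caratheodory_type (@hausdorff R d s) -> 'rV[R]_d).
  apply: measurable_fun_rV => i.
  apply: (measurability _ (RGenOInfty.measurableE R)) => //.
  move=> _ [_ [a ->] <-]; rewrite setTI.
  rewrite (_ : _ @^-1` _ = ~` [set x : 'rV[R]_d | x ord0 i - a <= 0]%R).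
    apply: measurableC; apply: hausdorff_sublevel_caratheodory => x y.
    rewrite opprB addrA subrK; apply: le_trans (enorm_coord _ i).
    by rewrite !mxE.
  apply/seteqP; split => x /=; rewrite in_itv/= andbT subr_le0 ltNge; first by move/negP.
  by move/negP.
by move=> mA; have := m measurableT A mA; rewrite setTI preimage_id.
Qed.

End hausdorff_metric.

(** * Nearest-point projection onto a compact convex set *)

Section projection.
Variables (R : realType) (n : nat).
Implicit Types (x y z q c : 'rV[R]_n) (C : set 'rV[R]_n).

Lemma dotvC x y : dotv x y = dotv y x.
Proof. by apply: eq_bigr => i _; rewrite mulrC. Qed.

Lemma dotvDl x y z : dotv (x + y) z = dotv x z + dotv y z.
Proof. by rewrite -big_split; apply: eq_bigr => i _; rewrite mxE mulrDl. Qed.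

Lemma dotvZl a x y : dotv (a *: x) y = a * dotv x y.
Proof. by rewrite mulr_sumr; apply: eq_bigr => i _; rewrite mxE mulrA. Qed.

Lemma dotvNl x y : dotv (- x) y = - dotv x y.
Proof. by rewrite -scaleN1r dotvZl mulN1r. Qed.

Lemma dotvDr x y z : dotv z (x + y) = dotv z x + dotv z y.
Proof. by rewrite dotvC dotvDl !(dotvC _ z). Qed.

Lemma dotvZr a x y : dotv y (a *: x) = a * dotv y x.
Proof. by rewrite dotvC dotvZl (dotvC _ y). Qed.

Lemma dotvNr x y : dotv y (- x) = - dotv y x.
Proof. by rewrite dotvC dotvNl (dotvC _ y). Qed.

Definition dotvE := (dotvDl, dotvDr, dotvZl, dotvZr, dotvNl, dotvNr).

Lemma dotv_subZ x y t :
  dotv (x - t *: y) (x - t *: y) = dotv x x - 2 * t * dotv x y + t * (t * dotv y y).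
Proof. by rewrite !dotvE (dotvC y x); ring. Qed.

Lemma dotv_le0 x : dotv x x <= 0 -> x = 0.
Proof.
move=> h; have /eqP : dotv x x == 0 by rewrite eq_le h dotv_ge0.
move/psumr_eq0P => h0; apply/rowP => i; rewrite mxE.
have /eqP := h0 (fun i _ => ltac:(rewrite -expr2; exact: sqr_ge0)) i isT.
by rewrite mulf_eq0 orbb => /eqP.
Qed.

Lemma continuous_coord i : continuous (fun x : 'rV[R]_n => x 0 i).
Proof. exact: coord_continuous. Qed.

Lemma continuous_dotv_sub q : continuous (fun c => dotv (q - c) (q - c)).
Proof.
apply: continuous_big => [|i _ c]; first exact: add_continuous.
have h1 : {for c, continuous (fun x : 'rV[R]_n => x 0 i)} by exact: continuous_coord.
have h2 : {for c, continuous (fun=> q 0 i : R)} by exact: cst_continuous.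
have h : {for c, continuous (fun x : 'rV[R]_n => (q - x) 0 i)}.
  rewrite (_ : (fun x : 'rV[R]_n => _) = (fun=> q 0 i) - (fun x => x 0 i)).
    exact: continuousB h2 h1.
  by apply/funext => x; rewrite !mxE.
exact: (cvgM h h).
Qed.

Definition convexv C := forall x y (t : R), 0 <= t <= 1 -> C x -> C y ->
  C (x + t *: (y - x)).

(** The variational characterization of the nearest point. Unlike minimality, it visibly persists
    when q moves along the ray from c through q. *)
Definition is_proj C q c := C c /\ forall z, C z -> dotv (q - c) (z - c) <= 0.

Lemma is_proj_exists C q : compact C -> convexv C -> C !=set0 ->
  exists2 c, is_proj C q c & forall z, C z -> dotv (q - c) (q - c) <= dotv (q - z) (q - z).
Proof.
move=> cC cvC C0.
have [c /set_mem Cc minc] := EVT_min_rV C0 cC (continuous_subspaceT (@continuous_dotv_sub q)).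
exists c; last by move=> z Cz; apply: minc; exact: mem_set.
split=> // z Cz; rewrite leNgt; apply/negP => pos.
pose u := q - c; pose v := z - c.
have vv : 0 < dotv v v.
  rewrite lt_neqAle dotv_ge0 andbT; apply/eqP => v0.
  have : v = 0 by apply: dotv_le0; rewrite -v0.
  by rewrite -/u -/v in pos => v00; move: pos; rewrite v00 /dotv big1 ?ltxx// => i _; rewrite [X in _ * X]mxE mulr0.
(* The minimizer of |u - t v|^2 over real t, cut off at 1 to stay on the segment from c to z; the
   value there is below |u|^2. *)
pose t := Num.min 1 (dotv u v / dotv v v).
have t0 : 0 < t by rewrite lt_min ltr01 divr_gt0.
have t1 : 0 <= t <= 1 by rewrite ltW//= ge_min lexx.
have := minc _ (mem_set (cvC _ _ _ t1 Cc Cz)).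
rewrite (_ : q - (c + t *: (z - c)) = u - t *: v); last by rewrite opprD addrA.
rewrite -/u dotv_subZ.
have tle : t * dotv v v <= dotv u v.
  by rewrite -ler_pdivlMr// ge_min lexx orbT.
have : t * (t * dotv v v) <= t * dotv u v by rewrite ler_pM2l.
have : 0 < t * dotv u v by rewrite mulr_gt0.
nra.
Qed.

(** Testing each variational inequality with the other projection and adding gives |c - c'|^2 <= (q
    - q').(c - c'). *)
Lemma is_proj_lip C q c q' c' : is_proj C q c -> is_proj C q' c' ->
  dotv (c - c') (c - c') <= dotv (q - q') (q - q').
Proof.
move=> [Cc hc] [Cc' hc']; have := hc _ Cc'; have := hc' _ Cc.
have := dotv_ge0 ((q - q') - (c - c')).
rewrite !dotvE (dotvC c q) (dotvC c' q') (dotvC c' c) (dotvC c' q) (dotvC c q') (dotvC q' q).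
lra.
Qed.

Lemma dotv_le (x : 'rV[R]_n) (e : R) : 0 <= e -> (forall i, `|x 0 i| <= e) ->
  dotv x x <= n%:R * e ^+ 2.
Proof.
move=> e0 h; apply: (@le_trans _ _ (\sum_(i < n) e ^+ 2)).
  apply: ler_sum => i _; rewrite -expr2 -real_normK ?num_real//.
  by rewrite lerXn2r ?nnegrE//; exact: h.
by rewrite sumr_const card_ord mulr_natl.
Qed.

Lemma enorm_le_sqr x (e : R) : 0 <= e -> (enorm x <= e) = (dotv x x <= e ^+ 2).
Proof.
move=> e0; rewrite -(@ler_pXn2r _ 2)// ?nnegrE ?enorm_ge0//.
by rewrite /enorm sqr_sqrtr// dotv_ge0.
Qed.

Lemma enorm_le_coord (x : 'rV[R]_n) (e : R) : 0 <= e -> (forall i, `|x 0 i| <= e) ->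
  enorm x <= n%:R * e.
Proof.
move=> e0 h; rewrite enorm_le_sqr ?mulr_ge0//; apply: le_trans (dotv_le e0 h) _.
rewrite exprMn; apply: ler_wpM2r; first exact: sqr_ge0.
by rewrite -natrX ler_nat; case: (n) => // k; rewrite expnS leq_pmulr// expn_gt0.
Qed.

Lemma diam_closure (S : set 'rV[R]_n) (e : R) : 0 <= e ->
  (forall x y, S x -> S y -> enorm (x - y) <= e) -> (diam (closure S) <= e%:E)%E.
Proof.
move=> e0 h.
have cl y : closed [set x | dotv (y - x) (y - x) <= e ^+ 2].
  rewrite (_ : [set x | _] = (fun x => dotv (y - x) (y - x)) @^-1` [set z | z <= e ^+ 2])//.
  by apply: (preimage_closed _ (@closed_le _ _)) => x _; exact: continuous_dotv_sub.
have h1 y : S y -> closure S `<=` [set x | dotv (y - x) (y - x) <= e ^+ 2].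
  move=> Sy; rewrite (closure_id [set x | _]).1; last exact: cl.
  by apply: closure_subset => x Sx /=; rewrite -enorm_le_sqr//; exact: h.
have h2 x : closure S x -> closure S `<=` [set y | dotv (x - y) (x - y) <= e ^+ 2].
  move=> Sx; rewrite (closure_id [set x | _]).1; last exact: cl.
  apply: closure_subset => y Sy /=; have := h1 _ Sy _ Sx => /=.
  by rewrite -opprB dotvNl dotvNr opprK.
apply: ge_ereal_sup => _ [[x y] [/= Sx Sy] <-].
by rewrite lee_fin enorm_le_sqr//; exact: h2.
Qed.

End projection.

(** * Surface growth of convex boundaries: at most r^n in a cube of radius r *)

Section ahlfors.
Variables (R : realType).

(** A finite cover, continued by empty sets of gauge 0, is an admissible sequence; its cost is a
    cardinality times one gauge value. *)
Lemma hausdorff_le_cover d s (S : set 'rV[R]_d) (c : R) :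
  (forall delta, 0 < delta -> exists (J : finType) (E : J -> set 'rV[R]_d) (eta : R),
    [/\ 0 <= eta <= delta, forall j, measurable (E j),
        forall j, (diam (E j) <= eta%:E)%E, S `<=` \bigcup_j E j &
        #|J|%:R * (hausdorff_cst R s * eta ^+ s) <= c]) ->
  (hausdorff s S <= c%:E)%E.
Proof.
move=> h; apply: ge_ereal_sup => _ [delta /= delta0 <-].
have [J [E [eta [/andP[eta0 etad] mE dE SE cE]]]] := h _ delta0.
pose F k := nth set0 [seq E j | j <- enum J] k.
have sz : size [seq E j | j <- enum J] = #|J| by rewrite size_map -cardE.
have FE k : F k = set0 \/ exists j, F k = E j.
  have [kJ|Jk] := ltnP k #|J|; last by left; rewrite /F nth_default ?sz.
  right; have /mapP[j _ ->] : F k \in [seq E j | j <- enum J] by rewrite mem_nth ?sz.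
  by exists j.
apply: (@le_trans _ _ (\sum_(0 <= k <oo) hausdorff_gauge s delta (F k))%E).
  apply: ereal_inf_lbound; exists F => //; split=> [k|x /SE[j _ Ejx]].
    by have [->|[j ->]] := FE k; [exact: measurable0|exact: mE].
  have /(nthP set0)[k k1 k2] : E j \in [seq E j | j <- enum J] by rewrite map_f// mem_enum.
  by exists k => //; rewrite /F k2.
have g0 k : (0 <= hausdorff_gauge s delta (F k))%E by exact: hausdorff_gauge_ge0.
rewrite (nneseries_split 0%N #|J|)//= add0n eseries0 ?adde0; last first.
  by move=> k Jk _; rewrite /F nth_default ?sz// hausdorff_gauge0.
apply: (@le_trans _ _ (\sum_(0 <= k < #|J|) (hausdorff_cst R s * eta ^+ s)%:E)%E); last first.
  by rewrite sumEFin lee_fin sumr_const_nat subn0 -mulr_natl.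
apply: lee_sum => k _.
have c0 : 0 <= hausdorff_cst R s * eta ^+ s by rewrite mulr_ge0 ?hausdorff_cst_ge0 ?exprn_ge0.
have [->|[j ->]] := FE k; first by rewrite hausdorff_gauge0 lee_fin.
rewrite /hausdorff_gauge; case: eqVneq => [_|/set0P E0]; first by rewrite lee_fin.
rewrite ifT; last by rewrite (le_trans (dE j))// lee_fin.
rewrite lee_fin ler_wpM2l ?hausdorff_cst_ge0// lerXn2r ?nnegrE//.
  by rewrite fine_ge0// diam_ge0.
rewrite -[leRHS]/(fine eta%:E) fine_le ?dE//.
by rewrite ge0_fin_numE ?diam_ge0// (le_lt_trans (dE j))// ltry.
Qed.

Lemma subdivision_mem (k : nat) (h z : R) : 0 < h -> 0 <= z <= k.+1%:R * h ->
  exists m : 'I_k.+1, m%:R * h <= z <= m.+1%:R * h.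
Proof.
move=> h0 /andP[z0 z1].
have zh0 : 0 <= z / h by rewrite divr_ge0// ltW.
have [tk|kt] := leqP (Num.truncn (z / h)) k.
  exists (Ordinal (tk : (Num.truncn (z / h) < k.+1)%N)) => /=.
  have /andP[a b] := truncn_itv zh0.
  by rewrite -ler_pdivlMr// a/= -ler_pdivrMr// ltW.
(* The right end point has truncated quotient [k.+1] and goes to the last cell. *)
exists ord_max => /=; rewrite z1 andbT.
have /andP[a b] := truncn_itv zh0.
rewrite -ler_pdivlMr// (le_trans _ a)// ler_nat ltnW//.
Qed.

Variable n : nat.
Implicit Types (p q c x : 'rV[R]_n.+1) (K C : set 'rV[R]_n.+1).

Definition face p (r : R) : set 'rV[R]_n.+1 :=
  [set q | cube p r q /\ exists i, `|q 0 i - p 0 i| = r].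

(** The index consists of the normal direction of a face, its side, and one of the (k+1)^n grid
    cells of that face. *)
Definition face_cell p r (k : nat) (j : 'I_n.+1 * bool * {ffun 'I_n -> 'I_k.+1}) :
    set 'rV[R]_n.+1 :=
  [set q | q 0 j.1.1 = p 0 j.1.1 + (-1) ^+ j.1.2 * r /\
    forall l, let t := r *+ 2 / k.+1%:R in
      let z := q 0 (lift j.1.1 l) - (p 0 (lift j.1.1 l) - r) in
      (j.2 l)%:R * t <= z <= (j.2 l).+1%:R * t].

Lemma face_cellP p r k q : 0 < r -> face p r q -> exists j : 'I_n.+1 * bool * {ffun 'I_n -> 'I_k.+1}, face_cell p r j q.
Proof.
move=> r0 [qc [i qi]].
have t0 : 0 < r *+ 2 / k.+1%:R by rewrite divr_gt0// pmulrn_lgt0.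
have h l : exists m : 'I_k.+1,
    m%:R * (r *+ 2 / k.+1%:R) <= q 0 (lift i l) - (p 0 (lift i l) - r) <= m.+1%:R * (r *+ 2 / k.+1%:R).
  apply: subdivision_mem => //; rewrite mulrC divfK//.
  have := qc (lift i l); rewrite ler_norml => /andP[a b].
  by apply/andP; split; lra.
pose b := q 0 i < p 0 i.
exists (i, b, [ffun l => projT1 (cid (h l))]); split => /= [|l].
  move: qi; rewrite /b; case: ltP => qp.
    by rewrite expr1 ltr0_norm ?subr_lt0// => <-; ring.
  by rewrite expr0 ger0_norm ?subr_ge0// => <-; ring.
by rewrite ffunE; case: cid.
Qed.

Lemma face_cell_diam p r k (j : 'I_n.+1 * bool * {ffun 'I_n -> 'I_k.+1}) q q' : 0 < r -> face_cell p r j q -> face_cell p r j q' ->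
  enorm (q - q') <= n.+1%:R * (r *+ 2 / k.+1%:R).
Proof.
move=> r0 [qi ql] [qi' ql'].
have t0 : 0 < r *+ 2 / k.+1%:R by rewrite divr_gt0// pmulrn_lgt0.
apply: enorm_le_coord => [|i]; first exact: ltW.
rewrite !mxE; case: (unliftP j.1.1 i) => [l ->|->]; last first.
  by rewrite qi qi' subrr normr0 ltW.
have /= := ql l; have /= := ql' l; rewrite -!natr1 !mulrDl !mul1r.
move=> /andP[a b] /andP[a' b']; rewrite ler_norml; apply/andP; split; lra.
Qed.

Lemma ray_face p r c u : u != 0 -> cube p r c ->
  exists2 s, 0 <= s & face p r (c + s *: u).
Proof.
move=> u0 cc.
have [i0 ui0] : exists i, u 0 i != 0.
  apply/existsP; apply: contraNT u0; rewrite negb_exists => /forallP h.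
  by apply/eqP/rowP => i; rewrite mxE; apply/eqP; have := h i; rewrite negbK.
(* The time at which the ray leaves the slab in direction i; the earliest exit time over all slabs
   leads to a face of the cube. *)
pose T i := (p 0 i + Num.sg (u 0 i) * r - c 0 i) / u 0 i.
have T0 i : u 0 i != 0 -> 0 <= T i.
  move=> ui; have := cc i; rewrite ler_norml => /andP[a b].
  rewrite /T; have [ul|ug|ue] := ltgtP (u 0 i) 0.
  - by rewrite ltr0_sg// nmulr_lge0 ?invr_lt0//; lra.
  - by rewrite gtr0_sg// mulr_ge0 ?invr_ge0 ?(ltW ug)//; lra.
  - by rewrite ue eqxx in ui.
have [i ui mini] := @arg_minP _ _ _ i0 (fun i => u 0 i != 0) T ui0.
exists (T i); first exact: T0.
have TE : c 0 i + T i * u 0 i = p 0 i + Num.sg (u 0 i) * r.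
  by rewrite /T divfK//; ring.
split=> [j|].
  rewrite !mxE; have := cc j; rewrite !ler_norml => /andP[a b].
  have [uj|uj] := eqVneq (u 0 j) 0; first by rewrite uj mulr0 addr0 a b.
  have : T i <= (p 0 j + Num.sg (u 0 j) * r - c 0 j) / u 0 j := mini _ uj.
  have := T0 _ ui.
  have [ul|ug|ue] := ltgtP (u 0 j) 0.
  - rewrite (ltr0_sg ul) (ler_ndivlMr _ _ ul) => h1 h2.
    have := mulr_ge0_le0 h1 (ltW ul); move=> h3; apply/andP; split; lra.
  - rewrite (gtr0_sg ug) (ler_pdivlMr _ _ ug) => h1 h2.
    have := mulr_ge0 h1 (ltW ug); move=> h3; apply/andP; split; lra.
  - by rewrite ue eqxx in uj.
exists i; rewrite !mxE TE addrAC subrr add0r normrM normr_sg ui mul1r ger0_norm//.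
exact: le_trans (normr_ge0 _) (cc i).
Qed.

(** There are 2(n+1) faces with (k+1)^n cells of diameter at most (n+1) 2r/(k+1) each; in the n-th
    power of the diameter the factor k+1 cancels. *)
Definition ahlfors_cst : R :=
  (n.+1 * 2)%:R * (hausdorff_cst R n * (n.+1%:R * 2) ^+ n).

Lemma compact_cube p r : compact (cube p r).
Proof.
rewrite (_ : cube p r = [set v : 'rV[R]_n.+1 | forall i, `[p 0 i - r, p 0 i + r]%classic (v ord0 i)]).
  by apply: (@rV_compact _ _ (fun i => `[p 0 i - r, p 0 i + r]%classic)) => i; exact: segment_compact.
by apply/seteqP; split=> x h i; have := h i; rewrite /= in_itv/= ler_distl.
Qed.

(* The nearest-point projection onto K intersected with the cube does not increase
   distances, and it maps the boundary of the cube onto a set whose closure contains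
   the boundary points of K, so a grid on the faces of the cube yields a cover. *)
Lemma ahlfors_convex K x r : closed K -> convexv K -> 0 < r ->
  (hausdorff n ((K `\` K°) `&` cube x r) <= (ahlfors_cst * r ^+ n)%:E)%E.
Proof.
move=> clK cvK r0; pose C := K `&` cube x r.
have cC : compact C.
  by rewrite /C setIC; apply: compact_closedI => //; exact: compact_cube.
have cvC : convexv C.
  move=> a b t t01 [Ka ca] [Kb cb]; split; first exact: cvK.
  move=> i; rewrite !mxE; have := ca i; have := cb i; rewrite !ler_norml.
  move: t01 => /andP[? ?] /andP[? ?] /andP[? ?].
  apply/andP; split; nra.
apply: hausdorff_le_cover => delta delta0.
have [k kd] : exists k : nat, n.+1%:R * (r *+ 2 / k.+1%:R) <= delta.
  exists (Num.truncn (n.+1%:R * (r *+ 2) / delta)).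
  rewrite mulrA ler_pdivrMr// -ler_pdivrMl// [leLHS]mulrC.
  exact/ltW/truncnS_gt.
have t0 : 0 < r *+ 2 / k.+1%:R by rewrite divr_gt0// pmulrn_lgt0.
pose P (j : 'I_n.+1 * bool * {ffun 'I_n -> 'I_k.+1}) := [set c | exists2 q, face_cell x r j q & is_proj C q c].
(* Closures keep the diameter bound, make the sets measurable, and catch the boundary points, which
   are only known to be limits of projected face points. *)
exists _, (fun j => closure (P j)), (n.+1%:R * (r *+ 2 / k.+1%:R)); split.
- by rewrite kd andbT mulr_ge0// ltW.
- move=> j; rewrite -[closure _]setCK; apply: measurableC; apply: open_measurable_rV.
  exact: closed_openC (@closed_closure _ (P j)).
- move=> j; apply: diam_closure => [|c c' [q fq qc] [q' fq' qc']].
    by rewrite mulr_ge0// ltW.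
  have e0 : 0 <= n.+1%:R * (r *+ 2 / k.+1%:R) by rewrite mulr_ge0// ltW.
  rewrite enorm_le_sqr//; apply: le_trans (is_proj_lip qc qc') _.
  by rewrite -enorm_le_sqr//; exact: (face_cell_diam r0 fq fq').
- move=> p [[Kp pK] xp].
  have Cp : C p by split.
  have : closure (\bigcup_j P j) p.
    move=> B /nbhs_cubeP[e e0 eB].
    (* A point y outside K within e' of p has its projection c within (n+1) e' of itself, hence
       within (n+2) e' = e of p. *)
    pose e' := e / (n.+2%:R).
    have e'0 : 0 < e' by rewrite divr_gt0.
    have [y yK yp] : exists2 y, ~ K y & cube p e' y.
      apply: contrapT => h; apply: pK; apply/nbhs_cubeP; exists e' => // y yp.
      by apply: contrapT => yK; apply: h; exists y.
    have [c pc minc] := is_proj_exists y cC cvC (ex_intro _ p Cp).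
    have yc : y - c != 0.
      rewrite subr_eq0; apply/eqP => ycE; apply: yK; rewrite ycE.
      by case: pc => -[].
    have [s s0 fs] := ray_face yc pc.1.2.
    have [j jP] := face_cellP k r0 fs.
    exists c; split.
      exists j => //; exists (c + s *: (y - c)) => //; split; first exact: pc.1.
      (* Along the ray from c through y the variational inequality is only multiplied by s >= 0, so
         the face point that the ray hits projects to c as well. *)
      move=> z Cz; rewrite [c + _]addrC addrK dotvZl.
      by rewrite mulr_ge0_le0//; exact: pc.2.
    apply: eB => i.
    have h1 : enorm (y - c) <= n.+1%:R * e'.
      have ne0 : 0 <= n.+1%:R * e' by rewrite mulr_ge0// ltW.
      rewrite enorm_le_sqr//; apply: le_trans (minc _ Cp) _.
      rewrite -enorm_le_sqr//; apply: enorm_le_coord (ltW e'0) _ => l.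
      by rewrite !mxE; exact: yp.
    have h2 := le_trans (enorm_coord (y - c) i) h1.
    have := yp i; rewrite !mxE in h2 => h3.
    have -> : e = n.+1%:R * e' + e'.
      by rewrite /e' -[X in _ + X]mul1r -mulrDl natr1 mulrC divfK.
    rewrite (_ : c 0 i - p 0 i = - (y 0 i - c 0 i) + (y 0 i - p 0 i)); last by ring.
    by rewrite (le_trans (ler_normD _ _))// normrN lerD.
  have : closed (\bigcup_j closure (P j)).
    by apply: closed_bigcup => [|j _]; [exact: finite_finset|exact: closed_closure].
  move=> clU; rewrite [X in _ -> X](_ : _ = closure (\bigcup_j closure (P j)) p).
    by apply: closure_subset => z [j _ Pz]; exists j => //; exact: subset_closure.
  by rewrite -(closure_id _).1.
- rewrite !card_prod card_ord card_bool card_ffun !card_ord /ahlfors_cst.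
  rewrite le_eqVlt; apply/orP; left; apply/eqP.
  rewrite natrM natrX !exprMn exprVn -[r *+ 2]mulr_natl exprMn; field.
  by rewrite expf_neq0.
Qed.

End ahlfors.

(** * A smooth step and bump on the real line *)

Section smooth_step.
Variable R : realType.
Implicit Types (f g : R -> R) (x : R).

Definition has_deriv f f' := forall x, is_derive x (1 : R) f (f' x).

Lemma has_derivD f f' g g' : has_deriv f f' -> has_deriv g g' ->
  has_deriv (fun x => f x + g x) (fun x => f' x + g' x).
Proof. by move=> df dg x; exact: (is_deriveD (df x) (dg x)). Qed.

Lemma has_derivM f f' g g' : has_deriv f f' -> has_deriv g g' ->
  has_deriv (fun x => f x * g x) (fun x => f' x * g x + f x * g' x).
Proof.
move=> df dg x; apply: (is_derive_eq (is_deriveM (df x) (dg x))).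
by rewrite /GRing.scale/= addrC mulrC.
Qed.

Lemma has_derivZ a f f' : has_deriv f f' -> has_deriv (fun x => a * f x) (fun x => a * f' x).
Proof. by move=> df x; exact: (is_deriveZ a (df x)). Qed.

Lemma has_derivV f f' : (forall x, f x != 0) -> has_deriv f f' ->
  has_deriv (fun x => (f x)^-1) (fun x => - (f' x * ((f x)^-1 * (f x)^-1))).
Proof.
move=> f0 df x; apply: (is_derive_eq (is_deriveV (f0 x) (df x))).
by rewrite /GRing.scale/= mulNr [in RHS]mulrC expr2 invfM.
Qed.

Lemma has_deriv_affine a b f f' : has_deriv f f' ->
  has_deriv (fun x => f (a * x + b)) (fun x => a * f' (a * x + b)).
Proof.
move=> df x.
have da : is_derive x (1 : R) (fun x => a * x + b) (a *: 1 + 0).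
  exact: (is_deriveD (is_deriveZ a (is_derive_id x (1 : R))) (is_derive_cst b x (1 : R))).
apply: (is_derive_eq (is_derive1_comp (df _) da)).
by rewrite addr0 /GRing.scale/= mulr1 mulrC.
Qed.

Fixpoint diffk (k : nat) f : Prop :=
  if k is k'.+1 then exists f', has_deriv f f' /\ diffk k' f' else True.

Lemma diffkS k f : diffk k.+1 f -> diffk k f.
Proof. by elim: k f => [|k IH] f //= [f' [df h]]; exists f'; split => //; exact: IH. Qed.

Lemma diffkD k f g : diffk k f -> diffk k g -> diffk k (fun x => f x + g x).
Proof.
elim: k f g => [|k IH] f g //= [f' [df hf]] [g' [dg hg]].
by exists (fun x => f' x + g' x); split; [exact: has_derivD|exact: IH].
Qed.

Lemma diffkZ k a f : diffk k f -> diffk k (fun x => a * f x).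
Proof.
elim: k f => [|k IH] f //= [f' [df hf]].
by exists (fun x => a * f' x); split; [exact: has_derivZ|exact: IH].
Qed.

Lemma diffkM k f g : diffk k f -> diffk k g -> diffk k (fun x => f x * g x).
Proof.
elim: k f g => [|k IH] f g //= F G; have [f' [df hf]] := F; have [g' [dg hg]] := G.
exists (fun x => f' x * g x + f x * g' x); split; first exact: has_derivM.
by apply: diffkD; apply: IH => //; exact: diffkS.
Qed.

Lemma diffkV k f : (forall x, f x != 0) -> diffk k f -> diffk k (fun x => (f x)^-1).
Proof.
move=> f0; elim: k => [|k IH] //= F; have [f' [df hf]] := F.
exists (fun x => - (f' x * ((f x)^-1 * (f x)^-1))); split; first exact: has_derivV.
have -> : (fun x => - (f' x * ((f x)^-1 * (f x)^-1))) = (fun x => -1 * (f' x * ((f x)^-1 * (f x)^-1))).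
  by apply/funext => x; rewrite mulN1r.
have F' := IH (diffkS F).
by apply: diffkZ; do 2 apply: diffkM => //.
Qed.

Lemma diffk_affine k a b f : diffk k f -> diffk k (fun x => f (a * x + b)).
Proof.
elim: k f => [|k IH] f //= [f' [df hf]].
exists (fun x => a * f' (a * x + b)); split; first exact: has_deriv_affine.
by apply: diffkZ; exact: IH.
Qed.

Lemma has_deriv_continuous f f' : has_deriv f f' -> continuous f.
Proof.
move=> df x; apply: differentiable_continuous; apply/derivable1_diffP.
by case: (df x).
Qed.

(** The functions x^(-n) exp(-1/x), extended by 0. The whole family is needed because derivatives of
    its members are combinations of members, so that smoothness follows by induction. *)
Definition flat n x : R := if 0 < x then (x^-1) ^+ n * expR (- x^-1) else 0.

Lemma flat_ge0 n x : 0 <= flat n x.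
Proof.
by rewrite /flat; case: ltP => // x0; rewrite mulr_ge0 ?expR_ge0// exprn_ge0// invr_ge0 ltW.
Qed.

(** From exp(y) >= y^(n+2)/(n+2)! at y = 1/x. The quadratic order makes the difference quotient at 0
    vanish in the limit. *)
Lemma flat_le n x : 0 < x -> flat n x <= (n.+2)`!%:R * x ^+ 2.
Proof.
move=> x0; rewrite /flat x0 expRN ler_pdivrMr ?expR_gt0//.
have xi0 : 0 <= x^-1 by rewrite invr_ge0 ltW.
have h := expR_ge1Dxn n.+1 xi0.
have f0 : 0 < (n.+2)`!%:R :> R by rewrite ltr0n fact_gt0.
apply: (@le_trans _ _ ((n.+2)`!%:R * x ^+ 2 * (x^-1 ^+ n.+2 / (n.+2)`!%:R))); last first.
  apply: ler_wpM2l; first by rewrite mulr_ge0 ?sqr_ge0 ?(ltW f0).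
  by apply: (le_trans _ h); rewrite lerDr.
rewrite (_ : _ * _ = (x * x^-1) ^+ 2 * (x^-1 ^+ n * ((n.+2)`!%:R / (n.+2)`!%:R))).
  by rewrite divff ?gt_eqF// divff ?gt_eqF// expr1n mul1r mulr1.
by set f := (n.+2)`!%:R; rewrite !exprS; ring.
Qed.

Lemma is_derive_cvg0 f x l :
  h^-1 *: (f (h *: (1 : R) + x) - f x) @[h --> 0^'] --> l -> is_derive x (1 : R) f l.
Proof.
move=> fl; apply: DeriveDef; first by apply/cvg_ex; exists l.
exact: cvg_lim.
Qed.

Lemma has_deriv_flat n : has_deriv (flat n) (fun x => - n%:R * flat n.+1 x + flat n.+2 x).
Proof.
move=> x; have [x0|x0|->] := ltgtP x 0.
- rewrite /flat !ltNge !(ltW x0)/= mulr0 addr0.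
  apply: (near_eq_is_derive _ (is_derive_cst 0 x (1 : R))).
  near=> y; rewrite /flat ltNge ifN// negbK ltW//.
  by near: y; exact: (lt_nbhsl x0).
- have xn0 : x != 0 by rewrite gt_eqF.
  have dV : is_derive x (1 : R) (fun x => x^-1) (- x^-1 ^+ 2).
    apply: (is_derive_eq (is_deriveV xn0 (is_derive_id x (1 : R)))).
    by rewrite /GRing.scale/= mulr1 exprVn.
  have dE : is_derive x (1 : R) (fun x => expR (- x^-1)) (expR (- x^-1) * x^-1 ^+ 2).
    apply: (is_derive_eq (is_derive1_comp (is_derive_expR _) (is_deriveN dV))).
    by rewrite opprK.
  apply: (@near_eq_is_derive _ _ _ (fun x => (x^-1) ^+ n * expR (- x^-1))).
    near=> y; rewrite /flat ifT//.
    by near: y; exact: (lt_nbhsr x0).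
  have dX : is_derive x (1 : R) (fun y => y^-1 ^+ n) (n%:R * x^-1 ^+ n.-1 * - x^-1 ^+ 2).
    rewrite (_ : (fun y => _) = (fun y : R => y^-1) ^+ n); last first.
      by apply/funext => y; rewrite exprfctE.
    by apply: (is_derive_eq (is_deriveX n dV)).
  apply: (is_derive_eq (is_deriveM dX dE)).
  rewrite /flat x0 /GRing.scale/= !exprS.
  clear dX; case: n => [|n]; first by rewrite !expr0 !mul0r /=; ring.
  by rewrite /= !exprS; ring.
- apply: is_derive_cvg0.
  rewrite /flat ltxx mulr0 addr0.
  have c0 : 0 < (n.+2)`!%:R :> R by rewrite ltr0n fact_gt0.
  apply/cvgrPdist_le => e e0; near=> h.
  rewrite addr0 subr0 sub0r normrN /GRing.scale/= mulr1.
  have h0 : h != 0 by near: h; exact: nbhs_dnbhs_neq.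
  have he : `|h| <= e / (n.+2)`!%:R.
    near: h; apply: dnbhs0_le; exact: divr_gt0.
  case: ifPn => [hp|_]; last by rewrite mulr0 normr0 ltW.
  have := flat_le n hp; rewrite /flat hp => h1.
  rewrite ger0_norm; last first.
    rewrite mulr_ge0 ?invr_ge0 ?(ltW hp)//.
    by have := flat_ge0 n h; rewrite /flat hp.
  rewrite ler_pdivrMl//; apply: le_trans h1 _.
  rewrite expr2 mulrA mulrC ler_pM2l//.
  by move: he; rewrite gtr0_norm// ler_pdivlMr// mulrC.
Unshelve. all: by end_near. Qed.

Lemma diffk_flat k n : diffk k (flat n).
Proof.
elim: k n => [|k IH] n //=.
exists (fun x => - n%:R * flat n.+1 x + flat n.+2 x); split; first exact: has_deriv_flat.
by apply: diffkD => //; exact: diffkZ.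
Qed.

Lemma flat_gt0 n x : 0 < x -> 0 < flat n x.
Proof. by move=> x0; rewrite /flat x0 mulr_gt0 ?expR_gt0// exprn_gt0// invr_gt0. Qed.

Lemma flat_eq0 n x : x <= 0 -> flat n x = 0.
Proof. by move=> x0; rewrite /flat ltNge x0. Qed.

Lemma flat_sum_neq0 x : flat 0 (1 * x + 1) + flat 0 (-1 * x + 1) != 0.
Proof.
have [x0|x0] := leP 0 x.
  by rewrite gt_eqF// ltr_pwDl ?flat_ge0//; apply: flat_gt0; lra.
by rewrite gt_eqF// ltr_wpDl ?flat_ge0//; apply: flat_gt0; lra.
Qed.

(** The quotient f(1+x) / (f(1+x) + f(1-x)) with f(x) = exp(-1/x), rising from 0 at -1 to 1 at 1;
    the arguments have the shape [a * x + b] of [diffk_affine]. *)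
Definition step x : R := flat 0 (1 * x + 1) * (flat 0 (1 * x + 1) + flat 0 (-1 * x + 1))^-1.

(** The derivative of [step] by the quotient rule, [flat 2] being the derivative of [flat 0]; as
    such it has integral 1 without normalization, and an antiderivative bounded by 1. *)
Definition bump_fun x : R :=
  (flat 2 (1 * x + 1) * flat 0 (-1 * x + 1) + flat 0 (1 * x + 1) * flat 2 (-1 * x + 1)) *
  ((flat 0 (1 * x + 1) + flat 0 (-1 * x + 1))^-1 * (flat 0 (1 * x + 1) + flat 0 (-1 * x + 1))^-1).

Lemma diffk_step k : diffk k step.
Proof.
apply: diffkM; first exact/diffk_affine/diffk_flat.
apply: diffkV; first exact: flat_sum_neq0.
by apply: diffkD; exact/diffk_affine/diffk_flat.
Qed.

Lemma has_deriv_step : has_deriv step bump_fun.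
Proof.
move=> x.
have d0 : has_deriv (flat 0) (flat 2).
  move=> y; apply: (is_derive_eq (has_deriv_flat 0 y)).
  by rewrite oppr0 mul0r add0r.
have d1 := has_deriv_affine 1 1 d0; have d2 := has_deriv_affine (-1) 1 d0.
have d3 := has_derivV flat_sum_neq0 (has_derivD d1 d2).
apply: (is_derive_eq (has_derivM d1 d3 x)); rewrite /bump_fun.
have := flat_sum_neq0 x.
set E := flat 0 (1 * x + 1); set F := flat 0 (-1 * x + 1).
by move=> h; field.
Qed.

Lemma has_deriv_unique f f1 f2 : has_deriv f f1 -> has_deriv f f2 -> f1 = f2.
Proof.
move=> h1 h2; apply/funext => x.
by rewrite -(@derive_val _ _ _ _ _ _ _ (h1 x)) -(@derive_val _ _ _ _ _ _ _ (h2 x)).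
Qed.

Lemma diffk_bump k : diffk k bump_fun.
Proof.
have [f' [df hf]] := diffk_step k.+1.
by rewrite (has_deriv_unique has_deriv_step df).
Qed.

Lemma bump_ge0 x : 0 <= bump_fun x.
Proof.
rewrite /bump_fun -expr2 mulr_ge0 ?sqr_ge0//.
by rewrite addr_ge0// mulr_ge0// flat_ge0.
Qed.

Lemma bump_eq0 x : 1 <= `|x| -> bump_fun x = 0.
Proof.
rewrite ler_normr => /orP[h|h]; rewrite /bump_fun.
  by rewrite !(@flat_eq0 _ (-1 * x + 1)) ?mulr0 ?add0r ?mul0r//; lra.
by rewrite !(@flat_eq0 _ (1 * x + 1)) ?mul0r ?add0r ?mul0r//; lra.
Qed.

Lemma step_eq0 x : x <= -1 -> step x = 0.
Proof. by move=> h; rewrite /step (@flat_eq0 _ (1 * x + 1)) ?mul0r//; lra. Qed.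

Lemma step_eq1 x : 1 <= x -> step x = 1.
Proof.
move=> h; have := flat_sum_neq0 x.
by rewrite /step (@flat_eq0 _ (-1 * x + 1)) ?addr0; [move=> ?; rewrite divff|lra].
Qed.

Lemma step_ge0_le1 x : 0 <= step x <= 1.
Proof.
have S0 : 0 < flat 0 (1 * x + 1) + flat 0 (-1 * x + 1).
  by rewrite lt_neqAle eq_sym flat_sum_neq0/= addr_ge0 ?flat_ge0.
rewrite /step; apply/andP; split; first by rewrite mulr_ge0 ?flat_ge0// invr_ge0 ltW.
by rewrite ler_pdivrMr// [leRHS]mul1r lerDl flat_ge0.
Qed.

Lemma bump_bounded : exists2 B, 0 < B & forall x, bump_fun x <= B.
Proof.
have cb : continuous bump_fun.
  by have [f' [df _]] := diffk_bump 1; exact: has_deriv_continuous df.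
have [c _ hc] := EVT_max (ltW (gtrN (ltr01 : 0 < 1 :> R))) (continuous_subspaceT cb).
exists (bump_fun c + 1); first by rewrite ltr_wpDl ?bump_ge0.
move=> x; have [x1|x1] := leP 1 `|x|.
  by rewrite bump_eq0// addr_ge0 ?bump_ge0.
rewrite (le_trans (hc x _))// ?lerDl// in_itv/=.
by rewrite -ler_norml ltW.
Qed.

Lemma integral_bump p s : 0 < s ->
  (\int[lebesgue_measure]_t (s^-1 * bump_fun (s^-1 * t - s^-1 * p))%:E = 1)%E.
Proof.
move=> s0; have si0 : 0 < s^-1 by rewrite invr_gt0.
pose F t := step (s^-1 * t + (- (s^-1 * p))).
pose f t := s^-1 * bump_fun (s^-1 * t + (- (s^-1 * p))).
have dF : has_deriv F f by exact: has_deriv_affine has_deriv_step.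
have cF := has_deriv_continuous dF.
have cf : continuous f.
  have [g [dg _]] : diffk 1 f by apply: diffkZ; exact/diffk_affine/diffk_bump.
  exact: has_deriv_continuous dg.
have ps : p - s < p + s by lra.
have Z x : ~~ (x \in `[p - s, p + s]) -> f x = 0.
  rewrite in_itv/= -ler_distl -ltNge => h.
  rewrite /f bump_eq0 ?mulr0// -mulrBr normrM gtr0_norm//.
  by rewrite ler_pdivlMl// mulr1 ltW.
transitivity (\int[lebesgue_measure]_(x in `[(p - s)%R, (p + s)%R]) (f x)%:E)%E.
  rewrite [RHS]integral_mkcond; apply: eq_integral => x _.
  rewrite patchE; case: ifPn => // h; congr (_%:E).
  by rewrite -[LHS]/(f x) Z//; apply: contra h => h; exact/mem_set.
rewrite (@continuous_FTC2 _ f F)//.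
- rewrite /F -EFinB step_eq1 ?step_eq0 ?subr0//.
  + by rewrite mulrBr mulVf ?gt_eqF//; lra.
  + by rewrite mulrDr mulVf ?gt_eqF//; lra.
- exact: continuous_subspaceT.
- split.
  + by move=> x _; by case: (dF x).
  + exact/cvg_at_right_filter/cF.
  + exact/cvg_at_left_filter/cF.
- by move=> x _; rewrite derive1E; by case: (dF x).
Qed.

End smooth_step.

(** * The L2 product on a measurable set *)

Section L2_theory.
Context dd (T : measurableType dd) (R : realType).
Variables (mu : {measure set T -> \bar R}).
Implicit Types (D : set T) (u v w : T -> R).

Lemma L2fun_mul_integrable D u v : measurable D -> L2fun mu D u -> L2fun mu D v ->
  mu.-integrable D (fun x => (u x * v x)%:E).
Proof.
move=> mD [mu1 iu] [mv iv].
have mu2 : measurable_fun D (fun x => (u x ^+ 2)%:E).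
  by apply/measurable_EFinP; exact: measurable_funX.
have mv2 : measurable_fun D (fun x => (v x ^+ 2)%:E).
  by apply/measurable_EFinP; exact: measurable_funX.
have I : mu.-integrable D (fun x => (u x ^+ 2)%:E + (v x ^+ 2)%:E)%E.
  apply/integrableP; split; first exact: emeasurable_funD.
  rewrite (_ : (\int[mu]_(x in D) _)%E = (\int[mu]_(x in D) (u x ^+ 2)%:E + \int[mu]_(x in D) (v x ^+ 2)%:E)%E).
    by rewrite lte_add_pinfty.
  rewrite -ge0_integralD//; [|by move=> x _; rewrite lee_fin sqr_ge0..].
  apply: eq_integral => x _; rewrite gee0_abs// -EFinD lee_fin.
  by rewrite addr_ge0// sqr_ge0.
apply: le_integrable I => //.
  by apply/measurable_EFinP; exact: measurable_funM.
move=> x _ /=; rewrite lee_fin [leRHS]ger0_norm ?addr_ge0 ?sqr_ge0// normrM.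
rewrite -(real_normK (num_real (u x))) -(real_normK (num_real (v x))).
have := sqr_ge0 (`|u x| - `|v x|); have := sqr_ge0 `|u x|; have := sqr_ge0 `|v x|.
rewrite !expr2; nra.
Qed.

Lemma L2fun_scale D a u : measurable D -> L2fun mu D u -> L2fun mu D (fun x => a * u x).
Proof.
move=> mD [mu1 iu]; split; first exact: measurable_funM.
rewrite (_ : (\int[mu]_(x in D) _)%E = ((a ^+ 2)%:E * \int[mu]_(x in D) (u x ^+ 2)%:E)%E).
  by rewrite lte_mul_pinfty// lee_fin sqr_ge0.
rewrite -ge0_integralZl_EFin ?sqr_ge0//.
- by apply: eq_integral => x _; rewrite -EFinM exprMn.
- by move=> x _; rewrite lee_fin sqr_ge0.
- by apply/measurable_EFinP; exact: measurable_funX.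
Qed.

Lemma L2fun_add D u v : measurable D -> L2fun mu D u -> L2fun mu D v ->
  L2fun mu D (fun x => u x + v x).
Proof.
move=> mD [mu1 iu] [mv iv]; split; first exact: measurable_funD.
have mu2 : measurable_fun D (fun x => (u x ^+ 2)%:E).
  by apply/measurable_EFinP; exact: measurable_funX.
have mv2 : measurable_fun D (fun x => (v x ^+ 2)%:E).
  by apply/measurable_EFinP; exact: measurable_funX.
apply: (@le_lt_trans _ _ (\int[mu]_(x in D) (2%:E * (u x ^+ 2)%:E + 2%:E * (v x ^+ 2)%:E))%E).
  apply: ge0_le_integral => //.
  - by move=> x _; rewrite lee_fin sqr_ge0.
  - by apply/measurable_EFinP; apply: measurable_funX; exact: measurable_funD.
  - by apply: emeasurable_funD; exact: measurable_funeM.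
  - move=> x _; rewrite -!EFinM -EFinD lee_fin.
    have := sqr_ge0 (u x - v x); rewrite !expr2; nra.
rewrite ge0_integralD//.
- rewrite !ge0_integralZl_EFin//; try by move=> x _; rewrite lee_fin sqr_ge0.
  by rewrite lte_add_pinfty// lte_mul_pinfty.
- by move=> x _; rewrite mule_ge0// lee_fin sqr_ge0.
- exact: measurable_funeM.
- by move=> x _; rewrite mule_ge0// lee_fin sqr_ge0.
- exact: measurable_funeM.
Qed.

Lemma L2fun_cst0 D : L2fun mu D (fun=> 0).
Proof.
split; first exact: measurable_cst.
by rewrite integral0_eq// => x _; rewrite expr0n.
Qed.

Lemma L2fun_sum D I (s : seq I) (f : I -> T -> R) : measurable D ->
  (forall i, L2fun mu D (f i)) -> L2fun mu D (fun x => \sum_(i <- s) f i x).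
Proof.
move=> mD h; elim: s => [|i s IH].
  by rewrite (_ : (fun x => _) = fun=> 0); [exact: L2fun_cst0|apply/funext => x; rewrite big_nil].
rewrite (_ : (fun x => _) = fun x => f i x + \sum_(j <- s) f j x).
  exact: L2fun_add.
by apply/funext => x; rewrite big_cons.
Qed.

Lemma L2fun_sub D u v : measurable D -> L2fun mu D u -> L2fun mu D v ->
  L2fun mu D (fun x => u x - v x).
Proof.
move=> mD hu hv; rewrite (_ : (fun x => _) = (fun x => u x + -1 * v x)).
  by apply: L2fun_add => //; exact: L2fun_scale.
by apply/funext => x; rewrite mulN1r.
Qed.

Lemma eq_L2fun D u v : {in D, u =1 v} -> L2fun mu D u -> L2fun mu D v.
Proof.
move=> uv [mu1 iu]; split; first exact: eq_measurable_fun mu1.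
rewrite (_ : (\int[mu]_(x in D) _)%E = (\int[mu]_(x in D) (u x ^+ 2)%:E)%E)//.
by apply: eq_integral => x xD; rewrite uv.
Qed.

Lemma L2funS D E u : measurable D -> measurable E -> E `<=` D -> L2fun mu D u -> L2fun mu E u.
Proof.
move=> mD mE ED [mu1 iu]; split; first exact: measurable_funS mu1.
apply: le_lt_trans iu; apply: ge0_subset_integral => //.
  by apply/measurable_EFinP; exact: measurable_funX.
by move=> x _; rewrite lee_fin sqr_ge0.
Qed.

Lemma bounded_L2fun D u (B : R) : measurable D -> (mu D < +oo)%E ->
  measurable_fun D u -> (forall x, D x -> `|u x| <= B) -> L2fun mu D u.
Proof.
move=> mD fD mu1 uB; split=> //.
apply: (@le_lt_trans _ _ (\int[mu]_(x in D) (B ^+ 2)%:E)%E).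
  apply: ge0_le_integral => //.
  - by move=> x _; rewrite lee_fin sqr_ge0.
  - by apply/measurable_EFinP; exact: measurable_funX.
  - move=> x Dx; rewrite lee_fin -real_normK ?num_real//.
    by rewrite lerXn2r ?nnegrE ?uB// (le_trans _ (uB _ Dx)).
by rewrite integral_cst// lte_mul_pinfty// lee_fin sqr_ge0.
Qed.

Lemma L2dotC D u v : L2dot mu D u v = L2dot mu D v u.
Proof. by apply: eq_Rintegral => x _; rewrite mulrC. Qed.

Lemma L2dot_addl D u v w : measurable D -> L2fun mu D u -> L2fun mu D v -> L2fun mu D w ->
  L2dot mu D (fun x => u x + v x) w = L2dot mu D u w + L2dot mu D v w.
Proof.
move=> mD hu hv hw; rewrite /L2dot -RintegralD//; try exact: L2fun_mul_integrable.
by apply: eq_Rintegral => x _; rewrite mulrDl.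
Qed.

Lemma L2dot_scalel D a u w : measurable D -> L2fun mu D u -> L2fun mu D w ->
  L2dot mu D (fun x => a * u x) w = a * L2dot mu D u w.
Proof.
move=> mD hu hw; rewrite /L2dot -RintegralZl//; try exact: L2fun_mul_integrable.
by apply: eq_Rintegral => x _; rewrite mulrA.
Qed.

Lemma L2dot_scaler D a u w : measurable D -> L2fun mu D u -> L2fun mu D w ->
  L2dot mu D w (fun x => a * u x) = a * L2dot mu D w u.
Proof. by move=> mD hu hw; rewrite L2dotC L2dot_scalel// L2dotC. Qed.

Lemma L2dot_suml D I (s : seq I) (f : I -> T -> R) w : measurable D ->
  (forall i, L2fun mu D (f i)) -> L2fun mu D w ->
  L2dot mu D (fun x => \sum_(i <- s) f i x) w = \sum_(i <- s) L2dot mu D (f i) w.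
Proof.
move=> mD h hw; elim: s => [|i s IH].
  rewrite big_nil /L2dot (_ : (fun x => _) = fun=> 0) ?Rintegral_cst// ?mul0r//.
  by apply/funext => x; rewrite big_nil mul0r.
rewrite big_cons -IH -L2dot_addl//; last exact: L2fun_sum.
by congr L2dot; apply/funext => x; rewrite big_cons.
Qed.

Lemma L2dot_subl D u v w : measurable D -> L2fun mu D u -> L2fun mu D v -> L2fun mu D w ->
  L2dot mu D (fun x => u x - v x) w = L2dot mu D u w - L2dot mu D v w.
Proof.
move=> mD hu hv hw; rewrite /L2dot -RintegralB//; try exact: L2fun_mul_integrable.
by apply: eq_Rintegral => x _; rewrite mulrBl.
Qed.

Lemma L2dot_ge0 D u : 0 <= L2dot mu D u u.
Proof. by apply: Rintegral_ge0 => x _; rewrite -expr2 sqr_ge0. Qed.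

Lemma L2dot_EFin D u : measurable D -> L2fun mu D u ->
  ((L2dot mu D u u)%:E = \int[mu]_(x in D) (u x ^+ 2)%:E)%E.
Proof.
move=> mD hu; rewrite /L2dot /Rintegral fineK.
  by apply: eq_integral => x _; rewrite -expr2.
exact/integrable_fin_num/L2fun_mul_integrable.
Qed.

Lemma eq_L2dot D u v u' v' : {in D, u =1 u'} -> {in D, v =1 v'} ->
  L2dot mu D u v = L2dot mu D u' v'.
Proof. by move=> h1 h2; apply: eq_Rintegral => x xD; rewrite h1// h2. Qed.

Lemma le_L2dot D u v : measurable D -> L2fun mu D u -> L2fun mu D v ->
  (forall x, D x -> `|u x| <= `|v x|) -> L2dot mu D u u <= L2dot mu D v v.
Proof.
move=> mD hu hv h; apply: le_Rintegral => //; try exact: L2fun_mul_integrable.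
move=> x Dx; rewrite -!expr2 -(real_normK (num_real (u x))) -(real_normK (num_real (v x))).
by rewrite lerXn2r ?nnegrE ?h.
Qed.

Lemma L2dotS D E u : measurable D -> measurable E -> E `<=` D -> L2fun mu D u ->
  L2dot mu E u u <= L2dot mu D u u.
Proof.
move=> mD mE ED hu; rewrite -lee_fin !L2dot_EFin//; last exact: L2funS hu.
apply: ge0_subset_integral => //.
  by apply/measurable_EFinP; apply: measurable_funX; case: hu.
by move=> x _; rewrite lee_fin sqr_ge0.
Qed.

Lemma L2dot_sqrD D u v : measurable D -> L2fun mu D u -> L2fun mu D v ->
  L2dot mu D (fun x => u x + v x) (fun x => u x + v x) =
  L2dot mu D u u + 2 * L2dot mu D u v + L2dot mu D v v.
Proof.
move=> mD hu hv; have huv := L2fun_add mD hu hv.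
by rewrite L2dot_addl// !(L2dotC _ _ (fun x => u x + v x)) !L2dot_addl// (L2dotC _ v u); ring.
Qed.

Lemma L2dot_sqrD_le D u v : measurable D -> L2fun mu D u -> L2fun mu D v ->
  L2dot mu D (fun x => u x + v x) (fun x => u x + v x) <=
  2 * L2dot mu D u u + 2 * L2dot mu D v v.
Proof.
move=> mD hu hv; rewrite L2dot_sqrD//.
have := L2dot_ge0 D (fun x => u x + -1 * v x).
rewrite L2dot_sqrD//; last exact: L2fun_scale.
have hNv := L2fun_scale (-1) mD hv.
by rewrite !(L2dot_scaler, L2dot_scalel)//; lra.
Qed.

Lemma L2dot_CS D u v : measurable D -> L2fun mu D u -> L2fun mu D v ->
  L2dot mu D u v ^+ 2 <= L2dot mu D u u * L2dot mu D v v.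
Proof.
move=> mD hu hv.
have h t : 0 <= L2dot mu D u u + 2 * (t * L2dot mu D u v) + t ^+ 2 * L2dot mu D v v.
  have := L2dot_ge0 D (fun x => u x + t * v x).
  have htv := L2fun_scale t mD hv.
  by rewrite L2dot_sqrD// !(L2dot_scaler, L2dot_scalel)// expr2 -mulrA.
(* If v.v = 0, the quadratic in [h] is affine in t, and a suitable t makes it negative unless u.v =
   0. *)
have [v0|v0] := eqVneq (L2dot mu D v v) 0.
  rewrite v0 mulr0; have [-> |uv0] := eqVneq (L2dot mu D u v) 0; first by rewrite expr0n.
  have := h (- (L2dot mu D u u + 1) / L2dot mu D u v); have := L2dot_ge0 D u.
  by rewrite v0 mulr0 addr0 divfK//; lra.
have vp : 0 < L2dot mu D v v by rewrite lt_neqAle eq_sym v0 L2dot_ge0.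
have := h (- L2dot mu D u v / L2dot mu D v v).
set a := L2dot mu D u u; set b := L2dot mu D u v; set c := L2dot mu D v v.
rewrite (_ : _ + _ = (a * c - b ^+ 2) / c); last first.
  by rewrite !expr2; field.
by rewrite pmulr_lge0 ?invr_gt0// subr_ge0.
Qed.

End L2_theory.

(** * Tensor-product test functions and mollifiers *)

Section tensor_test.
Variables (R : realType) (n : nat).
Implicit Types (g : 'I_n.+1 -> R -> R) (x p : 'rV[R]_n.+1).

Definition tensor g x : R := \prod_j g j (x 0 j).

Definition smooth1 (f : R -> R) := forall k, diffk k f.

Lemma smooth1_deriv f : smooth1 f -> exists2 f', has_deriv f f' & smooth1 f'.
Proof.
move=> sf; have [f' [df _]] := sf 1%N.
(* Each order of differentiability provides its own derivative; uniqueness identifies them all. *)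
exists f' => // k; have [f2 [df2 hf2]] := sf k.+1.
by rewrite (has_deriv_unique df df2).
Qed.

Lemma tensor_is_derive g (g' : R -> R) (i : 'I_n.+1) x : has_deriv (g i) g' ->
  is_derive x (delta_mx 0 i : 'rV[R]_n.+1) (tensor g)
    (tensor (fun j => if j == i then g' else g j) x).
Proof.
move=> dg; pose Q := \prod_(j | j != i) g j (x 0 j).
have -> : tensor (fun j => if j == i then g' else g j) x = g' (x 0 i) * Q.
  rewrite /tensor (bigD1 i)//= eqxx; congr (_ * _).
  by apply: eq_bigr => j /negbTE ->.
suff h : h^-1 *: (tensor g (h *: (delta_mx 0 i : 'rV[R]_n.+1) + x) - tensor g x) @[h --> 0^'] --> g' (x 0 i) * Q.
  by apply: DeriveDef; [apply/cvg_ex; exists (g' (x 0 i) * Q)|exact: cvg_lim].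
rewrite (_ : (fun h => _) = (fun h => (h^-1 *: (g i (h *: (1 : R) + x 0 i) - g i (x 0 i))) * Q)); last first.
  apply/funext => h; rewrite /tensor (bigD1 i)//= [X in _ - X](bigD1 i)//= -/Q.
  rewrite !mxE !eqxx /= (eq_bigr (fun j => g j (x 0 j))).
    by rewrite -/Q -mulrBl /GRing.scale/= mulrA.
  by move=> j ji; rewrite !mxE (negbTE ji) andbF mulr0 add0r.
apply: cvgMl; have [d1 d2] := dg (x 0 i).
by rewrite -d2; exact: d1.
Qed.

Lemma tensor_continuous g : (forall j, continuous (g j)) -> continuous (tensor g).
Proof.
move=> cg; apply: continuous_big => [|j _]; first exact: mul_continuous.
move=> x; apply: continuous_comp; [exact: coord_continuous|exact: cg].
Qed.

Lemma tensor_smooth g : (forall j, smooth1 (g j)) -> smooth (tensor g).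
Proof.
move=> sg k; elim: k g sg => [|k IH] g sg.
  by split => //; apply: tensor_continuous => j; have [f' /has_deriv_continuous] := smooth1_deriv (sg j).
split; first by apply: tensor_continuous => j; have [f' /has_deriv_continuous] := smooth1_deriv (sg j).
move=> i; have [g' dg sg'] := smooth1_deriv (sg i); split => [x|].
  by have [] := tensor_is_derive x dg.
rewrite (_ : partial i _ = tensor (fun j => if j == i then g' else g j)).
  by apply: IH => j; case: ifP.
by apply/funext => x; have [_ <-] := tensor_is_derive x dg.
Qed.

Lemma closed_cube p r : closed (cube p r).
Proof. by apply: compact_closed; [exact: norm_hausdorff|exact: compact_cube]. Qed.

Lemma tensor_support g p r : (forall j t, r < `|t - p 0 j| -> g j t = 0) ->
  forall x, ~ cube p r x -> tensor g x = 0.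
Proof.
move=> gs x; rewrite /cube/= => /existsNP[i /negP]; rewrite -ltNge => h.
by rewrite /tensor (bigD1 i)//= gs// mul0r.
Qed.

Lemma tensor_test U g p r : (forall j, smooth1 (g j)) ->
  (forall j t, r < `|t - p 0 j| -> g j t = 0) -> cube p r `<=` U ->
  test U (tensor g).
Proof.
move=> sg gs sU.
have cl : closure [set x | tensor g x != 0] `<=` cube p r.
  rewrite (closure_id (cube p r)).1; last exact: closed_cube.
  apply: closure_subset => x /= h; apply: contrapT => nx.
  by move: h; rewrite (tensor_support gs nx) eqxx.
split; first exact: tensor_smooth.
  apply: (subclosed_compact _ (@compact_cube _ _ p r)) => //; exact: closed_closure.
by move=> x /cl/sU.
Qed.

(* A difference of two tensor products of functions with equal integrals is a
   divergence of test functions, which a weak gradient can be tested against. *)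
Lemma tensor_telescope (b c B : 'I_n.+1 -> R -> R) : (forall j, has_deriv (B j) (fun t => c j t - b j t)) ->
  forall x, \sum_i partial i (tensor (fun j : 'I_n.+1 => if (j < i)%N then c j else if j == i then B j else b j)) x =
  tensor c x - tensor b x.
Proof.
move=> dB x.
(* Exchanging the factors [b j] for [c j] one at a time; each exchange is a partial derivative, with
   [B i] as antiderivative of the exchanged factor. *)
pose T (i : nat) := tensor (fun j : 'I_n.+1 => if (j < i)%N then c j else b j) x.
have TE (i : 'I_n.+1) : partial i (tensor (fun j : 'I_n.+1 => if (j < i)%N then c j else if j == i then B j else b j)) x = T i.+1 - T i.
  set G := fun j : 'I_n.+1 => _.
  have d : has_deriv (G i) (fun t => c i t - b i t) by rewrite /G ltnn eqxx; exact: dB.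
  have [_ dG] := tensor_is_derive x d; rewrite /partial dG /G.
  rewrite /T /tensor (bigD1 i)//= eqxx [X in _ = X - _](bigD1 i)//= [X in _ = _ - X](bigD1 i)//=.
  rewrite ltnn leqnn mulrBl; congr (_ * _ - _ * _).
    apply: eq_bigr => j ji; rewrite (negbTE ji); case: ltnP => ij.
      by rewrite ltnW//.
    rewrite ltnS leq_eqVlt; have -> : (j == i :> nat) = false by exact: negbTE ji.
    by rewrite ltnNge ij.
  by apply: eq_bigr => j ji; rewrite (negbTE ji).
rewrite (eq_bigr _ (fun i _ => TE i)) -(big_mkord xpredT (fun i => T i.+1 - T i)) telescope_sumr//.
by congr (_ - _); rewrite /T; apply: eq_bigr => j _; rewrite ?ltn_ord.
Qed.

Lemma smooth1_bump a b : smooth1 (fun t => a * bump_fun (a * t + b) : R).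
Proof. by move=> k; apply: diffkZ; exact/diffk_affine/diffk_bump. Qed.

Lemma smooth1_step_sub (a b a' b' : R) : smooth1 (fun t => step (a * t + b) - step (a' * t + b') : R).
Proof.
move=> k; rewrite (_ : (fun t => _) = (fun t => step (a * t + b) + -1 * step (a' * t + b'))).
  by apply: diffkD; [|apply: diffkZ]; exact/diffk_affine/diffk_step.
by apply/funext => t; rewrite mulN1r.
Qed.

(** Each factor is the derivative of [step] at (t - p_j)/s, which gives integral 1 and provides the
    antiderivatives for telescoping. *)
Definition mollifier p (s : R) : 'rV[R]_n.+1 -> R :=
  tensor (fun j t => s^-1 * bump_fun (s^-1 * t + - (s^-1 * p 0 j))).

Lemma bump_scale_eq0 (s q t : R) : 0 < s -> s <= `|t - q| -> bump_fun (s^-1 * t + - (s^-1 * q)) = 0.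
Proof.
move=> s0 h; apply: bump_eq0; rewrite -mulrBr normrM gtr0_norm ?invr_gt0//.
by rewrite ler_pdivlMl// mulr1.
Qed.

Lemma mollifier_ge0 p s x : 0 < s -> 0 <= mollifier p s x.
Proof. by move=> s0; apply: prodr_ge0 => j _; rewrite mulr_ge0 ?bump_ge0// invr_ge0 ltW. Qed.

Lemma mollifier_eq0 p s x : 0 < s -> ~ cube p s x -> mollifier p s x = 0.
Proof.
move=> s0; apply: tensor_support => j t h.
by rewrite bump_scale_eq0 ?mulr0// ltW.
Qed.

Lemma mollifier_continuous p s : continuous (mollifier p s).
Proof.
apply: tensor_continuous => j; have [f' /has_deriv_continuous] := smooth1_deriv (smooth1_bump s^-1 (- (s^-1 * p 0 j))).
by [].
Qed.

Lemma integral_mollifier p s : 0 < s ->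
  (\int[lebesgue_rV R n.+1]_x (mollifier p s x)%:E = 1)%E.
Proof.
move=> s0; rewrite (@integral_rV_prod _ _ (fun j t => s^-1 * bump_fun (s^-1 * t + - (s^-1 * p 0 j)))).
- rewrite big1// => j _; exact: integral_bump.
- move=> j; apply: continuous_measurable_fun.
  by have [f' /has_deriv_continuous] := smooth1_deriv (smooth1_bump s^-1 (- (s^-1 * p 0 j))).
- by move=> j t; rewrite mulr_ge0 ?bump_ge0// invr_ge0 ltW.
Qed.

End tensor_test.

(** * Weighted Cauchy-Schwarz inequality *)

Section finite_sums.
Variable R : realType.

(** With summable weights the first factor is bounded independently of N. In the induction the mixed
    term is absorbed by (x + y)^2 >= 4xy together with S^2 <= W T. *)
Lemma sqr_sum_le (N : nat) (w d : nat -> R) : (forall k, 0 < w k) ->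
  (\sum_(k < N) d k) ^+ 2 <= (\sum_(k < N) w k) * (\sum_(k < N) d k ^+ 2 / w k).
Proof.
move=> w0; elim: N => [|N IH]; first by rewrite !big_ord0 expr0n mul0r.
rewrite !big_ord_recr/=; move: IH.
have W0 : 0 <= \sum_(k < N) w k by apply: sumr_ge0 => k _; exact: ltW.
have T0 : 0 <= \sum_(k < N) d k ^+ 2 / w k.
  by apply: sumr_ge0 => k _; rewrite divr_ge0 ?sqr_ge0// ltW.
move: W0 T0 (w0 N); set W := \sum_(k < N) w k; set T := \sum_(k < N) _ / _; set S := \sum_(k < N) _.
move: (w N) (d N) => v e W0 T0 v0 h.
have -> : (W + v) * (T + e ^+ 2 / v) = W * T + (W * (e ^+ 2 / v) + v * T) + e ^+ 2.
  by field; rewrite gt_eqF.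
rewrite sqrrD lerD2r lerD//.
set X := _ + v * T.
have X0 : 0 <= X by rewrite addr_ge0// mulr_ge0 ?divr_ge0 ?sqr_ge0// ltW.
rewrite (le_trans (ler_norm _))// -(@ler_pXn2r _ 2) ?nnegrE// real_normK ?num_real//.
apply: (@le_trans _ _ (4 * (W * T) * e ^+ 2)).
  rewrite (_ : (_ *+ 2) ^+ 2 = 4 * S ^+ 2 * e ^+ 2); last by ring.
  by rewrite ler_wpM2r ?sqr_ge0// ler_wpM2l.
rewrite /X -subr_ge0; set Y := (_ - _).
have -> : Y = (W * (e ^+ 2 / v) - v * T) ^+ 2.
  by rewrite /Y !expr2; field; rewrite gt_eqF.
exact: sqr_ge0.
Qed.

Lemma sqr_sum_le_card (N : nat) (d : 'I_N -> R) :
  (\sum_k d k) ^+ 2 <= N%:R * \sum_k d k ^+ 2.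
Proof.
pose d' (k : nat) : R := if (insub k : option 'I_N) is Some i then d i else 0.
have d'E (k : 'I_N) : d' k = d k by rewrite /d' valK.
have := @sqr_sum_le N (fun=> 1) d' (fun=> ltr01).
rewrite sumr_const card_ord -[_ *+ N]mulr_natl mulr1.
under eq_bigr do rewrite d'E.
by under [X in _ <= _ * X]eq_bigr do rewrite d'E divr1.
Qed.

End finite_sums.

(** * The difference of two averages as a weak gradient tested against a test function *)

Section one_step.
Variables (R : realType) (n : nat).
Local Notation E := 'rV[R]_n.+1.
Local Notation leb := (lebesgue_rV R n.+1).
Implicit Types (f : E -> R) (G : E -> E) (U D : set E) (p : E).

Lemma continuous_support_bounded (h : E -> R) p r : continuous h ->
  (forall x, ~ cube p r x -> h x = 0) -> exists B, forall x, `|h x| <= B.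
Proof.
move=> ch h0.
have [C0|C0] := pselect (cube p r !=set0); last first.
  exists 0 => x; rewrite h0 ?normr0// => px; apply: C0; by exists x.
have cn : continuous (fun x => `|h x|).
  by move=> x; apply: continuous_comp; [exact: ch|exact: norm_continuous].
have [c _ hc] := EVT_max_rV C0 (@compact_cube _ _ p r) (continuous_subspaceT cn).
exists `|h c| => x; have [px|px] := pselect (cube p r x); first by apply: hc; exact: mem_set.
by rewrite h0// normr0.
Qed.

Lemma continuous_support_L2fun D (h : E -> R) p r : measurable D -> (leb D < +oo)%E ->
  continuous h -> (forall x, ~ cube p r x -> h x = 0) -> L2fun leb D h.
Proof.
move=> mD fD ch h0; have [B hB] := continuous_support_bounded ch h0.
apply: (bounded_L2fun (B := B)) => //.
by apply: measurable_funTS; exact: continuous_measurable_rV.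
Qed.

Lemma lebesgue_cube_lty p r : (leb (cube p r) < +oo)%E.
Proof.
have [r0|r0] := leP 0 r; first by rewrite lebesgue_cube// ltry.
rewrite (_ : cube p r = set0) ?measure0//.
apply/seteqP; split=> // x /(_ ord0) h.
by have := le_lt_trans h r0; rewrite ltNge normr_ge0.
Qed.

Lemma L2dot_support U D (u v : E -> R) : D `<=` U ->
  (forall x, U x -> ~ D x -> v x = 0) -> L2dot leb U u v = L2dot leb D u v.
Proof.
move=> DU h; have UD : U `&` D = D by exact/setIidPr.
rewrite /L2dot -[in RHS]UD Rintegral_mkcondr.
apply: eq_Rintegral => x /set_mem Ux; rewrite patchE; case: ifPn => // /negP nD.
by rewrite h ?mulr0// => Dx; apply: nD; exact: mem_set.
Qed.

(** The weak gradient formula is applied to each term of [tensor_telescope]. Cauchy-Schwarz over the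
    n+1 directions and over the cube yields the factors [n.+1] and (2 rho)^(n+1). *)
Lemma weak_gradient_tensor_step U f G p (rho beta : R) (b c B : 'I_n.+1 -> R -> R) :
  open U -> (leb U < +oo)%E -> L2fun leb U f -> is_weak_gradient U f G ->
  cube p rho `<=` U -> 0 <= rho ->
  (forall j, [/\ smooth1 (b j), smooth1 (c j) & smooth1 (B j)]) ->
  (forall j, has_deriv (B j) (fun t => c j t - b j t)) ->
  (forall j t, rho < `|t - p 0 j| -> [/\ b j t = 0, c j t = 0 & B j t = 0]) ->
  (forall j t, [/\ `|b j t| <= beta, `|c j t| <= beta & `|B j t| <= 1]) ->
  (L2dot leb U f (tensor c) - L2dot leb U f (tensor b)) ^+ 2 <=
  n.+1%:R * ((beta ^+ n) ^+ 2 * (rho *+ 2) ^+ n.+1) *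
  \sum_i L2dot leb (cube p rho) (fun x => G x 0 i) (fun x => G x 0 i).
Proof.
move=> oU fU hf wG QU rho0 sm dB supp bd.
have mU := open_measurable_rV oU.
have mQ := measurable_cube p rho.
pose g (i j : 'I_n.+1) := if (j < i)%N then c j else if j == i then B j else b j.
pose g' (i j : 'I_n.+1) := if (j < i)%N then c j else if j == i then (fun t => c j t - b j t) else b j.
have sg i j : smooth1 (g i j) by rewrite /g; have [? ? ?] := sm j; case: ifP => // _; case: ifP.
have gs i j t : rho < `|t - p 0 j| -> g i j t = 0.
  by move=> h; rewrite /g; have [? ? ?] := supp _ _ h; case: ifP => // _; case: ifP.
have tU i : test U (tensor (g i)) := tensor_test (sg i) (gs i) QU.
have cts j : continuous (b j) /\ continuous (c j).
  have [sb sc _] := sm j.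
  by have [? /has_deriv_continuous] := smooth1_deriv sb; have [? /has_deriv_continuous] := smooth1_deriv sc.
have Lb : L2fun leb U (tensor b).
  apply: (continuous_support_L2fun (p := p) (r := rho)) => //.
    by apply: tensor_continuous => j; have [] := cts j.
  by apply: tensor_support => j t h; have [] := supp _ _ h.
have Lc : L2fun leb U (tensor c).
  apply: (continuous_support_L2fun (p := p) (r := rho)) => //.
    by apply: tensor_continuous => j; have [] := cts j.
  by apply: tensor_support => j t h; have [] := supp _ _ h.
have pE i : partial i (tensor (g i)) = tensor (g' i).
  apply/funext => x.
  have d : has_deriv (g i i) (fun t => c i t - b i t) by rewrite /g ltnn eqxx; exact: dB.
  have [_ dG] := tensor_is_derive x d; rewrite /partial dG; apply: eq_bigr => j _.
  by rewrite /g' /g; have [->|ji] := eqVneq j i; rewrite ?ltnn.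
have Lp i : L2fun leb U (partial i (tensor (g i))).
  rewrite pE; apply: (continuous_support_L2fun (p := p) (r := rho)) => //.
    apply: tensor_continuous => j; have [cb cc] := cts j; rewrite /g'.
    case: ifP => // _; case: ifP => // _ t.
    by apply: continuousB; [exact: cc|exact: cb].
  apply: tensor_support => j t h; have [h1 h2 _] := supp _ _ h; rewrite /g'.
  by case: ifP => // _; case: ifP => //; rewrite h1 h2 subrr.
have gbd i x : `|tensor (g i) x| <= beta ^+ n.
  have beta0 : 0 <= beta by have [h _ _] := bd ord0 0; exact: le_trans (normr_ge0 _) h.
  rewrite /tensor normr_prod (bigD1 i)//= -[leRHS]mul1r ler_pM//.
  - by apply: prodr_ge0.
  - by rewrite /g ltnn eqxx; have [] := bd i (x 0 i).
  apply: (@le_trans _ _ (\prod_(j | j != i) beta)).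
    apply: ler_prod => j ji; rewrite normr_ge0/=.
    by rewrite /g (negbTE ji); have [? ? ?] := bd j (x 0 j); case: ifP.
  by rewrite prodr_const cardC1 card_ord.
have -> : L2dot leb U f (tensor c) - L2dot leb U f (tensor b) =
    - \sum_i L2dot leb U (fun x => G x 0 i) (tensor (g i)).
  rewrite !(L2dotC _ _ f) -L2dot_subl//.
  rewrite (_ : (fun x => _) = (fun x => \sum_(i <- index_enum 'I_n.+1) partial i (tensor (g i)) x)); last first.
    by apply/funext => x; rewrite -(tensor_telescope dB).
  rewrite L2dot_suml// -sumrN; apply: eq_bigr => i _.
  by rewrite L2dotC; have [_ ->] := wG i.
rewrite sqrrN; apply: le_trans (sqr_sum_le_card _) _.
rewrite -mulrA ler_wpM2l// mulr_sumr; apply: ler_sum => i _.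
rewrite (L2dot_support _ QU) => [|x _ nQ]; last exact: (tensor_support (gs i)).
have LG : L2fun leb (cube p rho) (fun x => G x 0 i) by apply: L2funS QU _ => //; have [] := wG i.
have Lg : L2fun leb (cube p rho) (tensor (g i)).
  apply: (continuous_support_L2fun (p := p) (r := rho)) => //; first exact: lebesgue_cube_lty.
    by apply: tensor_continuous => j; have [? /has_deriv_continuous] := smooth1_deriv (sg i j).
  exact: tensor_support (gs i).
apply: le_trans (L2dot_CS mQ LG Lg) _; rewrite mulrC ler_wpM2r ?L2dot_ge0//.
apply: (@le_trans _ _ (L2dot leb (cube p rho) (fun=> beta ^+ n) (fun=> beta ^+ n))).
  apply: le_L2dot => //.
    by apply: (bounded_L2fun (B := `|beta ^+ n|)) => //; exact: lebesgue_cube_lty.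
  by move=> x _; apply: le_trans (gbd i x) (ler_norm _).
by rewrite /L2dot Rintegral_cst//= [X in fine X]lebesgue_cube// -expr2.
Qed.

End one_step.

(** * Pointwise bound at a boundary point from averages along a cone *)

Section element_pointwise.
Variables (R : realType) (n : nat).
Local Notation E := 'rV[R]_n.+1.
Local Notation leb := (lebesgue_rV R n.+1).
Implicit Types (f : E -> R) (G : E -> E) (U : set E) (p x y : E).

Definition bump_bound : R := projT1 (cid2 (@bump_bounded R)).

Lemma bump_bound_gt0 : 0 < bump_bound.
Proof. by rewrite /bump_bound; case: cid2. Qed.

Lemma bump_le (t : R) : bump_fun t <= bump_bound.
Proof. by rewrite /bump_bound; case: cid2 => B B0 h /=; exact: h. Qed.

Lemma step_scale_eq1 (s q t : R) : 0 < s -> q + s <= t -> step (s^-1 * t + - (s^-1 * q)) = 1.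
Proof.
move=> s0 h; apply: step_eq1; rewrite -mulrBr ler_pdivlMl// mulr1; lra.
Qed.

Lemma step_scale_eq0 (s q t : R) : 0 < s -> t <= q - s -> step (s^-1 * t + - (s^-1 * q)) = 0.
Proof.
move=> s0 h; apply: step_eq0; rewrite -mulrBr ler_pdivrMl// mulrN1; lra.
Qed.

Lemma sqrD_le (u v t x : R) : v ^+ 2 <= t -> t *+ 2 <= x -> (u + v) ^+ 2 <= 2 * u ^+ 2 + x.
Proof. by move=> h1 h2; have := sqr_ge0 (u - v); rewrite sqrrB sqrrD; lra. Qed.

Lemma scale_bump_le (s u : R) : 0 < s -> `|s^-1 * bump_fun u| <= bump_bound / s.
Proof.
move=> s0; rewrite normrM (ger0_norm (bump_ge0 u)) gtr0_norm ?invr_gt0//.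
by rewrite mulrC ler_wpM2r ?bump_le// invr_ge0 ltW.
Qed.

(** The cost of one step at scale t: squared size t^(-2k) of the test function times volume t^(k+1),
    that is t^(1-k) up to constants. *)
Lemma mollifier_cst_le (B s t : R) (k : nat) : 0 < B -> 0 < t -> t / 4 <= s ->
  ((B / s) ^+ k) ^+ 2 * (t *+ 2) ^+ k.+1 <=
  (4 * B) ^+ (k * 2) * 2 ^+ k.+1 * (t * t^-1 ^+ k).
Proof.
move=> B0 t0 ts; have s0 : 0 < s by rewrite (lt_le_trans _ ts)// divr_gt0.
have h : B / s <= 4 * B / t.
  rewrite (_ : 4 * B / t = B * (t / 4)^-1); last by field; rewrite gt_eqF.
  by rewrite ler_wpM2l ?(ltW B0)// lef_pV2 ?posrE ?divr_gt0.
have h0 : 0 <= B / s by rewrite divr_ge0// ltW.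
apply: (@le_trans _ _ (((4 * B / t) ^+ k) ^+ 2 * (t *+ 2) ^+ k.+1)).
  rewrite ler_wpM2r ?exprn_ge0 ?mulrn_wge0 ?(ltW t0)//.
  by rewrite -!exprM lerXn2r// nnegrE// (le_trans h0).
have u : t^-1 ^+ k * t ^+ k = 1 by rewrite -exprMn mulVf ?gt_eqF// expr1n.
rewrite (exprMn k (4 * B) t^-1) -[t *+ 2]mulr_natl (exprMn _ 2 t) (exprS t) exprM.
set X := (4 * B) ^+ k; set Y := 2 ^+ _; set v := t^-1 ^+ k; set z := t ^+ k.
rewrite (_ : _ * _ = X ^+ 2 * Y * (t * v) * (v * z)); last by ring.
by rewrite u mulr1.
Qed.

(** The antiderivative is a difference of two steps. Left of the common cube both are 0, right of it
    both are 1, so it has support in the cube although neither step has. *)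
Lemma mollifier_step U f G p p' P (s s' rho : R) :
  open U -> (leb U < +oo)%E -> L2fun leb U f -> is_weak_gradient U f G ->
  cube P rho `<=` U -> 0 < s' -> s' <= s ->
  (forall j, `|p 0 j - P 0 j| + s <= rho) -> (forall j, `|p' 0 j - P 0 j| + s' <= rho) ->
  (L2dot leb U f (mollifier p' s') - L2dot leb U f (mollifier p s)) ^+ 2 <=
  n.+1%:R * (((bump_bound / s') ^+ n) ^+ 2 * (rho *+ 2) ^+ n.+1) *
  \sum_i L2dot leb (cube P rho) (fun x => G x 0 i) (fun x => G x 0 i).
Proof.
move=> oU fU hf wG QU s'0 s's hp hp'.
have s0 : 0 < s by exact: lt_le_trans s's.
have rho0 : 0 <= rho.
  by apply: le_trans (hp ord0); rewrite addr_ge0// ltW.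
apply: (@weak_gradient_tensor_step _ _ _ _ _ _ _ _ _ _
  (fun j t => step (s'^-1 * t + - (s'^-1 * p' 0 j)) - step (s^-1 * t + - (s^-1 * p 0 j))) oU fU hf wG QU rho0).
- by move=> j; split; [exact: smooth1_bump|exact: smooth1_bump|exact: smooth1_step_sub].
- move=> j t.
  have h1 := has_deriv_affine s'^-1 (- (s'^-1 * p' 0 j)) (@has_deriv_step R).
  have h2 := has_deriv_affine s^-1 (- (s^-1 * p 0 j)) (@has_deriv_step R).
  by exact: (is_deriveB (h1 t) (h2 t)).
- move=> j t.
  have a1 := hp j; have a2 := hp' j.
  have b1 := ler_norm (p 0 j - P 0 j); have b2 := ler_norm (p' 0 j - P 0 j).
  have c1 := ler_norm (- (p 0 j - P 0 j)); have c2 := ler_norm (- (p' 0 j - P 0 j)).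
  rewrite !normrN in c1 c2.
  rewrite ltr_normr => /orP[h|h].
    rewrite !bump_scale_eq0 ?mulr0 ?step_scale_eq1 ?subrr//; try lra.
    + by rewrite ler_normr; apply/orP; left; lra.
    + by rewrite ler_normr; apply/orP; left; lra.
  rewrite !bump_scale_eq0 ?mulr0 ?step_scale_eq0 ?subrr//; try lra.
  + by rewrite ler_normr; apply/orP; right; lra.
  + by rewrite ler_normr; apply/orP; right; lra.
- move=> j t; split.
  + by apply: le_trans (scale_bump_le _ s0) _; rewrite ler_wpM2l ?(ltW bump_bound_gt0)// lef_pV2.
  + exact: scale_bump_le.
  + have /andP[u1 u2] := step_ge0_le1 (s'^-1 * t - s'^-1 * p' 0 j).
    have /andP[v1 v2] := step_ge0_le1 (s^-1 * t - s^-1 * p 0 j).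
    by rewrite ler_norml; apply/andP; split; lra.
Qed.

Lemma mollifier_L2fun U p s : 0 < s -> measurable U -> (leb U < +oo)%E ->
  L2fun leb U (mollifier p s).
Proof.
move=> s0 mU fU; apply: (continuous_support_L2fun (p := p) (r := s)) => //.
  exact: mollifier_continuous.
by move=> x; exact: mollifier_eq0.
Qed.

Variables (U : set E) (f : E -> R) (G : E -> E) (Lam r : R) (x0 y : E).
Hypotheses (oU : open U) (fU : (leb U < +oo)%E) (hf : L2fun leb U f)
  (wG : is_weak_gradient U f G) (Lam1 : 1 <= Lam) (r0 : 0 < r)
  (xy : forall j, `|x0 0 j - y 0 j| <= Lam * r)
  (cone : forall t, 0 < t <= 1 -> cube (y + t *: (x0 - y)) (t * r) `<=` U).

(* The cubes around pk k of radius tk k * r shrink geometrically to y; the ratio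
   1 - 1 / (4 Lam) makes consecutive ones overlap inside U. The weights w ^+ k, with
   q < w < 1, are those of the Cauchy-Schwarz inequality for the telescoping sum. *)
Let q := 1 - (4 * Lam)^-1.
Let w := 1 - (8 * Lam)^-1.
Let tk k := q ^+ k.
Let pk k := y + tk k *: (x0 - y).
Let phi k := mollifier (pk k) (tk k * r / 2).
Let a k := L2dot leb U f (phi k).
Let e k := \sum_i L2dot leb (cube y (2 * Lam * r * tk k) `&` U) (fun x => G x 0 i) (fun x => G x 0 i).

Let L0 : 0 < Lam. Proof. exact: lt_le_trans Lam1. Qed.

Let qE : q = 1 - (4 * Lam)^-1. Proof. by []. Qed.
Let q34 : 3 / 4 <= q < 1.
Proof.
rewrite /q ltrBlDr ltrDl invr_gt0 mulr_gt0//= andbT.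
have : (4 * Lam)^-1 <= 4^-1.
  by rewrite lef_pV2 ?posrE ?mulr_gt0// ler_pMr.
lra.
Qed.

Let tk0 k : 0 < tk k <= 1.
Proof.
have /andP[h1 h2] := q34.
by rewrite exprn_gt0 ?exprn_ile1//; lra.
Qed.

Definition element_cst : R := n.+1%:R * (4 * bump_bound) ^+ (n * 2) * 2 ^+ n.+1.

(** Consecutive centres differ by at most (1 - q) tk Lam r = tk r / 4 and the mollifiers have radius
    at most tk r / 2, so both fit in the cube of radius tk r around [pk k], which the cone
    hypothesis puts inside U. *)
Let step_k k : (a k.+1 - a k) ^+ 2 <= element_cst * ((tk k * r) * (tk k * r)^-1 ^+ n) * e k.
Proof.
have /andP[q1 q2] := q34; have /andP[t0 t1] := tk0 k.
have tS : tk k.+1 = q * tk k by rewrite /tk exprS.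
have tr0 : 0 < tk k * r by rewrite mulr_gt0.
have B0 := bump_bound_gt0.
have Qsub : cube (pk k) (tk k * r) `<=` U by apply: cone; exact: tk0.
have s'0 : 0 < tk k.+1 * r / 2 by rewrite divr_gt0// mulr_gt0//; case/andP: (tk0 k.+1).
have s's : tk k.+1 * r / 2 <= tk k * r / 2.
  rewrite ler_pM2r ?invr_gt0// ler_pM2r// tS ler_piMl ?ltW//.
apply: (le_trans (mollifier_step oU fU hf wG Qsub s'0 s's _ _)) => [j|j|].
- by rewrite subrr normr0 add0r; lra.
- rewrite !mxE (_ : _ - _ = (tk k.+1 - tk k) * (x0 0 j - y 0 j)); last by ring.
  rewrite normrM tS -[X in _ - X]mul1r -mulrBl normrM.
  rewrite (_ : `|q - 1| = (4 * Lam)^-1); last first.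
    by rewrite qE addrAC subrr add0r normrN ger0_norm// invr_ge0 mulr_ge0// ltW.
  rewrite (gtr0_norm t0).
  have h1 : (4 * Lam)^-1 * tk k * `|x0 0 j - y 0 j| <= (4 * Lam)^-1 * tk k * (Lam * r).
    by rewrite ler_wpM2l// mulr_ge0 ?(ltW t0)// invr_ge0 mulr_ge0// ltW.
  have h2 : (4 * Lam)^-1 * tk k * (Lam * r) = tk k * r / 4 by field; rewrite gt_eqF.
  have h3 : q * tk k * r / 2 <= tk k * r / 2 by rewrite -tS.
  lra.
(* Recentring the cube at y costs a factor 2 Lam in the radius, and gives the energy a form that can
   be integrated over y by Tonelli. *)
have e_le : \sum_i L2dot leb (cube (pk k) (tk k * r)) (fun x => G x 0 i) (fun x => G x 0 i) <= e k.
  apply: ler_sum => i _; apply: L2dotS.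
  - by apply: measurableI; [exact: measurable_cube|exact: open_measurable_rV].
  - exact: measurable_cube.
  - move=> z zQ; split; last exact: Qsub.
    move=> j; have := zQ j; rewrite !mxE => h.
    rewrite (_ : z 0 j - y 0 j = (z 0 j - (y 0 j + tk k * (x0 0 j - y 0 j))) + tk k * (x0 0 j - y 0 j)); last by ring.
    rewrite (le_trans (ler_normD _ _))//.
    have : `|tk k * (x0 0 j - y 0 j)| <= tk k * (Lam * r).
      by rewrite normrM (gtr0_norm t0) ler_wpM2l// ltW.
    have : tk k * r * 1 <= tk k * r * Lam by rewrite ler_wpM2l// ltW.
    nra.
  - apply: (L2funS (D := U)); [exact: open_measurable_rV| | by move=> ? []|by have [] := wG i].
    by apply: measurableI; [exact: measurable_cube|exact: open_measurable_rV].
have e0 : 0 <= \sum_i L2dot leb (cube (pk k) (tk k * r)) (fun x => G x 0 i) (fun x => G x 0 i).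
  by apply: sumr_ge0 => i _; exact: L2dot_ge0.
apply: ler_pM => //.
  by rewrite mulr_ge0 ?ler0n// mulr_ge0 ?sqr_ge0// exprn_ge0// mulrn_wge0// ltW.
rewrite /element_cst -[X in _ <= X * _]mulrA -[leRHS]mulrA ler_wpM2l//.
apply: mollifier_cst_le => //.
have : 3 / 4 * (tk k * r) <= q * (tk k * r) by rewrite ler_wpM2r// ltW.
by rewrite tS mulrA; lra.
Qed.

Let pk_cube k s : 0 <= s <= tk k * r -> cube (pk k) s `<=` cube y (2 * Lam * r * tk k).
Proof.
move=> /andP[s0 sr] z zQ j; have := zQ j; rewrite !mxE => h.
have /andP[t0 t1] := tk0 k.
rewrite (_ : z 0 j - y 0 j = (z 0 j - (y 0 j + tk k * (x0 0 j - y 0 j))) + tk k * (x0 0 j - y 0 j)); last by ring.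
rewrite (le_trans (ler_normD _ _))//.
have : `|tk k * (x0 0 j - y 0 j)| <= tk k * (Lam * r).
  by rewrite normrM (gtr0_norm t0) ler_wpM2l// ltW.
have : tk k * r * 1 <= tk k * r * Lam by rewrite ler_wpM2l// mulr_ge0// ltW.
nra.
Qed.

Let mU : measurable U. Proof. exact: open_measurable_rV. Qed.

Let trk0 k : 0 < tk k * r. Proof. by have /andP[? _] := tk0 k; rewrite mulr_gt0. Qed.

Let phi_L2 k : L2fun leb U (phi k).
Proof. by apply: mollifier_L2fun => //; rewrite divr_gt0. Qed.

Let phi_supp k z : ~ cube (pk k) (tk k * r / 2) z -> phi k z = 0.
Proof. by apply: mollifier_eq0; rewrite divr_gt0. Qed.

Let phi_int k : \int[leb]_(z in U) phi k z = 1.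
Proof.
rewrite /Rintegral integral_mkcond (_ : _ \_ _ = fun z => (phi k z)%:E).
  by rewrite integral_mollifier// divr_gt0.
apply/funext => z; rewrite patchE; case: ifPn => // /negP nU.
rewrite phi_supp// => h; apply: nU; apply/mem_set; apply: (cone (tk0 k)).
by move=> j; apply: le_trans (h j) _; have := trk0 k; rewrite /tk; lra.
Qed.

Let cst_L2 (c : R) : L2fun leb U (fun=> c).
Proof. exact: (bounded_L2fun (B := `|c|)). Qed.

Hypothesis cf : continuous f.

Let a_cvg : a @ \oo --> f y.
Proof.
apply/cvgrPdist_le => eps eps0.
have /nbhs_cubeP[dl dl0 dlP] : nbhs y [set z | `|f y - f z| <= eps].
  have := @cf y; move/cvgrPdist_le => /(_ _ eps0); exact.
have L2r : 0 < 2 * Lam * r by rewrite !mulr_gt0.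
have tcvg : tk @ \oo --> (0 : R).
  have /andP[q1 q2] := q34.
  by apply: cvg_expr; rewrite ger0_norm//; lra.
have dp : 0 < dl / (2 * Lam * r) by rewrite divr_gt0.
move/cvgrPdist_le: tcvg => /(_ _ dp) tN.
near=> k.
have tkd : tk k <= dl / (2 * Lam * r).
  have : `|0 - tk k| <= dl / (2 * Lam * r).
    by near: k; exact: tN.
  by rewrite sub0r normrN; apply: le_trans; exact: ler_norm.
have near_f z : U z -> phi k z != 0 -> `|f y - f z| <= eps.
  move=> _ pz; apply: dlP.
  have zc : cube (pk k) (tk k * r / 2) z.
    by apply: contrapT => nz; move: pz; rewrite phi_supp ?eqxx.
  have : cube y (2 * Lam * r * tk k) z.
    apply: pk_cube zc; have := trk0 k; lra.
  by move=> h j; apply: le_trans (h j) _; move: tkd; rewrite ler_pdivlMr// mulrC.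
have phi0 z : 0 <= phi k z by apply: mollifier_ge0; rewrite divr_gt0.
(* Averages reproduce constants, so [a k] is squeezed between f y - eps and f y + eps. *)
have cE c : L2dot leb U (fun=> c) (phi k) = c.
  rewrite /L2dot RintegralZl ?phi_int ?mulr1//.
  have := L2fun_mul_integrable mU (cst_L2 1) (phi_L2 k).
  by apply: eq_integrable => // z _; rewrite mul1r.
have l1 : L2dot leb U (fun=> f y - eps) (phi k) <= a k.
  apply: le_Rintegral => //; try exact: L2fun_mul_integrable.
  move=> z Uz; have [->|pz] := eqVneq (phi k z) 0; first by rewrite !mulr0.
  rewrite ler_wpM2r//; have := near_f _ Uz pz; rewrite ler_norml; lra.
have l2 : a k <= L2dot leb U (fun=> f y + eps) (phi k).
  apply: le_Rintegral => //; try exact: L2fun_mul_integrable.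
  move=> z Uz; have [->|pz] := eqVneq (phi k z) 0; first by rewrite !mulr0.
  rewrite ler_wpM2r//; have := near_f _ Uz pz; rewrite ler_norml; lra.
rewrite !cE in l1 l2; rewrite ler_norml; lra.
Unshelve. all: by end_near. Qed.

Let w01 : 0 < w < 1.
Proof.
have h : (8 * Lam)^-1 <= 8^-1 by rewrite lef_pV2 ?posrE ?mulr_gt0// ler_pMr.
have h0 : 0 < (8 * Lam)^-1 by rewrite invr_gt0 mulr_gt0.
by rewrite /w; apply/andP; split; lra.
Qed.

Let wk0 k : 0 < w ^+ k. Proof. by have /andP[? _] := w01; rewrite exprn_gt0. Qed.

Let sum_w N : \sum_(k < N) w ^+ k <= 8 * Lam.
Proof.
have /andP[w0 w1] := w01.
have h : (8 * Lam)^-1 * \sum_(k < N) w ^+ k <= 1.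
  rewrite (_ : (8 * Lam)^-1 = 1 - w); last by rewrite /w; ring.
  have := subrX1 w N; have := exprn_ge0 N (ltW w0).
  by lra.
by rewrite -[leRHS]mulr1 -ler_pdivrMl ?mulr_gt0.
Qed.

(** The 16 Lam is the bound 8 Lam for the sum of the weights [w ^+ k], doubled when the square of
    [a 0] plus the increments is split. *)
Definition element_coef k : R :=
  16 * Lam * element_cst * ((q ^+ k * r) * (q ^+ k * r)^-1 ^+ n) / w ^+ k.

Lemma element_cst_ge0 : 0 <= element_cst.
Proof. by rewrite /element_cst !mulr_ge0// exprn_ge0// mulr_ge0// ltW// bump_bound_gt0. Qed.

Let coef_ge0 k : 0 <= element_coef k.
Proof.
have c0 := element_cst_ge0; have t0 := trk0 k; rewrite /tk in t0.
have h1 : 0 <= 16 * Lam * element_cst by rewrite mulr_ge0// mulr_ge0// ltW.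
have h2 : 0 <= (q ^+ k * r) * (q ^+ k * r)^-1 ^+ n.
  by rewrite mulr_ge0 ?exprn_ge0 ?invr_ge0 ?(ltW t0).
by rewrite divr_ge0 ?(ltW (wk0 k))// mulr_ge0.
Qed.

Let e_ge0 k : 0 <= e k.
Proof. by apply: sumr_ge0 => i _; exact: L2dot_ge0. Qed.

Let a_le N : a N ^+ 2 <= 2 * a 0%N ^+ 2 + \sum_(k < N) element_coef k * e k.
Proof.
pose d k := a k.+1 - a k.
have aE : a N = a 0%N + \sum_(k < N) d k.
  by rewrite -(big_mkord xpredT d) telescope_sumr// addrC subrK.
have h1 := @sqr_sum_le R N (fun k => w ^+ k) d wk0.
have T0 : 0 <= \sum_(k < N) d k ^+ 2 / w ^+ k.
  by apply: sumr_ge0 => k _; rewrite divr_ge0 ?sqr_ge0 ?(ltW (wk0 k)).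
have h2 := le_trans h1 (ler_wpM2r T0 (sum_w N)).
have h3 : 8 * Lam * (\sum_(k < N) d k ^+ 2 / w ^+ k) *+ 2 <= \sum_(k < N) element_coef k * e k.
  rewrite -mulrnAl mulr_sumr; apply: ler_sum => k _.
  have h : d k ^+ 2 / w ^+ k <= element_cst * ((tk k * r) * (tk k * r)^-1 ^+ n) * e k / w ^+ k.
    by rewrite ler_wpM2r ?invr_ge0 ?(ltW (wk0 k))//; exact: step_k.
  have h' : 0 <= 8 * Lam *+ 2 by rewrite mulrn_wge0// mulr_ge0// ltW.
  apply: le_trans (ler_wpM2l h' h) _.
  rewrite /element_coef /tk le_eqVlt; apply/orP; left; apply/eqP.
  by rewrite -[8 * Lam *+ 2]mulr_natl; ring.
by rewrite aE; exact: sqrD_le h2 h3.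
Qed.

(** The limit of [a_le], where the mollifier around x0 is the one of index 0. The series lives in
    the extended reals, so its convergence need not be known at a single y. *)
Lemma element_pointwise : ((f y ^+ 2)%:E <= (2 * L2dot leb U f (mollifier x0 (r / 2)) ^+ 2)%:E +
  \sum_(0 <= k <oo) (element_coef k *
    \sum_i L2dot leb (cube y (2 * Lam * r * (1 - (4 * Lam)^-1) ^+ k) `&` U)
       (fun x => G x 0 i) (fun x => G x 0 i))%:E)%E.
Proof.
rewrite -/q; set X := (\sum_(0 <= k <oo) _)%E.
have a0E : L2dot leb U f (mollifier x0 (r / 2)) = a 0%N.
  rewrite /a /phi /pk /tk expr0 mul1r scale1r addrC subrK//.
rewrite a0E.
have XN N : ((\sum_(k < N) element_coef k * e k)%:E <= X)%E.
  rewrite -(big_mkord xpredT (fun k => element_coef k * e k)) -sumEFin.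
  apply: (@nneseries_lim_ge R (fun k => (element_coef k * e k)%:E) xpredT 0%N N) => k _ _.
  by rewrite lee_fin; apply: mulr_ge0; [exact: coef_ge0|exact: e_ge0].
have X0 : (0 <= X)%E by apply: le_trans (XN 0%N); rewrite big_ord0.
clearbody X; move: X X0 XN => [x| |] X0 XN; last by rewrite leeNy_eq in X0.
  2: by rewrite addey ?leey.
rewrite -EFinD lee_fin.
have sq : (a k ^+ 2) @[k --> \oo] --> f y ^+ 2.
  by rewrite expr2; under eq_cvg do rewrite expr2; exact: cvgM a_cvg a_cvg.
rewrite leNgt; apply/negP => lt.
have [N _ hN] := cvgr_gt _ sq _ lt.
have := hN N (leqnn N); rewrite /= ltNge => /negP; apply.
by apply: le_trans (a_le N) _; rewrite lerD2l -lee_fin.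
Qed.

End element_pointwise.

(** * Integrating local energies over the surface *)

Section tonelli.
Variables (R : realType) (n : nat).
Local Notation E := 'rV[R]_n.+1.
Local Notation leb := (lebesgue_rV R n.+1).
Local Notation T1 := (caratheodory_type (surface_outer R n.+1)).

Lemma measurable_surface (D : set E) : measurable D -> measurable (D : set T1).
Proof. by move=> mD; exact: measurable_hausdorff. Qed.

Lemma measurable_fun_surface (f : E -> R) : measurable_fun setT f ->
  measurable_fun setT (f : T1 -> R).
Proof.
move=> mf _ Y mY; apply: measurable_surface.
exact: mf.
Qed.

Variables (Gam : set E) (c rho : R) (S : E -> R).
Hypotheses (mGam : measurable Gam) (Gamfin : (surface R n.+1 Gam < +oo)%E)
  (mS : measurable_fun setT S) (S0 : forall x, 0 <= S x)
  (Gamc : forall x, (surface R n.+1 (Gam `&` cube x rho) <= c%:E)%E).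

Let F (p : T1 * E) : \bar R := (\1_[set p : E * E | cube p.1 rho p.2] p * S p.2)%:E.

Let F0 p : (0 <= F p)%E.
Proof. by rewrite lee_fin mulr_ge0. Qed.

Let mF : measurable_fun setT F.
Proof.
apply/measurable_EFinP; apply: measurable_funM; last exact: (measurableT_comp mS measurable_snd).
apply: measurable_indic.
rewrite (_ : [set p | _] = \bigcap_(i in [set: 'I_n.+1]) [set p : T1 * E | (`|p.2 ord0 i - (p.1 : E) ord0 i| <= rho)%R]); last first.
  by apply/seteqP; split => [p /= h i _|p /= h i]; [exact: h|exact: (h i Logic.I)].
apply: fin_bigcap_measurable => //= i _.
have m1 : measurable_fun setT (fun p : T1 * E => p.2 ord0 i - (p.1 : E) ord0 i).
  apply: measurable_funB.
    exact: (measurableT_comp (@measurable_rV_coord R n.+1 i) measurable_snd).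
  exact: (measurableT_comp (measurable_fun_surface (@measurable_rV_coord R n.+1 i)) measurable_fst).
have m2 : measurable_fun setT (fun p : T1 * E => `|p.2 ord0 i - (p.1 : E) ord0 i|).
  exact: (measurableT_comp (@normr_measurable R setT) m1).
have := m2 measurableT _ (measurable_itv `]-oo, rho]).
by rewrite setTI.
Qed.

Let h (y : E) : \bar R := (\int[leb]_x (\1_(cube y rho) x * S x)%:E)%E.

Let hE : h = fubini_F leb F.
Proof.
by apply/funext => y; apply: eq_integral => x _; rewrite /F /=; congr (_ * _)%:E; rewrite !indicE; congr (_%:R); congr nat_of_bool; apply/idP/idP => /set_mem ?; apply/mem_set.
Qed.

Lemma measurable_cube_potential : measurable_fun setT (h : T1 -> \bar R).
Proof. by rewrite hE; exact: (@measurable_fun_fubini_tonelli_F _ _ _ _ _ leb F mF F0). Qed.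

(** Since x lies in the cube around y exactly when y lies in the cube around x, exchanging the
    integrals leaves the surface measure of [Gam] in a cube, at most c. *)
Lemma tonelli_cube : (\int[surface R n.+1]_(y in Gam) h y <= c%:E * \int[leb]_x (S x)%:E)%E.
Proof.
have mG := measurable_surface mGam.
(* Hausdorff measure of codimension one is not sigma-finite on the whole space; its restriction to
   [Gam] is finite, as Fubini's theorem requires. *)
pose m1 : {finite_measure set T1 -> \bar R} := mfrestr mG Gamfin.
have h0 y : (0 <= h y)%E by apply: integral_ge0 => x _; rewrite lee_fin mulr_ge0.
apply: (@le_trans _ _ (\int[m1]_(y in (Gam : set T1)) h y)%E).
  rewrite le_eqVlt; apply/orP; left; apply/eqP; apply: eq_measure_integral => A mA AG.
  by rewrite /m1 /= /mfrestr /mrestr setIidl.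
apply: (@le_trans _ _ (\int[m1]_y h y)%E).
  apply: ge0_subset_integral.
  - exact: mG.
  - exact: measurableT.
  - exact: measurable_cube_potential.
  - by move=> y _; exact: h0.
  - exact: subsetT.
rewrite hE (fubini_tonelli (m1 := m1) (m2 := leb) F mF F0).
rewrite -ge0_integralZl//; last 3 first.
- exact/measurable_EFinP.
- by move=> x _; rewrite lee_fin.
- by apply: le_trans (Gamc 0); exact: measure_ge0.
apply: ge0_le_integral => //.
- by move=> x _; apply: integral_ge0.
- exact: (@measurable_fun_fubini_tonelli_G _ _ _ _ _ m1 F mF F0).
- by apply: measurable_funeM; exact/measurable_EFinP.
move=> x _.
have mc : measurable (cube x rho : set T1) by apply: measurable_surface; exact: measurable_cube.
rewrite (_ : (\int[m1]_y F (y, x))%E = (\int[m1]_y ((S x)%:E * (\1_(cube x rho) y)%:E))%E).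
  rewrite ge0_integralZl_EFin; first last.
  - exact: S0.
  - by apply/measurable_EFinP; exact: measurable_indic.
  - by move=> y _; rewrite lee_fin indicE.
  - exact: measurableT.
  rewrite integral_indic// setIT muleC lee_wpmul2r ?lee_fin//.
  by rewrite /= /mfrestr /mrestr setIC; exact: Gamc.
apply: eq_integral => y _; rewrite /F /= -EFinM mulrC; congr (_ * _)%:E.
rewrite !indicE; congr (_%:R); congr nat_of_bool.
by apply/idP/idP => /set_mem xy; apply/mem_set => i; have := xy i; rewrite distrC.
Qed.

End tonelli.

(** * Trace inequality on one convex element *)

Section trace_element.
Variables (R : realType) (n : nat).
Local Notation E := 'rV[R]_n.+1.
Local Notation leb := (lebesgue_rV R n.+1).
Local Notation T1 := (caratheodory_type (surface_outer R n.+1)).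
Implicit Types (K U Gam : set E) (f : E -> R) (G : E -> E) (Lam r : R).

Lemma mollifier_dot_le U f p (s : R) : 0 < s -> measurable U -> (leb U < +oo)%E ->
  cube p s `<=` U -> L2fun leb U f ->
  L2dot leb U f (mollifier p s) ^+ 2 <= L2dot leb U f f * (2 * bump_bound R ^+ 2 / s) ^+ n.+1.
Proof.
move=> s0 mU fU sU hf; have mQ := measurable_cube p s.
have Lm := mollifier_L2fun p s0 mU fU.
apply: le_trans (L2dot_CS mU hf Lm) _; rewrite ler_wpM2l ?L2dot_ge0//.
rewrite (L2dot_support _ sU) => [|x _ nQ]; last exact: mollifier_eq0.
have LQ := L2funS mU mQ sU Lm.
pose b := (bump_bound R / s) ^+ n.+1.
have b0 : 0 <= b by rewrite exprn_ge0// divr_ge0// ltW// bump_bound_gt0.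
apply: (@le_trans _ _ (L2dot leb (cube p s) (fun=> b) (fun=> b))).
  apply: le_L2dot => //.
    by apply: (bounded_L2fun (B := `|b|)) => //; exact: lebesgue_cube_lty.
  move=> x _; rewrite [leRHS]ger0_norm// /mollifier /tensor normr_prod.
  rewrite /b -[X in _ ^+ X]card_ord -prodr_const.
  by apply: ler_prod => j _; rewrite normr_ge0/=; exact: scale_bump_le.
rewrite /L2dot Rintegral_cst//= [X in fine X]lebesgue_cube ?(ltW s0)//= -expr2 /b.
rewrite -exprM mulnC exprM -exprMn le_eqVlt; apply/orP; left; apply/eqP.
by congr (_ ^+ _); rewrite -[s *+ 2]mulr_natl !expr2; field; rewrite gt_eqF.
Qed.

Lemma integral_sumsqr (D : set E) G : measurable D -> (forall i, L2fun leb D (fun x => G x 0 i)) ->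
  (\int[leb]_(x in D) (\sum_i G x ord0 i ^+ 2)%:E =
   (\sum_i L2dot leb D (fun x => G x 0 i) (fun x => G x 0 i))%:E)%E.
Proof.
move=> mD hG; rewrite -sumEFin.
under [RHS]eq_bigr do rewrite L2dot_EFin//.
rewrite -ge0_integral_sum//.
- by apply: eq_integral => x _; rewrite sumEFin.
- by move=> i; apply/measurable_EFinP; apply: measurable_funX; have [] := hG i.
- by move=> i x _; rewrite lee_fin sqr_ge0.
Qed.

(** The first summand comes from the average over the inner cube, the second from the series of
    gradient energies. *)
Definition trace_cst Lam : R :=
  ahlfors_cst R n * (2 * (4 * bump_bound R ^+ 2) ^+ n.+1 * Lam ^+ n +
    128 * Lam ^+ 2 * element_cst R n * (2 * Lam) ^+ n).

Lemma geometric_sum_le (w : R) N : 0 <= w < 1 -> \sum_(k < N) w ^+ k <= (1 - w)^-1.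
Proof.
move=> /andP[w0 w1]; rewrite -[leRHS]mulr1 -ler_pdivrMl ?invr_gt0 ?subr_gt0// invrK.
by have := subrX1 w N; have := exprn_ge0 N w0; lra.
Qed.

Lemma ahlfors_cst_ge0 : 0 <= ahlfors_cst R n.
Proof. by rewrite /ahlfors_cst mulr_ge0// mulr_ge0 ?hausdorff_cst_ge0// exprn_ge0. Qed.

(** The surface factor cancels the negative power in [element_coef]. What remains is q^k / w^k, at
    most w^k because q <= w^2, and the sum of the w^k is at most 8 Lam. *)
Lemma element_coef_sum_le Lam r N : 1 <= Lam -> 0 < r ->
  \sum_(k < N) element_coef n Lam r k * (2 * Lam * r * (1 - (4 * Lam)^-1) ^+ k) ^+ n <=
  128 * Lam ^+ 2 * element_cst R n * (2 * Lam) ^+ n * r.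
Proof.
move=> L1 r0; have L0 : 0 < Lam by exact: lt_le_trans L1.
set th := (8 * Lam)^-1; have thE : (4 * Lam)^-1 = 2 * th.
  by rewrite /th; field; rewrite gt_eqF.
have th0 : 0 < th by rewrite invr_gt0 mulr_gt0.
have th8 : th <= 8^-1 by rewrite lef_pV2 ?posrE ?mulr_gt0// ler_pMr.
rewrite thE; set q := 1 - 2 * th; set w := 1 - th.
have w0 : 0 < w by rewrite /w; lra.
have q0 : 0 < q by rewrite /q; lra.
have qw : q <= w * w by rewrite /q /w; nra.
have c0 : 0 <= 16 * Lam * element_cst R n * (2 * Lam) ^+ n * r.
  apply: mulr_ge0; last exact: ltW.
  apply: mulr_ge0; last by rewrite exprn_ge0// mulr_ge0// ltW.
  by apply: mulr_ge0; [rewrite mulr_ge0// ltW|exact: element_cst_ge0].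
apply: (@le_trans _ _ (\sum_(k < N) (16 * Lam * element_cst R n * (2 * Lam) ^+ n * r) * w ^+ k)).
  apply: ler_sum => k _.
  have t0 : 0 < q ^+ k by rewrite exprn_gt0.
  have wk0 : 0 < w ^+ k by rewrite exprn_gt0.
  apply: (@le_trans _ _ (16 * Lam * element_cst R n * (2 * Lam) ^+ n * r * (q ^+ k / w ^+ k))).
    rewrite /element_coef thE -/q -/w -/th le_eqVlt; apply/orP; left; apply/eqP.
    rewrite (_ : 2 * Lam * r * q ^+ k = (2 * Lam) * (q ^+ k * r)); last by ring.
    have u : (q ^+ k * r)^-1 ^+ n * (q ^+ k * r) ^+ n = 1.
      by rewrite -exprMn mulVf ?expr1n// gt_eqF// mulr_gt0.
    rewrite (exprMn n (2 * Lam)).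
    set v := (q ^+ k * r)^-1 ^+ n in u *; set z := (q ^+ k * r) ^+ n in u *.
    rewrite (_ : _ * _ = 16 * Lam * element_cst R n * (2 * Lam) ^+ n * r * (q ^+ k / w ^+ k) * (v * z)); last by ring.
    by rewrite u mulr1.
  rewrite ler_wpM2l// ler_pdivrMr// -exprMn.
  by rewrite lerXn2r ?nnegrE ?(ltW q0)// mulr_ge0// ltW.
rewrite -mulr_sumr.
have w01 : 0 <= w < 1 by rewrite ltW//= /w; lra.
apply: le_trans (ler_wpM2l c0 (geometric_sum_le N w01)) _.
rewrite (_ : (1 - w)^-1 = 8 * Lam); last by rewrite /w opprB addrC subrK invrK.
by rewrite le_eqVlt; apply/orP; left; apply/eqP; rewrite expr2; ring.
Qed.

(** The pointwise bound integrated over [Gam]. The squared average scales like r^(-n-1) and the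
    surface like r^n, hence the factor 1/r; the series is integrated term by term with
    [tonelli_cube]. *)
Lemma trace_element K Gam f G Lam r x0 : closed K -> convexv K ->
  (leb K° < +oo)%E -> continuous f -> L2fun leb K° f -> is_weak_gradient K° f G ->
  1 <= Lam -> 0 < r -> cube x0 (2 * r) `<=` K ->
  (forall y, K y -> forall j, `|x0 0 j - y 0 j| <= Lam * r) ->
  measurable Gam -> Gam `<=` K `\` K° ->
  (\int[surface R n.+1]_(y in Gam) (f y ^+ 2)%:E <=
   (trace_cst Lam * (r^-1 * L2dot leb K° f f +
     r * \sum_i L2dot leb K° (fun x => G x 0 i) (fun x => G x 0 i)))%:E)%E.
Proof.
move=> clK cvK fU cf hf wG L1 r0 x0K KL mGam GamK.
set U := K°; have oU : open U by exact: open_interior.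
have mU := open_measurable_rV oU.
have L0 : 0 < Lam by exact: lt_le_trans L1.
have GK y : Gam y -> K y by move=> /GamK[].
(* The homothety of ratio t centred at y maps the cube of radius 2r around x0 into K; one r covers
   the cube, the other leaves a neighbourhood, so that points are interior. *)
have cone y : K y -> forall t, 0 < t <= 1 -> cube (y + t *: (x0 - y)) (t * r) `<=` U.
  move=> Ky t /andP[t0 t1] z zt; apply/nbhs_cubeP; exists (t * r); first by rewrite mulr_gt0.
  move=> z' zz'; pose u := y + t^-1 *: (z' - y).
  have -> : z' = y + t *: (u - y).
    by rewrite /u addrAC subrr add0r scalerA divff ?gt_eqF// scale1r addrC subrK.
  apply: cvK => //; first by rewrite ltW.
  apply: x0K => j; rewrite /u !mxE.
  have := zz' j; have := zt j; rewrite !mxE => h1 h2.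
  rewrite (_ : _ - _ = t^-1 * ((z' 0 j - z 0 j) + (z 0 j - (y 0 j + t * (x0 0 j - y 0 j))))); last by field; rewrite gt_eqF.
  rewrite normrM gtr0_norm ?invr_gt0// ler_pdivrMl//.
  by rewrite (le_trans (ler_normD _ _))//; lra.
have ah rho x : 0 < rho -> (surface R n.+1 (Gam `&` cube x rho) <= (ahlfors_cst R n * rho ^+ n)%:E)%E.
  move=> rho0; apply: le_trans (ahlfors_convex x clK cvK rho0).
  by apply: le_outer_measure => y [/GamK].
have GamL : Gam = Gam `&` cube x0 (Lam * r).
  apply/seteqP; split=> [y Gy|y []//]; split=> // j.
  by rewrite distrC; apply: KL; exact: GK.
have nuGam : (surface R n.+1 Gam <= (ahlfors_cst R n * (Lam * r) ^+ n)%:E)%E.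
  by rewrite GamL; apply: ah; rewrite mulr_gt0.
have Gamfin : (surface R n.+1 Gam < +oo)%E by apply: le_lt_trans nuGam _; rewrite ltry.
have LG i : L2fun leb U (fun x => G x 0 i) by have [] := wG i.
pose SG x := \sum_i G x ord0 i ^+ 2.
have SG0 x : 0 <= SG x by apply: sumr_ge0 => i _; exact: sqr_ge0.
(* The energy density is extended by 0, since [tonelli_cube] integrates over the whole space. *)
pose S := SG \_ U.
have S0 x : 0 <= S x by rewrite /S patchE; case: ifP.
have mSG : measurable_fun U SG.
  by apply: measurable_sum => i; apply: measurable_funX; have [] := LG i.
have mS : measurable_fun setT S.
  have h := (measurable_restrictT SG mU).1 mSG. exact: h.
pose q := 1 - (4 * Lam)^-1.
have q01 : 0 < q.
  rewrite /q subr_gt0 invf_lt1 ?mulr_gt0//; lra.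
pose rho k := 2 * Lam * r * q ^+ k.
have rho0 k : 0 < rho k by rewrite /rho !mulr_gt0// exprn_gt0.
pose e k y := \sum_i L2dot leb (cube y (rho k) `&` U) (fun x => G x 0 i) (fun x => G x 0 i).
pose h k y := (\int[leb]_x (\1_(cube y (rho k)) x * S x)%:E)%E.
have eE k y : (e k y)%:E = h k y.
  have mQ := measurable_cube y (rho k).
  rewrite /e -integral_sumsqr; last 2 first.
  - exact: measurableI.
  - by move=> i; apply: L2funS (LG i) => //; exact: measurableI.
  rewrite integral_mkcond; apply: eq_integral => x _.
  rewrite /S /SG !patchE in_setI indicE; case: (x \in cube y (rho k)) => /=; last by rewrite mul0r.
  by rewrite mul1r; case: ifP.
pose EE := \sum_i L2dot leb U (fun x => G x 0 i) (fun x => G x 0 i).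
have EEE : (EE%:E = \int[leb]_x (S x)%:E)%E.
  rewrite /EE -integral_sumsqr// integral_mkcond; apply: eq_integral => x _.
  by rewrite /S !patchE; case: ifP.
have EE0 : 0 <= EE by apply: sumr_ge0 => i _; exact: L2dot_ge0.
have coef0 k : 0 <= element_coef n Lam r k.
  have t1 : 0 < q ^+ k * r by rewrite mulr_gt0// exprn_gt0.
  rewrite /element_coef divr_ge0//.
    rewrite mulr_ge0//; first by rewrite mulr_ge0 ?element_cst_ge0// mulr_ge0// ltW.
    by rewrite -/q mulr_ge0 ?exprn_ge0 ?invr_ge0 ?(ltW t1).
  rewrite exprn_ge0// subr_ge0 invf_le1 ?mulr_gt0//; lra.
pose A0 := 2 * L2dot leb U f (mollifier x0 (r / 2)) ^+ 2.
have A00 : 0 <= A0 by rewrite mulr_ge0// sqr_ge0.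
have mG := measurable_surface mGam.
have mh k : measurable_fun (Gam : set T1) (h k : T1 -> \bar R).
  by apply: measurable_funTS; apply: measurable_cube_potential.
have h0 k y : (0 <= h k y)%E by rewrite -eE lee_fin; apply: sumr_ge0 => i _; exact: L2dot_ge0.
pose term k y := ((element_coef n Lam r k)%:E * h k y)%E.
have mt k : measurable_fun (Gam : set T1) (term k : T1 -> \bar R) by exact: measurable_funeM.
have t0 k y : (0 <= term k y)%E by rewrite mule_ge0// lee_fin.
have mser : measurable_fun (Gam : set T1) (fun y : T1 => \sum_(0 <= k <oo) term k y)%E.
  by apply: ge0_emeasurable_sum.
apply: (@le_trans _ _ (\int[surface R n.+1]_(y in Gam) (A0%:E + \sum_(0 <= k <oo) term k y))%E).
  apply: ge0_le_integral.
  - exact: mG.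
  - by move=> y _; rewrite lee_fin sqr_ge0.
  - apply/measurable_EFinP; apply: measurable_funX; apply: measurable_funTS.
    by apply: measurable_fun_surface; exact: continuous_measurable_rV.
  - exact: emeasurable_funD.
  - move=> y Gy.
    apply: le_trans (element_pointwise oU fU hf wG L1 r0 (KL _ (GK _ Gy)) (cone _ (GK _ Gy)) cf) _.
    rewrite leeD2l//; apply: lee_nneseries => [k _ _|k _].
      by rewrite lee_fin mulr_ge0// sumr_ge0// => i _; exact: L2dot_ge0.
    by rewrite /term -eE EFinM.
rewrite ge0_integralD//; last by move=> y _; exact: nneseries_ge0.
rewrite integral_cst// integral_nneseries//.
have a1 : (A0%:E * surface R n.+1 Gam <= (ahlfors_cst R n * (2 * (4 * bump_bound R ^+ 2) ^+ n.+1 * Lam ^+ n) * (r^-1 * L2dot leb U f f))%:E)%E.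
  apply: (@le_trans _ _ (A0%:E * (ahlfors_cst R n * (Lam * r) ^+ n)%:E)%E).
    by rewrite lee_wpmul2l// lee_fin.
  rewrite -EFinM lee_fin.
  have r20 : 0 < r / 2 by rewrite divr_gt0.
  have sU : cube x0 (r / 2) `<=` U.
    move=> z zc; apply/nbhs_cubeP; exists r => // z' zz; apply: x0K => j.
    rewrite (_ : _ - _ = (z' 0 j - z 0 j) + (z 0 j - x0 0 j)); last by ring.
    by rewrite (le_trans (ler_normD _ _))//; have := zz j; have := zc j; lra.
  have ha := mollifier_dot_le r20 mU fU sU hf.
  have c0 : 0 <= ahlfors_cst R n * (Lam * r) ^+ n.
    by rewrite mulr_ge0 ?ahlfors_cst_ge0// exprn_ge0// mulr_ge0// ltW.
  apply: (@le_trans _ _ (2 * (L2dot leb U f f * (2 * bump_bound R ^+ 2 / (r / 2)) ^+ n.+1) * (ahlfors_cst R n * (Lam * r) ^+ n))).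
    by rewrite ler_wpM2r// ler_wpM2l.
  have -> : 2 * bump_bound R ^+ 2 / (r / 2) = 4 * bump_bound R ^+ 2 * r^-1 by field; rewrite gt_eqF.
  rewrite (exprMn n.+1 (4 * bump_bound R ^+ 2)) (exprMn n Lam r) (exprS r^-1).
  have u : r^-1 ^+ n * r ^+ n = 1 by rewrite -exprMn mulVf ?expr1n// gt_eqF.
  set v := r^-1 ^+ n in u *; set z := r ^+ n in u *; set X := (4 * _) ^+ n.+1; set ff := L2dot _ _ _ _.
  rewrite (_ : _ * (_ * (_ * z)) = ahlfors_cst R n * (2 * X * Lam ^+ n) * (r^-1 * ff) * (v * z)); last by ring.
  by rewrite u mulr1.
have a2 : (\sum_(0 <= k <oo) \int[surface R n.+1]_(y in Gam) term k y <=
    (ahlfors_cst R n * (128 * Lam ^+ 2 * element_cst R n * (2 * Lam) ^+ n) * (r * EE))%:E)%E.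
  have tk k : (\int[surface R n.+1]_(y in Gam) term k y <=
      (element_coef n Lam r k * (rho k) ^+ n * (ahlfors_cst R n * EE))%:E)%E.
    rewrite ge0_integralZl_EFin//.
    have := @tonelli_cube R n Gam (ahlfors_cst R n * rho k ^+ n) (rho k) S mGam Gamfin mS S0 (fun x => ah _ x (rho0 k)).
    rewrite -EEE -EFinM => hh.
    apply: le_trans (lee_wpmul2l _ hh) _; first by rewrite lee_fin.
    by rewrite -EFinM lee_fin le_eqVlt; apply/orP; left; apply/eqP; ring.
  apply: lime_le.
    by apply: is_cvg_nneseries => k _ _; apply: integral_ge0 => y _.
  apply: nearW => N.
  apply: (@le_trans _ _ (\sum_(0 <= k < N) (element_coef n Lam r k * (rho k) ^+ n * (ahlfors_cst R n * EE))%:E)%E).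
    by apply: lee_sum => k _.
  rewrite sumEFin lee_fin -mulr_suml big_mkord.
  have c0 : 0 <= ahlfors_cst R n * EE by rewrite mulr_ge0 ?ahlfors_cst_ge0.
  apply: le_trans (ler_wpM2r c0 (element_coef_sum_le N L1 r0)) _.
  by rewrite le_eqVlt; apply/orP; left; apply/eqP; ring.
apply: le_trans (leeD a1 a2) _.
rewrite -EFinD lee_fin /trace_cst -/EE -/U.
set c1 := 2 * _ * _; set c2 := 128 * _ * _ * _; set ff := L2dot _ _ _ _.
have c10 : 0 <= c1.
  apply: mulr_ge0; last by rewrite exprn_ge0// ltW.
  by rewrite mulr_ge0// exprn_ge0// mulr_ge0// sqr_ge0.
have c20 : 0 <= c2.
  apply: mulr_ge0; last by rewrite exprn_ge0// mulr_ge0// ltW.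
  by rewrite mulr_ge0 ?element_cst_ge0// mulr_ge0// sqr_ge0.
have f0 : 0 <= r^-1 * ff by rewrite mulr_ge0 ?L2dot_ge0 ?invr_ge0 ?(ltW r0).
have g0 : 0 <= r * EE by rewrite mulr_ge0 ?(ltW r0).
rewrite -(mulrA _ c1) -(mulrA _ c2) -mulrDr -[leRHS]mulrA ler_wpM2l ?ahlfors_cst_ge0//.
move: c1 c2 c10 c20 (r^-1 * ff) (r * EE) f0 g0 => c1 c2 c10 c20 u v u0 v0.
have := mulr_ge0 c10 v0; have := mulr_ge0 c20 u0; rewrite mulrDl !mulrDr; lra.
Qed.

End trace_element.

(** * Geometry of the domain, the elements and the patches *)

Section mesh_geometry.
Variables (R : realType) (n : nat).
Local Notation E := 'rV[R]_n.+1.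
Local Notation leb := (lebesgue_rV R n.+1).
Implicit Types (U V Om w : set E) (x y z : E).

Lemma convex_setP (K : set E) : convex_set (K : set (convex_lmodType E)) -> convexv K.
Proof.
move=> cK x y t /andP[t0 t1] Kx Ky.
have h : K (t *: y + (1 - t) *: x) := set_mem (cK y x (Itv01 t0 t1) (mem_set Ky) (mem_set Kx)).
rewrite (_ : x + _ = t *: y + (1 - t) *: x)//.
by rewrite scalerBr scalerBl scale1r addrCA.
Qed.

(** A boundary point lies on or below the local graph, and a point slightly further down has a whole
    neighbourhood below it, so it is not in the closure. Patches are only known to lie in the
    closure of Om; this puts their interiors in Om. *)
Lemma interior_closure_lipschitz Om : open Om -> lipschitz_boundary Om ->
  (closure Om)° `<=` Om.
Proof.
move=> oOm lip x clx; apply: contrapT => nx.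
have bx : bdry Om x.
  split; first exact: interior_subset clx.
  by move=> ix; apply: nx; exact: interior_subset ix.
have [r [M [e [h [r0 e1 hl hr]]]]] := lip _ bx.
pose p := x - dotv x e *: e.
have ee : dotv e e = 1.
  have : enorm e ^+ 2 = 1 by rewrite e1 expr1n.
  by rewrite sqr_sqrtr// dotv_ge0.
have hx : dotv x e <= h p.
  rewrite leNgt; apply/negP => lt; apply: nx; apply/(hr x) => //.
  by rewrite subrr /enorm /dotv big1 ?sqrtr0// => i _; rewrite mxE mul0r.
have ei i : `|e 0 i| <= 1 by rewrite -e1 enorm_coord.
have /nbhs_cubeP[eps eps0 epsP] : nbhs x (closure Om) by [].
(* A perturbation of size t / D moves the height and the graph value by at most t together, so it
   cannot make up for the descent by t. *)
pose D : R := n.+1%:R + (`|M| + 1) * (n.+1%:R * (1 + n.+1%:R)).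
have D1 : 1 <= D.
  have h1 : 1 <= n.+1%:R :> R by rewrite ler1n.
  by rewrite /D (le_trans h1)// lerDl mulr_ge0 ?addr_ge0// mulr_ge0// addr_ge0.
have D0 : 0 < D by exact: lt_le_trans D1.
pose t := Num.min eps (r / (4 * n.+1%:R)).
have t0 : 0 < t by rewrite lt_min eps0 divr_gt0// mulr_gt0.
have tr : n.+1%:R * (t + t) < r.
  have : t <= r / (4 * n.+1%:R) by rewrite ge_min lexx orbT.
  rewrite ler_pdivlMr ?mulr_gt0// => h1; lra.
pose y := x - t *: e.
have ycl : closure Om y.
  apply: epsP => i; rewrite /y !mxE addrAC subrr add0r normrN normrM (gtr0_norm t0).
  have te : t <= eps by rewrite ge_min lexx.
  by rewrite (le_trans _ te)// ler_piMr// ltW.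
pose dl := t / D.
have dl0 : 0 < dl by rewrite divr_gt0.
have dlt : dl <= t by rewrite ler_pdivrMr// ler_peMr// ltW.
have [z [Omz zy]] : Om `&` cube y dl !=set0.
  by apply: ycl; apply/nbhs_cubeP; exists dl.
pose u := z - y.
have zE : z = x - t *: e + u by rewrite /u /y addrC subrK.
have ui i : `|u 0 i| <= dl by rewrite /u !mxE; have := zy i; rewrite !mxE.
clearbody u.
have ue : `|dotv u e| <= n.+1%:R * dl.
  apply: (le_trans (ler_norm_sum _ _ _)).
  rewrite mulr_natl -[X in _ <= _ *+ X]card_ord -sumr_const; apply: ler_sum => i _.
  by rewrite normrM -[leRHS]mulr1 ler_pM.
have zx : enorm (z - x) < r.
  apply: le_lt_trans tr; apply: enorm_le_coord => [|i]; first by rewrite addr_ge0// ltW.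
  rewrite zE !mxE (_ : _ - x 0 i = - (t * e 0 i) + u 0 i); last by ring.
  rewrite (le_trans (ler_normD _ _))// normrN normrM (gtr0_norm t0) lerD//.
    by rewrite ler_piMr// ltW.
  exact: le_trans dlt.
have hz0 := (hr z zx).1 Omz.
have zeE : dotv z e = dotv x e - t + dotv u e by rewrite zE !dotvE ee; ring.
have pe : z - dotv z e *: e = p + (u - dotv u e *: e).
  rewrite zeE /p [in LHS]zE; apply/rowP => i; rewrite !mxE; ring.
have hp := hl (z - dotv z e *: e) p.
have up : enorm (u - dotv u e *: e) <= n.+1%:R * ((1 + n.+1%:R) * dl).
  apply: enorm_le_coord => [|i]; first by rewrite mulr_ge0 ?addr_ge0// ltW.
  rewrite !mxE mulrDl mul1r (le_trans (ler_normB _ _))// lerD// normrM.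
  by rewrite -[leRHS]mulr1 ler_pM.
have hM : M * enorm (u - dotv u e *: e) <= (`|M| + 1) * (n.+1%:R * ((1 + n.+1%:R) * dl)).
  apply: (@le_trans _ _ ((`|M| + 1) * enorm (u - dotv u e *: e))).
    by rewrite ler_wpM2r ?enorm_ge0// (le_trans (ler_norm _))// lerDl.
  by rewrite ler_wpM2l// addr_ge0.
have pE : z - dotv z e *: e - p = u - dotv u e *: e by rewrite pe addrAC subrr add0r.
rewrite pE in hp.
have hp' := le_trans (ler_norm _) (le_trans (eq_ind _ (fun v => v <= _) hp _ (distrC _ _)) hM).
have ue' := le_trans (ler_norm _) ue; move: hz0.
have Ddl : D * dl = t by rewrite /dl mulrC divfK// gt_eqF.
set hv := h (z - _) in hp' *; clearbody hv; move: Ddl; rewrite /D zeE => Ddl hz.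
have : t = n.+1%:R * dl + (`|M| + 1) * (n.+1%:R * ((1 + n.+1%:R) * dl)) by rewrite -Ddl; ring.
move: hp' ue' hz hx; set q1 := n.+1%:R * dl; set q2 := _ * (_ * (_ * dl)); lra.
Qed.


Lemma weak_gradientS U V (v : E -> R) (G : E -> E) : open U -> open V -> V `<=` U ->
  is_weak_gradient U v G -> is_weak_gradient V v G.
Proof.
move=> oU oV VU wG i; have [LG hG] := wG i.
have mU := open_measurable_rV oU; have mV := open_measurable_rV oV.
split; first exact: L2funS LG.
move=> f [sf cf fV].
have tU : test U f by split => // x /fV/VU.
have supp x : ~ V x -> f x = 0.
  move=> nV; apply/eqP; apply: contrapT => /negP fx; apply: nV; apply: fV.
  exact: subset_closure.
have psupp x : ~ V x -> partial i f x = 0.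
  move=> nV.
  (* The derivative vanishes because f is 0 near x, the support being closed; f x = 0 alone would
     not do. *)
  have f0 : \forall y \near x, f y = 0.
    have : nbhs x (~` closure [set z | f z != 0]).
      by apply: open_nbhs_nbhs; split; [exact/closed_openC/closed_closure|move=> /fV].
    apply: filterS => y ny; apply/eqP; apply: contrapT => /negP fy; apply: ny.
    exact: subset_closure.
  rewrite /partial (@near_eq_derive _ _ _ f (fun=> 0)) ?derive_cst//.
rewrite -(L2dot_support _ VU) => [|x _]; last exact: psupp.
rewrite -(L2dot_support _ VU) => [|x _]; last exact: supp.
exact: hG.
Qed.

Section mesh.
Variables (I : finType) (K : I -> set E) (Om : set E) (gamma kappa H : R).
Hypotheses (mK : mesh K Om gamma kappa H) (g0 : 0 < gamma) (k0 : 0 < kappa).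

Let H0 : 0 < H. Proof. by case: mK => -[]. Qed.

Lemma mesh_closed i : closed (K i).
Proof. by have [_ _ h _ _] := mK; have [] := h i. Qed.

Lemma mesh_convexv i : convexv (K i).
Proof. by have [_ _ h _ _] := mK; apply: convex_setP; have [] := h i. Qed.

Lemma mesh_enorm_le i x y : K i x -> K i y -> enorm (x - y) <= H.
Proof.
move=> Kx Ky; have [_ _ _ h _] := mK; have [dH _] := h i.
by rewrite -lee_fin; apply: le_trans (enorm_le_diam Kx Ky) dH.
Qed.

(* Every element contains a cube of radius 2 * mesh_radius * H. *)
Definition mesh_radius : R := gamma * kappa / (2 * n.+1%:R).

Lemma mesh_radius_gt0 : 0 < mesh_radius.
Proof. by rewrite divr_gt0// mulr_gt0. Qed.

(** The inscribed ball has radius at least gamma kappa H and the Euclidean norm is at most n+1 times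
    the largest coordinate. In the second factor, 1/[mesh_radius] accounts for the diameter H, and
    the added 1 ensures Lam >= 1. *)
Lemma mesh_element i : exists2 x0, cube x0 (2 * (mesh_radius * H)) `<=` K i &
  forall y, K i y -> forall j, `|x0 0 j - y 0 j| <= (1 + mesh_radius^-1) * (mesh_radius * H).
Proof.
have [_ _ _ hd hb] := mK; have [d1 d2] := hd i; have [x0 hx] := hb i.
have r0 := mesh_radius_gt0.
have dfin : diam (K i) \is a fin_num.
  rewrite fin_numE; apply/andP; split; apply/eqP => dE.
    by move: d2; rewrite dE leeNy_eq.
  by move: d1; rewrite dE leye_eq.
have dk : kappa * H <= fine (diam (K i)) by rewrite -lee_fin fineK.
have sub : cube x0 (2 * (mesh_radius * H)) `<=` K i.
  move=> y yx; apply: hx => /=.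
  have h0 : 0 <= 2 * (mesh_radius * H) by rewrite !mulr_ge0// ltW.
  apply: le_trans (@enorm_le_coord _ _ _ (2 * (mesh_radius * H)) h0 _) _.
    by move=> j; rewrite !mxE; exact: yx.
  apply: (@le_trans _ _ (gamma * (kappa * H))); last by rewrite ler_wpM2l// ltW.
  by rewrite le_eqVlt; apply/orP; left; apply/eqP; rewrite /mesh_radius; field.
exists x0 => // y Ky j.
have Kx0 : K i x0 by apply: sub => l; rewrite subrr normr0 !mulr_ge0// ltW.
apply: (@le_trans _ _ H).
  by apply: le_trans (mesh_enorm_le Kx0 Ky); have := enorm_coord (x0 - y) j; rewrite !mxE.
by rewrite mulrDl mul1r mulrA mulVf ?gt_eqF// mul1r lerDr mulr_ge0 ?(ltW r0) ?(ltW H0).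
Qed.

Lemma mesh_element_subcube i : exists2 x0, cube x0 (2 * (mesh_radius * H)) `<=` K i & exists2 L, 0 <= L & K i `<=` cube x0 L.
Proof.
have [x0 h1 h2] := mesh_element i; exists x0 => //.
exists ((1 + mesh_radius^-1) * (mesh_radius * H)).
  by rewrite !mulr_ge0 ?addr_ge0 ?invr_ge0// ltW// mesh_radius_gt0.
by move=> y Ky j; rewrite distrC; exact: h2.
Qed.

Lemma mesh_interior_measure i : (0 < leb (K i)° < +oo)%E.
Proof.
have [x0 h1 [L L0 h2]] := mesh_element_subcube i.
have mKi : measurable (K i)° by apply: open_measurable_rV; exact: open_interior.
have r0 : 0 < mesh_radius * H by rewrite mulr_gt0// mesh_radius_gt0.
apply/andP; split.
  apply: (@lt_le_trans _ _ (leb (cube x0 (mesh_radius * H)))).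
    by rewrite lebesgue_cube ?ltW// lte_fin exprn_gt0// pmulrn_lgt0.
  apply: le_measure; rewrite ?inE//; first exact: measurable_cube.
  move=> z zc; apply/nbhs_cubeP; exists (mesh_radius * H) => // z' zz; apply: h1 => j.
  rewrite (_ : _ - _ = (z' 0 j - z 0 j) + (z 0 j - x0 0 j)); last by ring.
  by rewrite (le_trans (ler_normD _ _))//; have := zz j; have := zc j; lra.
apply: le_lt_trans (lebesgue_cube_lty x0 L).
apply: le_measure; rewrite ?inE//; first exact: measurable_cube.
by move=> z /interior_subset/h2.
Qed.

Lemma mesh_disjoint i j x : (K i)° x -> (K j)° x -> i = j.
Proof.
move=> xi xj; have [_ h _ _ _] := mK; apply/eqP; apply: contrapT => /negP ij.
have : ((K i)° `&` (K j)°) x by [].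
by rewrite h.
Qed.

(** Quasi-uniformity read backwards: kappa H is at most the diameter of an element, hence of the
    domain. It absorbs positive powers of H into constants. *)
Lemma mesh_size_le B : 0 <= B -> (forall x, closure Om x -> forall j, `|x 0 j| <= B) ->
  H <= n.+1%:R * (2 * B) / kappa.
Proof.
move=> B0 hB; have [[_ I0 cO] _ _ hd _] := mK.
have [i _] : exists i : I, i \in I by apply/card_gt0P.
have [_ d2] := hd i.
rewrite ler_pdivlMr// mulrC -lee_fin; apply: le_trans d2 _.
apply: ge_ereal_sup => _ [[x y] [/= Kx Ky] <-]; rewrite lee_fin.
have cK z : K i z -> closure Om z by move=> Kz; rewrite cO; exists i.
apply: enorm_le_coord => [|j]; first by rewrite mulr_ge0.
rewrite !mxE (le_trans (ler_normB _ _))//.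
by have := hB _ (cK _ Kx) j; have := hB _ (cK _ Ky) j; lra.
Qed.

Lemma mesh_patchE l i : mesh_patch K l i = \bigcup_(j in [set j | j \in submesh K (mesh_patch K l i)]) K j.
Proof.
apply/seteqP; split=> [x|x [j /=]]; last first.
  by rewrite inE => /asboolP; apply.
case: l => [|l]; rewrite /mesh_patch /=.
  by move=> Kx; exists i => //=; rewrite inE; apply/asboolP.
by move=> [j jS Kx]; exists j => //=; rewrite inE; apply/asboolP => z Kz; exists j.
Qed.

Lemma mesh_patch_closed l i : closed (mesh_patch K l i).
Proof.
rewrite mesh_patchE; apply: closed_bigcup => [|j _]; [exact: finite_finset|exact: mesh_closed].
Qed.

Lemma mesh_patch_sub l i : mesh_patch K l i `<=` closure Om.
Proof.
have [[_ _ ->] _ _ _ _] := mK.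
by rewrite mesh_patchE => x [j _ Kx]; exists j.
Qed.

End mesh.

End mesh_geometry.

(** * Integrals over covers and over disjoint families *)

Section integral_cover.
Context dd (T : measurableType dd) (R : realType) (mu : {measure set T -> \bar R}).
Local Open Scope ereal_scope.

Lemma integral_cover_le (I : eqType) (s : seq I) (F : I -> set T) (D : set T) (h : T -> \bar R) :
  measurable D -> (forall j, measurable (F j)) -> measurable_fun D h ->
  (forall x, 0 <= h x) -> (forall x, D x -> exists2 j, j \in s & F j x) ->
  \int[mu]_(x in D) h x <= \sum_(j <- s) \int[mu]_(x in D `&` F j) h x.
Proof.
move=> mD mF mh h0 DF.
have mhF j : measurable_fun D (h \_ (F j)).
  by apply/(measurable_restrict _ (mF j) mD).1; exact: measurable_funS mh.
have hF0 j x : 0 <= (h \_ (F j)) x by rewrite patchE; case: ifP.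
under eq_bigr do rewrite integral_mkcondr.
rewrite -ge0_integral_sum//.
apply: ge0_le_integral => //.
- by apply: emeasurable_sum.
- move=> x Dx; have [j js Fx] := DF x Dx.
  rewrite (big_rem j)//= patchE mem_set// leeDl//.
  by apply: sume_ge0.
Qed.

Lemma sum_disjoint_integral_le (I : eqType) (s : seq I) (F : I -> set T) (U : set T) (h : T -> \bar R) :
  measurable U -> (forall j, measurable (F j)) -> measurable_fun U h ->
  (forall x, 0 <= h x) -> uniq s -> trivIset [set` s] F -> (forall j, j \in s -> F j `<=` U) ->
  \sum_(j <- s) \int[mu]_(x in F j) h x <= \int[mu]_(x in U) h x.
Proof.
move=> mU mF mh h0 us tF FU.
have sub : \big[setU/set0]_(i <- s) F i `<=` U.
  rewrite big_seq; apply: (big_ind (fun A => A `<=` U)) => // A B AU BU x [/AU|/BU]//.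
have mB : measurable (\big[setU/set0]_(i <- s) F i) by exact: bigsetU_measurable.
rewrite -ge0_integral_bigsetU//; last exact: measurable_funS mh.
exact: ge0_subset_integral.
Qed.

End integral_cover.

Section bounded_domain.
Variables (R : realType) (n : nat).
Local Notation E := 'rV[R]_n.+1.

Lemma bounded_closure_coord (Om : set E) : bounded_set Om ->
  exists2 B, 0 <= B & forall x, closure Om x -> forall j, `|x 0 j| <= B.
Proof.
move=> [M0 [_ hM0]]; pose M := M0 + 1.
have hM : forall x, Om x -> `|x| <= M by apply: hM0; rewrite ltrDl.
have sub : Om `<=` cube 0 `|M|.
  move=> x Ox j; rewrite mxE subr0.
  apply: le_trans (le_trans (hM x Ox) (ler_norm M)).
  rewrite /Num.norm/= mx_normrE.
  exact: (le_bigmax _ (fun ij => `|x ij.1 ij.2|) (0, j)).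
exists `|M| => // x; move/(closure_subset sub).
by rewrite -(closure_id _).1; [move=> h j; have := h j; rewrite mxE subr0|exact: closed_cube].
Qed.

End bounded_domain.

(** * Trace inequality on a patch *)

Section trace_patch.
Variables (R : realType) (n : nat).
Local Notation E := 'rV[R]_n.+1.
Local Notation leb := (lebesgue_rV R n.+1).
Local Notation T1 := (caratheodory_type (surface_outer R n.+1)).
Variables (I : finType) (K : I -> set E) (Om : set E) (gamma kappa H : R).
Hypotheses (mK : mesh K Om gamma kappa H) (g0 : 0 < gamma) (k0 : 0 < kappa).
Hypothesis (bOm : bounded_set Om).

Lemma measurable_bdry (w : set E) : measurable (bdry w).
Proof.
apply: measurableD; last by apply: open_measurable_rV; exact: open_interior.
rewrite -[closure w]setCK; apply: measurableC; apply: open_measurable_rV.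
exact/closed_openC/closed_closure.
Qed.

Lemma measurable_Gamma1 (w : set E) : measurable (Gamma1 Om w).
Proof. by apply: measurableD; exact: measurable_bdry. Qed.

Lemma mesh_patch_measure l i : (leb (mesh_patch K l i)° < +oo)%E.
Proof.
have [B B0 hB] := bounded_closure_coord bOm.
apply: le_lt_trans (lebesgue_cube_lty (0 : E) B); apply: le_measure; rewrite ?inE.
- by apply: open_measurable_rV; exact: open_interior.
- exact: measurable_cube.
- by move=> x /interior_subset /(mesh_patch_sub mK) h j; rewrite mxE subr0; exact: hB.
Qed.

Lemma Gamma1_element l i x : Gamma1 Om (mesh_patch K l i) x ->
  exists2 j, j \in submesh K (mesh_patch K l i) & (K j `\` (K j)°) x.
Proof.
move=> [[cx nx] _].
have : mesh_patch K l i x by rewrite (closure_id (mesh_patch K l i)).1//; exact: (mesh_patch_closed mK).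
rewrite {1}mesh_patchE => -[j /= jS Kx]; exists j => //; split=> // kx; apply: nx.
by apply: interiorS kx; move: jS; rewrite inE => /asboolP.
Qed.

Lemma mesh_patch_interior_sum l i (u : E -> R) : L2fun leb (mesh_patch K l i)° u ->
  \sum_(j <- enum (submesh K (mesh_patch K l i))) L2dot leb (K j)° u u <=
  L2dot leb (mesh_patch K l i)° u u.
Proof.
set w := mesh_patch K l i => hu.
have mU : measurable w° by apply: open_measurable_rV; exact: open_interior.
have mF j : measurable (K j)° by apply: open_measurable_rV; exact: open_interior.
have sub j : j \in enum (submesh K w) -> (K j)° `<=` w°.
  by rewrite mem_enum inE => /asboolP Kw; exact: interiorS.
rewrite -lee_fin -sumEFin L2dot_EFin//.
rewrite big_seq (eq_bigr (fun j => (\int[leb]_(x in (K j)°) (u x ^+ 2)%:E)%E)); last first.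
  by move=> j js; rewrite L2dot_EFin//; apply: L2funS hu => //; exact: sub.
rewrite -big_seq; apply: sum_disjoint_integral_le => //.
- by apply/measurable_EFinP; apply: measurable_funX; have [] := hu.
- by move=> x; rewrite lee_fin sqr_ge0.
- exact: enum_uniq.
- by move=> j j' _ _ [x [xj xj']]; exact: (mesh_disjoint mK xj xj').
Qed.

(** Summation over the elements of the patch. Their boundaries may overlap, which only enlarges the
    right-hand side, while their interiors are disjoint, so the volume terms add up to at most those
    of the patch. *)
Lemma trace_patch l i f G : let w := mesh_patch K l i in
  continuous f -> L2fun leb w° f -> is_weak_gradient w° f G ->
  (\int[surface R n.+1]_(y in Gamma1 Om w) (f y ^+ 2)%:E <=
   (trace_cst n (1 + (mesh_radius n gamma kappa)^-1) *
     ((mesh_radius n gamma kappa * H)^-1 * L2dot leb w° f f +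
      (mesh_radius n gamma kappa * H) * \sum_i L2dot leb w° (fun x => G x 0 i) (fun x => G x 0 i)))%:E)%E.
Proof.
move=> w cf hf wG; set rho := mesh_radius n gamma kappa; set C := trace_cst _ _.
have H0 : 0 < H by case: mK => -[].
have rho0 : 0 < rho by exact: mesh_radius_gt0.
have rH0 : 0 < rho * H by rewrite mulr_gt0.
have mG := measurable_Gamma1 w.
have oU : open w° by exact: open_interior.
have mU := open_measurable_rV oU.
have mKj j : measurable (K j).
  rewrite -[K j]setCK; apply: measurableC; apply: open_measurable_rV.
  exact/closed_openC/(mesh_closed mK).
have mGs := measurable_surface mG.
have mh : measurable_fun (Gamma1 Om w : set T1) (fun y : T1 => (f y ^+ 2)%:E).
  apply/measurable_EFinP; apply: measurable_funX; apply: measurable_funTS.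
  by apply: measurable_fun_surface; exact: continuous_measurable_rV.
have L1 : 1 <= 1 + rho^-1 by rewrite lerDl invr_ge0 ltW.
have cov (x : T1) : (Gamma1 Om w : set T1) x -> exists2 j, j \in enum (submesh K w) & (K j : set T1) x.
  by move=> /Gamma1_element[j js [Kx _]]; exists j => //; rewrite mem_enum.
have h0 (x : T1) : (0 <= (f x ^+ 2)%:E)%E by rewrite lee_fin sqr_ge0.
have := @integral_cover_le _ T1 R (surface R n.+1) I (enum (submesh K w)) K (Gamma1 Om w)
  (fun y : T1 => (f y ^+ 2)%:E) mGs (fun j => measurable_surface (mKj j)) mh h0 cov.
move/le_trans; apply.
apply: (@le_trans _ _ (\sum_(j <- enum (submesh K w)) (C * ((rho * H)^-1 * L2dot leb (K j)° f f +
     (rho * H) * \sum_i L2dot leb (K j)° (fun x => G x 0 i) (fun x => G x 0 i)))%:E)%E).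
  rewrite big_seq [leRHS]big_seq; apply: lee_sum => j; rewrite mem_enum inE => /asboolP Kw.
  have sub : (K j)° `<=` w° by exact: interiorS.
  have mF : measurable (K j)° by apply: open_measurable_rV; exact: open_interior.
  have [x0 h1 h2] := mesh_element mK g0 k0 j.
  apply: (trace_element (x0 := x0)).
  - exact: (mesh_closed mK).
  - exact: (mesh_convexv mK).
  - by have /andP[] := mesh_interior_measure mK g0 k0 j.
  - exact: cf.
  - exact: L2funS hf.
  - by apply: weak_gradientS wG => //; exact: open_interior.
  - exact: L1.
  - exact: rH0.
  - exact: h1.
  - exact: h2.
  - exact: measurableI.
  (* A point interior to an element is interior to the patch, so it is not on the patch boundary. *)
  - move=> x [[[_ nx] _] Kx]; split=> // kx; apply: nx; exact: sub.
rewrite sumEFin lee_fin -mulr_sumr.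
have C0 : 0 <= C.
  rewrite /C /trace_cst mulr_ge0 ?ahlfors_cst_ge0//.
  have L0 : 0 <= 1 + rho^-1 by exact: le_trans L1.
  have B0 := bump_bound_gt0 R.
  apply: addr_ge0; apply: mulr_ge0.
  - by rewrite mulr_ge0// exprn_ge0// mulr_ge0// sqr_ge0.
  - by rewrite exprn_ge0.
  - by rewrite mulr_ge0 ?element_cst_ge0// mulr_ge0// sqr_ge0.
  - by rewrite exprn_ge0// mulr_ge0.
rewrite ler_wpM2l// big_split/= -!mulr_sumr lerD//.
  by rewrite ler_wpM2l ?invr_ge0 ?(ltW rH0)// mesh_patch_interior_sum.
rewrite ler_wpM2l ?(ltW rH0)// exchange_big/=; apply: ler_sum => k _.
by apply: mesh_patch_interior_sum; have [] := wG k.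
Qed.

End trace_patch.

(** * Finite combinations in L2 and of functions with weak gradients *)

Section L2_sums.
Context dd (T : measurableType dd) (R : realType) (mu : {measure set T -> \bar R}).

(** The crude factor 2^N is harmless: N is fixed before the summands, which are approximation
    errors, are made small. *)
Lemma L2dot_sum_le (D : set T) (N : nat) (u : 'I_N -> T -> R) : measurable D ->
  (forall k, L2fun mu D (u k)) ->
  L2dot mu D (fun x => \sum_k u k x) (fun x => \sum_k u k x) <=
  2 ^+ N * \sum_k L2dot mu D (u k) (u k).
Proof.
move=> mD; elim: N u => [|N IH] u hu.
  rewrite big_ord0 mulr0 (@eq_L2dot _ _ _ _ _ _ _ (fun=> 0) (fun=> 0)) => [|x _|x _]; rewrite ?big_ord0//.
  by rewrite /L2dot Rintegral_cst// mulr0 mul0r.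
have hS := @L2fun_sum _ _ _ mu D _ (index_enum 'I_N) (fun k => u (lift ord0 k)) mD (fun k => hu _).
rewrite (@eq_L2dot _ _ _ _ _ _ _ (fun x => u ord0 x + \sum_k u (lift ord0 k) x) (fun x => u ord0 x + \sum_k u (lift ord0 k) x)) => [|x _|x _]; rewrite ?big_ord_recl//.
apply: le_trans (L2dot_sqrD_le mD (hu ord0) hS) _.
have h := IH (fun k => u (lift ord0 k)) (fun k => hu _).
rewrite exprS mulrDr lerD//.
  rewrite -mulrA ler_wpM2l// ler_peMl ?L2dot_ge0//.
  by rewrite exprn_ege1// ler1n.
by rewrite -mulrA ler_wpM2l.
Qed.

End L2_sums.

Section sobolev_pairs.
Variables (R : realType) (n : nat).
Local Notation E := 'rV[R]_n.+1.
Local Notation leb := (lebesgue_rV R n.+1).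
Variable U : set E.
Hypotheses (oU : open U) (fU : (leb U < +oo)%E).
Implicit Types (u v : E -> R) (G : E -> E).

Let mU : measurable U. Proof. exact: open_measurable_rV. Qed.

Lemma test_L2fun f i : test U f -> L2fun leb U (partial i f).
Proof.
move=> [sf cS SU]; set S := closure _ in cS SU.
have [_ /(_ i)[_ [cp _]]] := sf 1%N.
have psupp x : ~ S x -> partial i f x = 0.
  move=> nS.
  have f0 : \forall y \near x, f y = 0.
    have : nbhs x (~` S).
      by apply: open_nbhs_nbhs; split; [exact/closed_openC/closed_closure|].
    apply: filterS => y ny; apply/eqP; apply: contrapT => /negP fy; apply: ny.
    exact: subset_closure.
  by rewrite /partial (@near_eq_derive _ _ _ f (fun=> 0)) ?derive_cst.
have cn : continuous (fun x => `|partial i f x|).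
  by move=> x; apply: continuous_comp; [exact: cp|exact: norm_continuous].
have [B hB] : exists B, forall x, `|partial i f x| <= B.
  have [S0|S0] := pselect (S !=set0); last first.
    by exists 0 => x; rewrite psupp ?normr0// => Sx; apply: S0; exists x.
  have [c _ hc] := EVT_max_rV S0 cS (continuous_subspaceT cn).
  exists `|partial i f c| => x; have [Sx|Sx] := pselect (S x); first by apply: hc; exact: mem_set.
  by rewrite psupp// normr0.
apply: (bounded_L2fun (B := B)) => //.
by apply: measurable_funTS; exact: continuous_measurable_rV.
Qed.

(** [wgrad] is a choice, so its value at a sum need not be the sum of its values; pairs with an
    explicit gradient are closed under linear combinations. *)
Definition sobolev_pair u G := L2fun leb U u /\ is_weak_gradient U u G.

Definition sobolev_sqr u G : R := L2dot leb U u u +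
  \sum_i L2dot leb U (fun x => G x 0 i) (fun x => G x 0 i).

Lemma test_L2 f : test U f -> L2fun leb U f.
Proof.
move=> [sf cS SU]; set S := closure _ in cS SU.
have [cf _] := sf 0%N.
have supp x : ~ S x -> f x = 0.
  move=> nS; apply/eqP; apply: contrapT => /negP fy; apply: nS; exact: subset_closure.
have cn : continuous (fun x => `|f x|).
  by move=> x; apply: continuous_comp; [exact: cf|exact: norm_continuous].
have [B hB] : exists B, forall x, `|f x| <= B.
  have [S0|S0] := pselect (S !=set0); last first.
    by exists 0 => x; rewrite supp ?normr0// => Sx; apply: S0; exists x.
  have [c _ hc] := EVT_max_rV S0 cS (continuous_subspaceT cn).
  exists `|f c| => x; have [Sx|Sx] := pselect (S x); first by apply: hc; exact: mem_set.
  by rewrite supp// normr0.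
apply: (bounded_L2fun (B := B)) => //.
by apply: measurable_funTS; exact: continuous_measurable_rV.
Qed.

Lemma sobolev_pairD u v G G' : sobolev_pair u G -> sobolev_pair v G' ->
  sobolev_pair (fun x => u x + v x) (fun x => G x + G' x).
Proof.
move=> [hu wu] [hv wv]; split; first exact: L2fun_add.
move=> i; have [Lu Gu] := wu i; have [Lv Gv] := wv i.
have -> : (fun x => (G x + G' x) 0 i) = (fun x => G x 0 i + G' x 0 i).
  by apply/funext => x; rewrite mxE.
split; first exact: L2fun_add.
move=> f tf; have Lf := test_L2 tf; have Lp := test_L2fun i tf.
by rewrite !L2dot_addl// Gu// Gv// opprD.
Qed.

Lemma sobolev_pairZ a u G : sobolev_pair u G ->
  sobolev_pair (fun x => a * u x) (fun x => a *: G x).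
Proof.
move=> [hu wu]; split; first exact: L2fun_scale.
move=> i; have [Lu Gu] := wu i.
have -> : (fun x => (a *: G x) 0 i) = (fun x => a * G x 0 i).
  by apply/funext => x; rewrite mxE.
split; first exact: L2fun_scale.
move=> f tf; have Lf := test_L2 tf; have Lp := test_L2fun i tf.
by rewrite !L2dot_scalel// Gu// mulrN.
Qed.

Lemma sobolev_sqrD_le u v G G' : sobolev_pair u G -> sobolev_pair v G' ->
  sobolev_sqr (fun x => u x + v x) (fun x => G x + G' x) <=
  2 * sobolev_sqr u G + 2 * sobolev_sqr v G'.
Proof.
move=> [hu wu] [hv wv]; rewrite /sobolev_sqr.
have h1 := L2dot_sqrD_le mU hu hv.
have h2 : \sum_i L2dot leb U (fun x => (G x + G' x) 0 i) (fun x => (G x + G' x) 0 i) <=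
    2 * (\sum_i L2dot leb U (fun x => G x 0 i) (fun x => G x 0 i)) +
    2 * (\sum_i L2dot leb U (fun x => G' x 0 i) (fun x => G' x 0 i)).
  rewrite !mulr_sumr -big_split; apply: ler_sum => i _.
  have -> : (fun x => (G x + G' x) 0 i) = (fun x => G x 0 i + G' x 0 i).
    by apply/funext => x; rewrite mxE.
  by apply: L2dot_sqrD_le => //; [have [] := wu i|have [] := wv i].
by move: h1 h2; lra.
Qed.

Lemma sobolev_sqrZ a u G : sobolev_pair u G ->
  sobolev_sqr (fun x => a * u x) (fun x => a *: G x) = a ^+ 2 * sobolev_sqr u G.
Proof.
move=> [hu wu]; rewrite /sobolev_sqr mulrDr; congr (_ + _).
  by rewrite L2dot_scalel ?L2dot_scaler ?mulrA//; exact: L2fun_scale.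
rewrite mulr_sumr; apply: eq_bigr => i _; have [Lu _] := wu i.
have -> : (fun x => (a *: G x) 0 i) = (fun x => a * G x 0 i).
  by apply/funext => x; rewrite mxE.
by rewrite L2dot_scalel ?L2dot_scaler ?mulrA//; exact: L2fun_scale.
Qed.

Lemma H1_pair u : H1 U u -> sobolev_pair u (wgrad U u).
Proof.
move=> [hu [G wG]]; split => //.
by rewrite /wgrad; case: xgetP => [G' -> //|/(_ G)].
Qed.

Lemma H1norm_sqr u : H1 U u -> H1norm U u ^+ 2 = sobolev_sqr u (wgrad U u).
Proof.
move=> /H1_pair[hu wu]; rewrite /H1norm sqr_sqrtr; last first.
  by rewrite addr_ge0 ?L2dot_ge0//; apply: Rintegral_ge0 => x _; exact: dotv_ge0.
rewrite /sobolev_sqr; congr (_ + _).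
have := integral_sumsqr mU (fun i => (wu i).1) => h.
rewrite /Rintegral (eq_integral (fun x => (\sum_i wgrad U u x ord0 i ^+ 2)%:E)) ?h//.
Qed.

Lemma sobolev_pair_H1 u G : sobolev_pair u G -> H1 U u.
Proof. by move=> [hu wu]; split => //; exists G. Qed.

Lemma H1D u v : H1 U u -> H1 U v -> H1 U (fun x => u x + v x).
Proof. by move=> /H1_pair hu /H1_pair hv; exact: sobolev_pair_H1 (sobolev_pairD hu hv). Qed.

Lemma H1Z a u : H1 U u -> H1 U (fun x => a * u x).
Proof. by move=> /H1_pair hu; exact: sobolev_pair_H1 (sobolev_pairZ a hu). Qed.

Lemma eq_H1 u v : {in U, u =1 v} -> H1 U u -> H1 U v.
Proof.
move=> uv [hu [G wG]]; split; first exact: eq_L2fun hu.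
exists G => i; have [LG hG] := wG i; split => // f tf; rewrite -hG//.
by apply: eq_L2dot => // x xU; rewrite uv.
Qed.

Lemma H1_scale_sum N (u : nat -> E -> R) (a : nat -> R) : (forall k, H1 U (u k)) ->
  forall v, H1 U v -> H1 U (fun x => v x + \sum_(k < N) a k * u k x).
Proof.
move=> hu v hv; elim: N => [|N IH].
  by apply: eq_H1 hv => x _; rewrite big_ord0 addr0.
apply: eq_H1 (H1D IH (H1Z (a N) (hu N))) => x _.
by rewrite big_ord_recr/= addrA.
Qed.

Lemma sobolev_pair_scale_sum N (u : nat -> E -> R) (a : nat -> R) v G : (forall k, H1 U (u k)) ->
  sobolev_pair v G -> exists2 GS, sobolev_pair (fun x => v x + \sum_(k < N) a k * u k x) GS &
   sobolev_sqr (fun x => v x + \sum_(k < N) a k * u k x) GS <=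
     2 * sobolev_sqr v G + 2 * (2 ^+ N * \sum_(k < N) a k ^+ 2 * H1norm U (u k) ^+ 2).
Proof.
move=> hu hv.
have [GS pS qS] : exists2 GS, sobolev_pair (fun x => \sum_(k < N) a k * u k x) GS &
   sobolev_sqr (fun x => \sum_(k < N) a k * u k x) GS <=
     2 ^+ N * \sum_(k < N) a k ^+ 2 * H1norm U (u k) ^+ 2.
  elim: N => [|N [GS pS qS]].
    have := sobolev_pairZ 0 hv; have := sobolev_sqrZ 0 hv.
    rewrite (_ : (fun x => 0 * v x) = (fun x => \sum_(k < 0) a k * u k x)); last first.
      by apply/funext => x; rewrite big_ord0 mul0r.
    move=> h p; exists (fun x => 0 *: G x) => //.
    by rewrite h expr0n mul0r big_ord0 mulr0.
  have hN := H1_pair (hu N).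
  have hZ := sobolev_pairZ (a N) hN.
  exists (fun x => GS x + a N *: wgrad U (u N) x).
    rewrite (_ : (fun x => \sum_(k < N.+1) a k * u k x) = (fun x => \sum_(k < N) a k * u k x + a N * u N x)); last first.
      by apply/funext => x; rewrite big_ord_recr.
    exact: sobolev_pairD.
  rewrite (_ : (fun x => \sum_(k < N.+1) a k * u k x) = (fun x => \sum_(k < N) a k * u k x + a N * u N x)); last first.
    by apply/funext => x; rewrite big_ord_recr.
  apply: le_trans (sobolev_sqrD_le pS hZ) _.
  rewrite sobolev_sqrZ// -H1norm_sqr// big_ord_recr/= (exprS 2 N) [leRHS]mulrDr lerD//.
    by rewrite -mulrA ler_wpM2l.
  have p0 : 0 <= a N ^+ 2 * H1norm U (u N) ^+ 2 by apply: mulr_ge0; exact: sqr_ge0.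
  by rewrite -mulrA ler_wpM2l// ler_peMl// exprn_ege1// ler1n.
exists (fun x => G x + GS x); first exact: sobolev_pairD.
apply: le_trans (sobolev_sqrD_le hv pS) _.
by rewrite lerD2l ler_wpM2l.
Qed.

End sobolev_pairs.

(** * Coefficients of a partial sum, bounded through the boundary norm *)

Section trace_coefficients.
Variables (R : realType) (n : nat).
Local Notation E := 'rV[R]_n.+1.
Local Notation leb := (lebesgue_rV R n.+1).
Local Notation T1 := (caratheodory_type (surface_outer R n.+1)).
Local Notation surf := (surface R n.+1).
Variables (U Gam : set E) (Ct : R).
Hypotheses (oU : open U) (fU : (leb U < +oo)%E) (mGam : measurable (Gam : set T1)) (Ct0 : 0 <= Ct).
Hypothesis tr : forall (f : E -> R) (G : E -> E), continuous f -> L2fun leb U f ->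
  is_weak_gradient U f G -> (\int[surf]_(y in Gam) (f y ^+ 2)%:E <= (Ct * sobolev_sqr U f G)%:E)%E.

Let mU : measurable U. Proof. exact: open_measurable_rV. Qed.

Variables (N : nat) (psi t : nat -> E -> R) (a : nat -> R) (v : E -> R).
Hypotheses (ht : forall k, is_trace U Gam (psi k) (t k))
  (to : forall j k, L2dot surf Gam (t j) (t k) = (j == k)%:R)
  (hpsi : forall k, H1 U (psi k)) (hv : H1 U v) (hv1 : H1norm U v = 1)
  (hr : H1norm U (fun x => v x - \sum_(k < N) a k * psi k x) <= 1).

Let Lt k : L2fun surf Gam (t k). Proof. by have [] := ht k. Qed.

Let sum_sqr : L2dot surf Gam (fun x => \sum_(k < N) a k * t k x) (fun x => \sum_(k < N) a k * t k x) =
  \sum_(k < N) a k ^+ 2.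
Proof.
have hT : L2fun surf Gam (fun x => \sum_(k < N) a k * t k x).
  by apply: (@L2fun_sum _ T1 _ surf Gam _ _ (fun (k : 'I_N) x => a k * t k x) mGam) => k; exact: L2fun_scale.
have Lat (k : 'I_N) : L2fun surf Gam (fun x => a k * t k x) by exact: L2fun_scale.
rewrite (@L2dot_suml _ T1 _ surf Gam _ _ (fun (k : 'I_N) x => a k * t k x) _ mGam)//.
apply: eq_bigr => k _; rewrite (L2dot_scalel _ mGam)// L2dotC.
rewrite (@L2dot_suml _ T1 _ surf Gam _ _ (fun (k : 'I_N) x => a k * t k x) _ mGam)//.
rewrite (bigD1 k)//= (L2dot_scalel _ mGam)// to eqxx mulr1 big1 ?addr0 ?expr2// => j jk.
rewrite (L2dot_scalel _ mGam)// to (_ : (j == k :> nat) = false) ?mulr0//.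
exact: negbTE jk.
Qed.

(** The left side is the squared norm of the trace of the partial sum, by [sum_sqr]. Since [tr] is
    for continuous functions, each [psi k] is replaced by a term [f k m] of its approximating
    sequence; the errors tend to 0 with m, for fixed N and [a]. The 16 is 2 * 2 * 4 from three uses
    of |x + y|^2 <= 2|x|^2 + 2|y|^2. *)
Lemma trace_coefficients_le : \sum_(k < N) a k ^+ 2 <= 16 * Ct.
Proof.
have [f hf] := choice (fun k => (ht k).2).
pose P := 2 ^+ N * \sum_(k < N) a k ^+ 2.
have P0 : 0 <= P by rewrite mulr_ge0// sumr_ge0// => k _; exact: sqr_ge0.
pose w0 x := v x - \sum_(k < N) a k * psi k x.
have hw0 : H1 U w0.
  apply: eq_H1 (H1_scale_sum oU fU N (fun k => - a k) hpsi hv) => x _.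
  by rewrite /w0 -sumrN; congr (_ + _); apply: eq_bigr => k _; rewrite mulNr.
have pv := H1_pair hv; have pw := sobolev_pairZ oU fU (-1) (H1_pair hw0).
have pb := sobolev_pairD oU fU pv pw.
(* v - w0 is the partial sum; both terms have norm at most 1. *)
have qb : sobolev_sqr U (fun x => v x + -1 * w0 x) (fun x => wgrad U v x + -1 *: wgrad U w0 x) <= 4.
  apply: le_trans (sobolev_sqrD_le oU pv pw) _.
  rewrite (sobolev_sqrZ oU _ (H1_pair hw0)) -!(H1norm_sqr oU)// hv1 sqrrN expr1n !mulr1 mul1r.
  have : H1norm U w0 ^+ 2 <= 1 by rewrite exprn_ile1// sqrtr_ge0.
  lra.
have bound m (e1 : R) : 0 <= e1 <= 1 ->
    (forall k : 'I_N, H1norm U (f k m \- psi k) <= e1) ->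
    (forall k : 'I_N, L2norm surf Gam (f k m \- t k) <= e1) ->
    \sum_(k < N) a k ^+ 2 <= 16 * Ct + (4 * Ct + 2) * (P * e1).
  move=> /andP[e10 e11] h1 h2.
  have H1f k : H1 U (f k m \- psi k) by have [/(_ m)[]] := hf k.
  have Lft k : L2fun surf Gam (f k m \- t k) by have [_ /(_ m)] := hf k.
  have cf k : continuous (f k m) by have [/(_ m)[/(_ 0%N)[]]] := hf k.
  have Lf k : L2fun surf Gam (f k m).
    apply: (eq_L2fun _ (L2fun_add mGam (Lft k) (Lt k))) => x _ /=.
    by rewrite subrK.
  have e1sq (z : R) : 0 <= z -> z <= e1 -> z ^+ 2 <= e1.
    move=> z0 ze; rewrite expr2; apply: (@le_trans _ _ (z * 1)); last by rewrite mulr1.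
    by rewrite ler_wpM2l// (le_trans ze).
  pose F x := \sum_(k < N) a k * f k m x.
  have [GS [LF wF] qS] := sobolev_pair_scale_sum oU fU N a H1f pb.
  have FE : (fun x => v x + -1 * w0 x + \sum_(k < N) a k * (f k m \- psi k) x) = F.
    apply/funext => x; rewrite /F /w0 mulN1r opprB [v x + _]addrC subrK -big_split/=.
    by apply: eq_bigr => k _; rewrite -mulrDr addrC subrK.
  rewrite FE in LF wF qS.
  have sumle (z : nat -> R) : (forall k : 'I_N, z k ^+ 2 <= e1) ->
      2 ^+ N * \sum_(k < N) a k ^+ 2 * z k ^+ 2 <= P * e1.
    move=> hz; rewrite /P -mulrA ler_wpM2l// mulr_suml; apply: ler_sum => k _.
    by rewrite ler_wpM2l ?sqr_ge0.
  have qF : sobolev_sqr U F GS <= 8 + 2 * (P * e1).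
    apply: le_trans qS _.
    have := sumle (fun k => H1norm U (f k m \- psi k)) (fun k => e1sq _ (sqrtr_ge0 _) (h1 k)).
    move: qb; lra.
  have cF : continuous F.
    apply: continuous_big => [|k _]; first exact: add_continuous.
    move=> x; have ha : {for x, continuous (fun=> a k : R)} by exact: cst_continuous.
    have hk : {for x, continuous (f k m)} by exact: cf.
    exact: (continuousM ha hk).
  have LFG : L2fun surf Gam F.
    by apply: (@L2fun_sum _ T1 _ surf Gam _ _ (fun (k : 'I_N) x => a k * f k m x) mGam) => k; exact: L2fun_scale.
  have FF : L2dot surf Gam F F <= Ct * (8 + 2 * (P * e1)).
    rewrite -lee_fin L2dot_EFin//; apply: le_trans (tr cF LF wF) _.
    by rewrite lee_fin ler_wpM2l.
  pose D x := \sum_(k < N) - a k * (f k m \- t k) x.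
  have LD : L2fun surf Gam D.
    by apply: (@L2fun_sum _ T1 _ surf Gam _ _ (fun (k : 'I_N) x => - a k * (f k m \- t k) x) mGam) => k; exact: L2fun_scale.
  have DD : L2dot surf Gam D D <= P * e1.
    apply: le_trans (@L2dot_sum_le _ T1 _ surf Gam N (fun (k : 'I_N) x => - a k * (f k m \- t k) x) mGam _) _.
      by move=> k; exact: L2fun_scale.
    apply: le_trans (sumle (fun k => L2norm surf Gam (f k m \- t k)) (fun k => e1sq _ (sqrtr_ge0 _) (h2 k))).
    rewrite ler_wpM2l//; apply: ler_sum => k _.
    have Lk := L2fun_scale (- a k) mGam (Lft k).
    rewrite (L2dot_scalel _ mGam)// (L2dot_scaler _ mGam)//.
    by rewrite /L2norm sqr_sqrtr ?L2dot_ge0// mulrA mulrNN -expr2.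
  rewrite -sum_sqr (_ : (fun x => \sum_(k < N) a k * t k x) = (fun x => F x + D x)); last first.
    apply/funext => x; rewrite /F /D -big_split; apply: eq_bigr => k _ /=.
    by rewrite mulNr -mulrBr opprB addrC subrK.
  apply: le_trans (L2dot_sqrD_le mGam LFG LD) _.
  move: FF DD; lra.
apply/ler_addgt0Pr => e e0.
(* Chosen so that the error term of [bound] is at most e for e1 <= e / Q; the added 1 makes Q
   positive. *)
pose Q := (4 * Ct + 2) * P + 1.
have Q0 : 0 < Q by rewrite ltr_wpDl// mulr_ge0// addr_ge0// mulr_ge0.
pose e1 := Num.min 1 (e / Q).
have e10 : 0 < e1 by rewrite lt_min ltr01 divr_gt0.
have near1 : \forall m \near \oo, forall k : 'I_N, H1norm U (f k m \- psi k) <= e1.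
  apply: filter_forall => k; have [_ _ /cvgrPdist_le /(_ _ e10) h _] := hf k.
  by apply: filterS h => m; rewrite sub0r normrN; apply: le_trans; exact: ler_norm.
have near2 : \forall m \near \oo, forall k : 'I_N, L2norm surf Gam (f k m \- t k) <= e1.
  apply: filter_forall => k; have [_ _ _ /cvgrPdist_le /(_ _ e10) h] := hf k.
  by apply: filterS h => m; rewrite sub0r normrN; apply: le_trans; exact: ler_norm.
have [m [h1 h2]] : exists m, (forall k : 'I_N, H1norm U (f k m \- psi k) <= e1) /\
    (forall k : 'I_N, L2norm surf Gam (f k m \- t k) <= e1).
  have [M _ hM] : \forall m \near \oo, (forall k : 'I_N, H1norm U (f k m \- psi k) <= e1) /\
    (forall k : 'I_N, L2norm surf Gam (f k m \- t k) <= e1) by apply: filterI near1 near2.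
  by exists M; apply: hM => /=.
have e1b : 0 <= e1 <= 1 by rewrite ltW//= ge_min lexx.
apply: le_trans (bound m e1 e1b h1 h2) _; rewrite lerD2l mulrA.
have e1Q : e1 <= e / Q by rewrite ge_min lexx orbT.
rewrite ler_pdivlMr// in e1Q; apply: le_trans e1Q.
by rewrite mulrC ler_wpM2l ?(ltW e10)// /Q lerDl.
Qed.

End trace_coefficients.

(** * Normalized piecewise constants orthogonal to finitely many functions *)

Section unit_kernel.
Variable R : realType.

Lemma unit_kernel_vector N M (A : 'M[R]_(N, M)) : (M < N)%N ->
  exists2 c : 'rV[R]_N, \sum_j c 0 j ^+ 2 = 1 & c *m A = 0.
Proof.
move=> MN; have kn0 : kermx A != 0.
  rewrite -mxrank_eq0 mxrank_ker subn_eq0 -ltnNge.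
  by apply: leq_ltn_trans MN; exact: rank_leq_col.
pose c := nz_row (kermx A).
have c0 : c != 0 by rewrite nz_row_eq0.
have cA : c *m A = 0 by apply/sub_kermxP; exact: nz_row_sub.
have s0 : 0 < \sum_j c 0 j ^+ 2.
  rewrite lt_neqAle sumr_ge0 ?andbT => [|j _]; last exact: sqr_ge0.
  rewrite eq_sym psumr_eq0 => [|j _]; last exact: sqr_ge0.
  apply: contraNN c0 => /allP h; apply/eqP/rowP => j; rewrite mxE.
  by have := h j (mem_index_enum j); rewrite /= sqrf_eq0 => /eqP.
pose s := Num.sqrt (\sum_j c 0 j ^+ 2).
have s2 : s ^+ 2 = \sum_j c 0 j ^+ 2 by rewrite sqr_sqrtr// ltW.
exists (s^-1 *: c); last by rewrite -scalemxAl cA scaler0.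
under eq_bigr do rewrite mxE exprMn.
by rewrite -mulr_sumr -s2 exprVn mulVf// s2 gt_eqF.
Qed.

End unit_kernel.

Section piecewise_constant.
Variables (R : realType) (n : nat).
Local Notation E := 'rV[R]_n.+1.
Local Notation leb := (lebesgue_rV R n.+1).
Variables (I : finType) (K : I -> set E) (Om : set E) (gamma kappa H : R).
Hypotheses (mK : mesh K Om gamma kappa H) (g0 : 0 < gamma) (k0 : 0 < kappa).
Hypothesis bOm : bounded_set Om.

Let mF j : measurable (K j)°.
Proof. by apply: open_measurable_rV; exact: open_interior. Qed.

Lemma L2fun_indic_mul (D A : set E) (u : E -> R) : measurable D -> measurable A ->
  L2fun leb D u -> L2fun leb D (fun x => u x * \1_A x).
Proof.
move=> mD mA [mu iu]; split.
  by apply: measurable_funM => //; exact: measurable_indic.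
apply: le_lt_trans iu; apply: ge0_le_integral => //.
- by move=> x _; rewrite lee_fin sqr_ge0.
- by apply/measurable_EFinP; apply: measurable_funX; apply: measurable_funM => //; exact: measurable_indic.
- by apply/measurable_EFinP; exact: measurable_funX.
- move=> x _; rewrite lee_fin indicE; case: (x \in A); rewrite ?mulr1//.
  by rewrite mulr0 expr0n sqr_ge0.
Qed.

Lemma L2dot_indic (D A : set E) (u v : E -> R) : A `<=` D ->
  L2dot leb D (fun x => u x * \1_A x) v = L2dot leb A u v.
Proof.
move=> AD; rewrite L2dotC (L2dot_support _ AD) => [|x _ nA]; last first.
  by rewrite indicE memNset// mulr0.
rewrite L2dotC; apply: eq_L2dot => // x xA.
by rewrite indicE xA mulr1.
Qed.

Lemma mesh_interior_fine j : 0 < fine (leb (K j)°).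
Proof. by apply: fine_gt0; exact: (mesh_interior_measure mK g0 k0 j). Qed.

(* The projection exists, so Pi is not the default value of xget. *)
Lemma P0_test (w : set E) (psi g : E -> R) : measurable w° -> (leb w° < +oo)%E ->
  L2fun leb w° psi -> P0 K w g ->
  P0 K w (Pi K w psi) /\ L2dot leb w° g psi = L2dot leb w° g (Pi K w psi).
Proof.
move=> mU fU hpsi hg.
suff [hP hproj] : is_L2proj leb w° (P0 K w) psi (Pi K w psi).
  split=> //; have := hproj _ hg; have [LP _] := hP; have [Lg _] := hg.
  rewrite (L2dot_subl mU hpsi LP Lg).
  by move/eqP; rewrite subr_eq0 => /eqP h; rewrite L2dotC h L2dotC.
rewrite /Pi /L2proj; case: xgetP => [p -> //|nex]; exfalso.
pose J := enum (submesh K w).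
have JU j : j \in J -> (K j)° `<=` w°.
  by rewrite mem_enum inE => /asboolP Kw; exact: interiorS.
pose av j := L2dot leb (K j)° psi (fun=> 1) / fine (leb (K j)°).
(* Element averages on the element interiors, psi itself elsewhere: the defect psi - p then lives on
   the interiors only, and the mesh skeleton needs no separate treatment. *)
pose p x := psi x - \sum_(j <- J) (psi x - av j) * \1_((K j)°) x.
have cst_L2 (c : R) (D : set E) : measurable D -> (leb D < +oo)%E -> L2fun leb D (fun=> c).
  by move=> mD fD; apply: (bounded_L2fun (B := `|c|)).
have Lt j : L2fun leb w° (fun x => (psi x - av j) * \1_((K j)°) x).
  by apply: L2fun_indic_mul => //; apply: L2fun_sub => //; exact: cst_L2.
have LS := @L2fun_sum _ _ _ leb w° _ J (fun j x => (psi x - av j) * \1_((K j)°) x) mU Lt.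
have pE j x : j \in J -> (K j)° x -> p x = av j.
  move=> jJ Kx; rewrite /p (bigD1_seq j)//= ?enum_uniq// indicE mem_set// mulr1.
  rewrite big1 ?addr0 ?opprB ?subrKC// => j' j'j.
  rewrite indicE memNset ?mulr0// => Kx'.
  by move: j'j; rewrite (mesh_disjoint mK Kx' Kx) eqxx.
apply: (nex p); split.
  split; first exact: L2fun_sub.
  move=> j js; exists (av j) => x Kx; apply: pE => //; by rewrite mem_enum.
move=> q [Lq cq].
rewrite (_ : psi \- p = (fun x => \sum_(j <- J) (psi x - av j) * \1_((K j)°) x)); last first.
  by apply/funext => x; rewrite /p/= opprB addrC subrK.
rewrite L2dot_suml// big_seq big1// => j jJ.
rewrite L2dot_indic; last exact: JU.
have [c hc] : exists c, forall x, (K j)° x -> q x = c by apply: cq; rewrite -mem_enum.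
have fK : (leb (K j)° < +oo)%E by have /andP[] := mesh_interior_measure mK g0 k0 j.
have LpK : L2fun leb (K j)° psi by apply: L2funS hpsi => //; exact: JU.
have L1K := cst_L2 1 _ (mF j) fK.
rewrite (@eq_L2dot _ _ _ _ _ _ _ (fun x => psi x - av j) (fun x => c * 1)) => [|//|x xK]; last first.
  by rewrite mulr1 hc//; exact: set_mem.
have LvK := cst_L2 (av j) _ (mF j) fK.
rewrite L2dot_scaler//; last exact: L2fun_sub.
rewrite L2dot_subl// [X in _ - X]/L2dot.
under [X in _ - X]eq_Rintegral do rewrite mulr1.
rewrite Rintegral_cst//= /av divfK ?subrr ?mulr0//.
by rewrite gt_eqF//; exact: mesh_interior_fine.
Qed.

Lemma mesh_patch_mono l l' i : (l <= l')%N -> mesh_patch K l i `<=` mesh_patch K l' i.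
Proof.
move=> /subnK <-; elim: (l' - l)%N => [|k IH]//; rewrite addSn.
apply: (subset_trans IH) => x; rewrite mesh_patchE => -[j /= js Kx].
rewrite /mesh_patch /=; exists j => //=; exists x; split => //.
by move: js; rewrite inE => /asboolP; apply.
Qed.

(** The N elements of [w0] span an N-dimensional space of piecewise constants, and N - 1 linear
    conditions leave a nonzero vector in it. *)
Lemma orthogonal_P0 (w0 w : set E) (psi : nat -> E -> R) : w0 `<=` w ->
  measurable w° -> (leb w° < +oo)%E -> (forall k, L2fun leb w° (psi k)) ->
  (0 < #|submesh K w0|)%N ->
  exists g, [/\ P0 K w g, L2dot leb w° g g = 1, (forall x, ~ w0° x -> g x = 0) &
    forall k, (k < #|submesh K w0|.-1)%N -> L2dot leb w° g (psi k) = 0].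
Proof.
move=> w0w mU fU hpsi N0; set N := #|submesh K w0|.
pose el (j : 'I_N) : I := enum_val j.
have elw0 j : K (el j) `<=` w0 by have := enum_valP j; rewrite inE => /asboolP.
have eU0 j : (K (el j))° `<=` w0° by exact: interiorS.
have eU j : (K (el j))° `<=` w°.
  by apply: interiorS; exact: subset_trans w0w.
(* The factor normalizing the indicator of an element in L2, so that the norm of g is that of its
   coefficient vector. *)
pose mu (j : 'I_N) := Num.sqrt (fine (leb (K (el j))°)) ^-1.
have mu2 j : mu j ^+ 2 * fine (leb (K (el j))°) = 1.
  have h := mesh_interior_fine (el j).
  by rewrite /mu sqr_sqrtr ?invr_ge0 ?ltW// mulVf// gt_eqF.
have cst_L2 (c : R) (D : set E) : measurable D -> (leb D < +oo)%E -> L2fun leb D (fun=> c).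
  by move=> mD fD; apply: (bounded_L2fun (B := `|c|)).
pose A : 'M[R]_(N, N.-1) := \matrix_(j, k) (mu j * L2dot leb (K (el j))° (psi k) (fun=> 1)).
have [c c1 cA] := @unit_kernel_vector R N N.-1 A ltac:(by rewrite prednK).
pose h (j : 'I_N) x : R := (c 0 j * mu j) * \1_((K (el j))°) x.
have Lh j : L2fun leb w° (h j).
  by apply: (@L2fun_indic_mul _ _ (fun=> c 0 j * mu j)) => //; exact: cst_L2.
pose g x := \sum_j h j x.
have Lg : L2fun leb w° g by exact: (@L2fun_sum _ _ _ leb w° _ (index_enum 'I_N) h mU Lh).
have gdot v : L2fun leb w° v -> L2dot leb w° g v = \sum_j c 0 j * (mu j * L2dot leb (K (el j))° v (fun=> 1)).
  move=> hv; rewrite (@L2dot_suml _ _ _ leb w° _ (index_enum 'I_N) h _ mU Lh hv).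
  apply: eq_bigr => j _; rewrite (@L2dot_indic _ _ (fun=> c 0 j * mu j))//.
  have fK : (leb (K (el j))° < +oo)%E by have /andP[] := mesh_interior_measure mK g0 k0 (el j).
  have L1 := cst_L2 1 _ (mF (el j)) fK.
  have Lv : L2fun leb (K (el j))° v by exact: L2funS hv.
  rewrite (@eq_L2dot _ _ _ _ _ _ _ (fun x => (c 0 j * mu j) * 1) v) => [|x _|//]; last by rewrite mulr1.
  by rewrite L2dot_scalel// L2dotC mulrA.
have gE j x : (K (el j))° x -> g x = c 0 j * mu j.
  move=> Kx; rewrite /g (bigD1 j)//= /h indicE mem_set// mulr1 big1 ?addr0// => j' j'j.
  rewrite indicE memNset ?mulr0// => Kx'.
  have := mesh_disjoint mK Kx' Kx => /enum_val_inj jj.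
  by rewrite jj eqxx in j'j.
have g00 x : (forall j, ~ (K (el j))° x) -> g x = 0.
  by move=> hx; rewrite /g big1// => j _; rewrite /h indicE memNset// mulr0.
exists g; split.
- split => // i isub.
  have [[j ij]|nj] := pselect (exists j, el j = i).
    by exists (c 0 j * mu j) => x; rewrite -ij; exact: gE.
  exists 0 => x Kx; apply: g00 => j Kjx; apply: nj; exists j.
  exact: (mesh_disjoint mK Kjx Kx).
- rewrite gdot// -c1; apply: eq_bigr => j _.
  have fK : (leb (K (el j))° < +oo)%E by have /andP[] := mesh_interior_measure mK g0 k0 (el j).
  have L1 := cst_L2 1 _ (mF (el j)) fK.
  rewrite (@eq_L2dot _ _ _ _ _ _ _ (fun x => (c 0 j * mu j) * 1) (fun=> 1)) => [|x /set_mem xK|//]; last first.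
    by rewrite mulr1; exact: gE.
  rewrite L2dot_scalel// /L2dot; under eq_Rintegral do rewrite mulr1.
  rewrite Rintegral_cst//= mul1r.
  by rewrite expr2 -(mulr1 (c 0 j * c 0 j)) -(mu2 j) expr2; ring.
- by move=> x nx; apply: g00 => j Kx; apply: nx; exact: eU0 Kx.
- move=> k kN; rewrite gdot//.
  have := congr1 (fun B : 'rV[R]_(N.-1) => B 0 (Ordinal kN)) cA.
  rewrite !mxE => {2}<-; apply: eq_bigr => j _; by rewrite mxE.
Qed.

End piecewise_constant.

(** * Convergence of the sum of exp(-a k^(1/p)) *)

Section decay_series.
Variable R : realType.

Lemma sum_inv_sqr_le m : \sum_(k < m) (k.+1%:R ^+ 2)^-1 <= 2 :> R.
Proof.
(* The subtracted term makes the induction go through, as 1/(k+2)^2 <= 1/(k+1) - 1/(k+2). *)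
suff h k : \sum_(j < k.+1) (j.+1%:R ^+ 2)^-1 <= 2 - k.+1%:R^-1 :> R.
  case: m => [|m]; first by rewrite big_ord0.
  by apply: le_trans (h m) _; rewrite gerBl invr_ge0.
elim: k => [|k IH]; first by rewrite big_ord_recr big_ord0/= add0r expr1n invr1; lra.
have e : (k.+2%:R ^+ 2)^-1 <= k.+1%:R^-1 - k.+2%:R^-1 :> R.
  have -> : k.+1%:R^-1 - k.+2%:R^-1 = (k.+1%:R * k.+2%:R)^-1 :> R.
    have x0 : 0 < k.+1%:R :> R by [].
    rewrite -[k.+2%:R]natr1; move: (k.+1%:R) x0 => x x0.
    by field; rewrite !gt_eqF// addr_gt0.
  by rewrite lef_pV2 ?posrE ?mulr_gt0 ?exprn_gt0// expr2 ler_pM2r// ler_nat.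
by rewrite big_ord_recr/=; apply: le_trans (lerD IH e) _; rewrite addrA subrK.
Qed.

Lemma powR_inv_nat_exp (p : nat) (x : R) : (0 < p)%N -> 0 <= x -> (x `^ p%:R^-1) ^+ p = x.
Proof.
move=> p0 x0; rewrite -powR_mulrn ?powR_ge0// -powRrM mulVf ?powRr1//.
by rewrite pnatr_eq0 -lt0n.
Qed.

(** Comparison with the sum of 1/k^2: exp(x) >= x^q/q! with q = 2p turns x = a k^(1/p) into a
    multiple of k^2. *)
Lemma exp_root_series_bounded (a : R) (p : nat) : 0 < a -> (0 < p)%N ->
  exists2 S, 0 < S & forall m, \sum_(k < m) expR (- (a * k%:R `^ p%:R^-1)) <= S.
Proof.
move=> a0 p0; pose q := (p * 2)%N.
have q0 : (0 < q)%N by rewrite muln_gt0 p0.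
pose C : R := q`!%:R / a ^+ q.
have C0 : 0 < C by rewrite divr_gt0 ?exprn_gt0// ltr0n fact_gt0.
exists (1 + C * 2); first by rewrite ltr_wpDr// mulr_ge0// ltW.
case=> [|m]; first by rewrite big_ord0 addr_ge0// mulr_ge0// ltW.
rewrite big_ord_recl lerD//.
  by rewrite expR_le1 oppr_le0 mulr_ge0 ?powR_ge0// ltW.
apply: (@le_trans _ _ (\sum_(k < m) C * (k.+1%:R ^+ 2)^-1)); last first.
  by rewrite -mulr_sumr ler_wpM2l ?(ltW C0)// sum_inv_sqr_le.
apply: ler_sum => k _; rewrite lift0.
set x := a * _.
have x0 : 0 <= x by rewrite mulr_ge0 ?powR_ge0// ltW.
have xq : x ^+ q = a ^+ q * k.+1%:R ^+ 2.
  by rewrite exprMn [(_ `^ _) ^+ q]exprM powR_inv_nat_exp.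
have := @expR_ge1Dxn R x q.-1 x0; rewrite prednK// => h.
have f0 : 0 < q`!%:R :> R by rewrite ltr0n fact_gt0.
have aq0 : 0 < a ^+ q by rewrite exprn_gt0.
have k0 : 0 < k.+1%:R ^+ 2 :> R by rewrite exprn_gt0.
rewrite expRN (_ : C * _ = (x ^+ q / q`!%:R)^-1); last first.
  by rewrite xq /C; field; rewrite !gt_eqF.
rewrite lef_pV2 ?posrE ?expR_gt0// ?divr_gt0// ?xq ?mulr_gt0//.
by rewrite -xq (le_trans _ h)// lerDr.
Qed.

End decay_series.

(** * Steklov expansions on a patch *)

Section patch_space.
Variables (R : realType) (n : nat).
Local Notation E := 'rV[R]_n.+1.
Local Notation leb := (lebesgue_rV R n.+1).

Lemma V_patch_H1 (Om w : set E) (v : E -> R) : open Om -> w° `<=` Om ->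
  V_patch Om w v -> H1 w° v.
Proof.
move=> oOm wOm [u [[Lu [G wG]] _] uv].
apply: (@eq_H1 _ _ _ u) => [x /set_mem xw|]; first by rewrite uv.
split; first by apply: L2funS Lu => //; apply: open_measurable_rV => //; exact: open_interior.
by exists G; apply: weak_gradientS wG => //; exact: open_interior.
Qed.

(* The trace of a function without trace is 0 by convention, so that a nonzero
   trace_dot certifies its existence. *)
Lemma trace_is_trace (U Gam : set E) (v : E -> R) :
  trace_dot U Gam v v != 0 -> is_trace U Gam v (trace U Gam v).
Proof.
rewrite /trace_dot /trace; case: xgetP => [t -> //|_].
rewrite /L2dot (_ : (fun x => _) = (fun=> 0)); last by apply/funext => x; rewrite mulr0.
by rewrite /Rintegral integral0 /= eqxx.
Qed.

End patch_space.

Lemma mean_le_right (R : realFieldType) (c x y : R) : 0 <= c -> x <= y ->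
  c / 2 * (x + y) <= c * y.
Proof. by move=> c0 xy; rewrite -mulrA ler_wpM2l//; lra. Qed.

Section steklov_patch.
Variables (R : realType) (n : nat).
Local Notation E := 'rV[R]_n.+1.
Local Notation leb := (lebesgue_rV R n.+1).
Local Notation surf := (surface R n.+1).

Lemma trace_cst_ge0 (Lam : R) : 1 <= Lam -> 0 <= trace_cst n Lam.
Proof.
move=> L1; have L0 : 0 <= Lam by exact: le_trans L1.
rewrite /trace_cst mulr_ge0 ?ahlfors_cst_ge0//.
apply: addr_ge0; apply: mulr_ge0.
- by rewrite mulr_ge0// exprn_ge0// mulr_ge0// sqr_ge0.
- by rewrite exprn_ge0.
- by rewrite mulr_ge0 ?element_cst_ge0// mulr_ge0// sqr_ge0.
- by rewrite exprn_ge0// mulr_ge0.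
Qed.

(** A constant free of H: in [trace_patch] the factor rho H of the gradient term is at most rho Hm^2
    / H, so that 1/H can be pulled out of both terms. *)
Definition patch_trace_cst (gamma kappa Hm : R) : R :=
  let rho := mesh_radius n gamma kappa in
  trace_cst n (1 + rho^-1) * (rho^-1 + rho * Hm ^+ 2).

Section patch.
Variables (I : finType) (K : I -> set E) (Om : set E) (gamma kappa H Hm : R).
Hypotheses (mK : mesh K Om gamma kappa H) (g0 : 0 < gamma) (k0 : 0 < kappa).
Hypotheses (oOm : open Om) (bOm : bounded_set Om) (lOm : lipschitz_boundary Om) (HHm : H <= Hm).

Let H0 : 0 < H. Proof. by case: mK => -[]. Qed.

Lemma patch_trace_cst_ge0 : 0 <= patch_trace_cst gamma kappa Hm.
Proof.
have r0 := mesh_radius_gt0 n g0 k0.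
rewrite /patch_trace_cst mulr_ge0//.
  by apply: trace_cst_ge0; rewrite lerDl invr_ge0 ltW.
by rewrite addr_ge0 ?invr_ge0 ?(ltW r0)// mulr_ge0 ?sqr_ge0// ltW.
Qed.

Lemma trace_patch_sobolev l i f G : let w := mesh_patch K l i in
  continuous f -> L2fun leb w° f -> is_weak_gradient w° f G ->
  (\int[surf]_(y in Gamma1 Om w) (f y ^+ 2)%:E <=
   (patch_trace_cst gamma kappa Hm / H * sobolev_sqr w° f G)%:E)%E.
Proof.
move=> w cf hf wG; apply: le_trans (trace_patch mK g0 k0 cf hf wG) _; rewrite lee_fin.
have r0 := mesh_radius_gt0 n g0 k0; rewrite /patch_trace_cst.
set rho := mesh_radius n gamma kappa in r0 *.
rewrite /sobolev_sqr -/w; set X := L2dot _ _ f f; set Y := \sum_i _.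
have X0 : 0 <= X by exact: L2dot_ge0.
have Y0 : 0 <= Y by apply: sumr_ge0 => j _; exact: L2dot_ge0.
have T0 : 0 <= trace_cst n (1 + rho^-1) by rewrite trace_cst_ge0// lerDl invr_ge0 ltW.
move: (trace_cst n _) T0 => T T0.
suff : (rho * H)^-1 * X + rho * H * Y <= (rho^-1 + rho * Hm ^+ 2) * (H^-1 * (X + Y)).
  by move=> h; rewrite -[T * _ / H]mulrA -[leRHS]mulrA -[_ / H * _]mulrA; apply: ler_wpM2l.
have h1 : (rho * H)^-1 * X <= rho^-1 * (H^-1 * (X + Y)).
  rewrite invfM -mulrA ler_wpM2l ?invr_ge0 ?(ltW r0)// ler_wpM2l ?invr_ge0 ?(ltW H0)//.
  by rewrite lerDl.
have h2 : rho * H * Y <= rho * Hm ^+ 2 * (H^-1 * (X + Y)).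
  rewrite -[leLHS]mulrA -[leRHS]mulrA ler_wpM2l ?(ltW r0)//.
  have -> : H * Y = H^-1 * (H ^+ 2 * Y) by rewrite expr2 -mulrA mulKf// gt_eqF.
  rewrite [leRHS]mulrCA ler_wpM2l ?invr_ge0 ?(ltW H0)//.
  apply: ler_pM => //; first exact: sqr_ge0.
    by rewrite lerXn2r ?nnegrE ?(ltW H0)// (le_trans (ltW H0)).
  by rewrite lerDr.
by rewrite [leRHS]mulrDl lerD.
Qed.

Variables (A : E -> 'M[R]_n.+1) (l : nat) (i : I) (psi : nat -> E -> R).
Let w := mesh_patch K l i.
Hypothesis hst : steklov_basis A Om w psi.

Let oU : open w°. Proof. exact: open_interior. Qed.
Let mU : measurable w°. Proof. exact: open_measurable_rV. Qed.
Let fU : (leb w° < +oo)%E. Proof. exact: (mesh_patch_measure mK bOm). Qed.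

Let UOm : w° `<=` Om.
Proof.
apply: subset_trans (interior_closure_lipschitz oOm lOm).
by apply: interiorS; exact: (mesh_patch_sub mK).
Qed.

Lemma steklov_H1 k : H1 w° (psi k).
Proof.
have [lam [heig _ _ _ _]] := hst; have [Vk _ _] := heig k.
exact: V_patch_H1 Vk.
Qed.

Lemma steklov_coefficients_le v N (a : nat -> R) : V_patch Om w v -> H1norm w° v = 1 ->
  H1norm w° (fun x => v x - \sum_(k < N) a k * psi k x) <= 1 ->
  \sum_(k < N) a k ^+ 2 <= 16 * (patch_trace_cst gamma kappa Hm / H).
Proof.
move=> Vv v1 hr; have [lam [_ horth _ _ _]] := hst.
apply: (@trace_coefficients_le R n w° (Gamma1 Om w) _ oU fU _ _ _ N psi
  (fun k => trace w° (Gamma1 Om w) (psi k)) a v).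
- by apply: measurable_surface; exact: measurable_Gamma1.
- by rewrite divr_ge0 ?patch_trace_cst_ge0// ltW.
- by move=> f G cf hf wG; exact: trace_patch_sobolev.
- by move=> k; apply: trace_is_trace; rewrite horth eqxx oner_eq0.
- exact: horth.
- exact: steklov_H1.
- exact: V_patch_H1 Vv.
- exact: v1.
- exact: hr.
Qed.

Variables (w0 : set E) (g : E -> R) (c0 cs : R) (s : R) (S : R).
Hypotheses (w0w : w0 `<=` w) (hg : P0 K w g) (g1 : L2dot leb w° g g = 1)
  (gs : forall x, ~ w0° x -> g x = 0) (N1 : nat)
  (gorth : forall k, (k < N1)%N -> L2dot leb w° g (psi k) = 0)
  (cs0 : 0 < cs) (c00 : 0 < c0) (s0 : 0 <= s)
  (hdec : forall k, L2norm leb w0° (Pi K w (psi k)) <= cs * expR (- (c0 * k%:R `^ s)))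
  (hS : forall m, \sum_(k < m) expR (- (c0 / 2 * k%:R `^ s)) <= S) (S0 : 0 < S).

Let Lg : L2fun leb w° g. Proof. by have [] := hg. Qed.

(** As g is piecewise constant, [psi k] may be replaced by its projection; as g vanishes off [w0],
    only the norm of that projection on [w0] enters. *)
Lemma P0_decay k : `|L2dot leb w° g (psi k)| <= cs * expR (- (c0 * k%:R `^ s)).
Proof.
have [[Lp _] ->] := P0_test mK g0 k0 mU fU (steklov_H1 k).1 hg.
have m0 : measurable w0° by apply: open_measurable_rV; exact: open_interior.
have sub : w0° `<=` w° by exact: interiorS.
apply: le_trans (hdec k); rewrite -(@ler_pXn2r _ 2)// ?nnegrE ?sqrtr_ge0//.
rewrite real_normK ?num_real// /L2norm sqr_sqrtr ?L2dot_ge0//.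
rewrite L2dotC (L2dot_support _ sub) => [|x _]; last exact: gs.
have Lp0 := L2funS mU m0 sub Lp; have Lg0 := L2funS mU m0 sub Lg.
apply: le_trans (L2dot_CS m0 Lp0 Lg0) _.
rewrite -[leRHS]mulr1 ler_wpM2l ?L2dot_ge0// -g1.
exact: L2dotS.
Qed.

(** The bound is B + B: one B for the expansion, where |a_k| <= D, and one for the remainder, since
    completeness in Y is used at a finite order. *)
Lemma steklov_test_le (D : R) v : 0 < D -> 16 * (patch_trace_cst gamma kappa Hm / H) <= D ^+ 2 ->
  Y_patch A Om w v -> H1norm w° v = 1 ->
  L2dot leb w° g v <= 2 * (D * cs * (expR (- (c0 / 2 * N1%:R `^ s)) * S)).
Proof.
move=> D0 hD Yv v1; have [Vv _] := Yv.
set B := D * cs * _.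
have B0 : 0 < B by rewrite /B !mulr_gt0// expR_gt0.
(* The 1 serves the bound on the coefficients, the B the pairing of g with the remainder. *)
pose e := Num.min 1 B; have e0 : 0 < e by rewrite lt_min ltr01.
have [lam [_ _ _ hcomp _]] := hst.
have [N [a ha]] := hcomp v Yv e e0.
have hv := V_patch_H1 oOm UOm Vv.
pose r x := v x - \sum_(k < N) a k * psi k x.
have hr1 : H1norm w° r <= 1 by rewrite (le_trans (ltW ha))// ge_min lexx.
have sq := steklov_coefficients_le Vv v1 hr1.
have Lpsi k : L2fun leb w° (psi k) by have [] := steklov_H1 k.
have Lap (k : 'I_N) : L2fun leb w° (fun x => a k * psi k x) by exact: L2fun_scale.
have LS := @L2fun_sum _ _ _ leb w° _ (index_enum 'I_N) (fun (k : 'I_N) x => a k * psi k x) mU Lap.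
have Lv : L2fun leb w° v by have [] := hv.
have Lr : L2fun leb w° r by exact: L2fun_sub.
have rB : L2dot leb w° g r <= B.
  apply: (@le_trans _ _ (H1norm w° r)); last by rewrite (le_trans (ltW ha))// ge_min lexx orbT.
  rewrite (le_trans (ler_norm _))// -(@ler_pXn2r _ 2)// ?nnegrE ?sqrtr_ge0//.
  rewrite real_normK ?num_real//.
  apply: le_trans (L2dot_CS mU Lg Lr) _; rewrite g1 mul1r.
  rewrite /H1norm sqr_sqrtr; last first.
    by rewrite addr_ge0 ?L2dot_ge0//; apply: Rintegral_ge0 => x _; exact: dotv_ge0.
  by rewrite lerDl; apply: Rintegral_ge0 => x _; exact: dotv_ge0.
have aD (k : 'I_N) : `|a k| <= D.
  rewrite -(@ler_pXn2r _ 2)// ?nnegrE ?(ltW D0)// real_normK ?num_real//.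
  apply: le_trans hD; apply: le_trans sq; rewrite (bigD1 k)//= lerDl.
  by apply: sumr_ge0 => j _; exact: sqr_ge0.
have -> : L2dot leb w° g v = L2dot leb w° g r + \sum_(k < N) a k * L2dot leb w° g (psi k).
  rewrite (_ : \sum_(k < N) _ = L2dot leb w° g (fun x => \sum_(k < N) a k * psi k x)); last first.
    rewrite L2dotC (@L2dot_suml _ _ _ leb w° _ (index_enum 'I_N) (fun (k : 'I_N) x => a k * psi k x) _ mU Lap Lg).
    by apply: eq_bigr => k _; rewrite L2dot_scalel// L2dotC.
  by rewrite !(L2dotC _ _ g) -L2dot_addl//; apply: eq_L2dot => // x _; rewrite /r subrK.
rewrite [leRHS](_ : _ = B + B); last by rewrite mulr_natl mulr2n.
rewrite lerD// /B mulrA.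
apply: (@le_trans _ _ (\sum_(k < N) D * cs * expR (- (c0 / 2 * N1%:R `^ s)) * expR (- (c0 / 2 * k%:R `^ s)))); last first.
  by rewrite -mulr_sumr ler_wpM2l// !mulr_ge0 ?expR_ge0 ?(ltW D0) ?(ltW cs0).
apply: ler_sum => k _.
have p0 : 0 <= D * cs * expR (- (c0 / 2 * N1%:R `^ s)) * expR (- (c0 / 2 * k%:R `^ s)).
  by rewrite !mulr_ge0 ?expR_ge0 ?(ltW D0) ?(ltW cs0).
have [kN|Nk] := ltnP k N1; first by rewrite gorth// mulr0.
rewrite (le_trans (ler_norm _))// normrM.
apply: (@le_trans _ _ (D * (cs * expR (- (c0 * k%:R `^ s))))).
  by rewrite ler_pM//; exact: P0_decay.
rewrite mulrA -[leRHS]mulrA ler_wpM2l ?mulr_ge0 ?(ltW D0) ?(ltW cs0)//.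
rewrite -expRD ler_expR -opprD lerN2 -mulrDr.
(* For k >= N1 half of the exponent is bounded below at N1 and gives the final decay; the other half
   stays for the series. *)
have : N1%:R `^ s <= k%:R `^ s :> R by rewrite ge0_ler_powR ?nnegrE// ler_nat.
exact: mean_le_right (ltW c00).
Qed.

End patch.
End steklov_patch.

(** * From element counts to powers of the number of layers *)

Section exponents.
Variable R : realType.

(** With d = p+2, the root of order d-1 of l^d is l^(d/(d-1)). Passing from N - 1 to N / 2 costs at
    most the factor [expR c]. *)
Lemma layer_exponent (c m1 : R) (p l N : nat) : 0 < c -> 0 <= m1 -> (0 < N)%N ->
  m1 * l%:R ^+ p.+2 <= N%:R ->
  expR (- (c * N.-1%:R `^ p.+1%:R^-1)) <=
  expR c * expR (- (c * (m1 / 2) `^ p.+1%:R^-1 * l%:R `^ (p.+2%:R / p.+1%:R))).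
Proof.
move=> c0 m0 N0 hN; set s := p.+1%:R^-1.
have s0 : 0 <= s by rewrite invr_ge0.
rewrite -expRD ler_expR -mulrA -[X in X - _]mulr1 -mulrBr -mulrN ler_wpM2l ?(ltW c0)//.
have -> : (m1 / 2) `^ s * l%:R `^ (p.+2%:R / p.+1%:R) = (m1 / 2 * l%:R ^+ p.+2) `^ s.
  by rewrite [RHS]powRM ?divr_ge0// ?exprn_ge0// -[l%:R ^+ _]powR_mulrn// -powRrM.
have : (m1 / 2 * l%:R ^+ p.+2) `^ s <= (N%:R / 2) `^ s.
  apply: ge0_ler_powR; rewrite ?nnegrE ?divr_ge0//.
    by rewrite mulr_ge0 ?divr_ge0 ?exprn_ge0.
  by rewrite mulrAC ler_wpM2r.
suff : (N%:R / 2) `^ s <= 1 + N.-1%:R `^ s :> R by lra.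
(* For N = 1 the summand 1 suffices, since N - 1 = 0 < N / 2; for N >= 2 one has N / 2 <= N - 1. *)
case: N N0 {hN} => [|[|N]]// _.
  rewrite ler_wpDr ?powR_ge0//; apply: (@le_trans _ _ (1 `^ s)); last by rewrite powR1.
  by apply: ge0_ler_powR; rewrite ?nnegrE//; lra.
have h : 1 <= N.+1%:R :> R by rewrite ler1n.
have h2 : N.+2%:R = N.+1%:R + 1 :> R by rewrite natr1.
rewrite ler_wpDl//.
by apply: ge0_ler_powR; rewrite ?nnegrE//= h2; lra.
Qed.

(* l./2 >= l / 3 for l >= 2, and for l = 1 a single element suffices. *)
Lemma half_layer_scale (m : R) (d l N : nat) : 0 <= m -> (0 < l)%N -> (0 < N)%N ->
  ((0 < l./2)%N -> m * l./2%:R ^+ d <= N%:R) ->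
  Num.min 1 m / 3 ^+ d * l%:R ^+ d <= N%:R.
Proof.
move=> m0 l0 N0 h; have n0 : 0 <= Num.min 1 m by rewrite le_min ler01.
have -> : Num.min 1 m / 3 ^+ d * l%:R ^+ d = Num.min 1 m * (l%:R / 3) ^+ d.
  by rewrite expr_div_n mulrA mulrAC.
case: (ltnP 0 l./2) => [hl|hl].
  apply: le_trans (h hl); apply: ler_pM => //.
  - by rewrite ge_min lexx orbT.
  - rewrite lerXn2r ?nnegrE ?mulr_ge0// ler_pdivrMr// -natrM ler_nat.
    by rewrite -{1}(odd_double_half l) mulnS muln2 leq_add2r (leq_trans (leq_b1 _)).
have -> : l = 1%N by case: l l0 hl {h} => [|[|]].
apply: (@le_trans _ _ 1); last by rewrite ler1n.
apply: mulr_ile1 => //; first by rewrite ge_min lexx.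
by rewrite exprn_ile1//; lra.
Qed.

End exponents.

(** * The bound for one patch and the choice of constants *)

Section sigma_bound.
Variables (R : realType) (n : nat).
Local Notation E := 'rV[R]_n.+1.
Variables (A : E -> 'M[R]_n.+1) (Om : set E) (I : finType) (K : I -> set E) (gamma kappa H Hm : R).
Hypotheses (mK : mesh K Om gamma kappa H) (g0 : 0 < gamma) (k0 : 0 < kappa).
Hypotheses (oOm : open Om) (bOm : bounded_set Om) (lOm : lipschitz_boundary Om) (HHm : H <= Hm).

(** The infimum is bounded by the value at the g of [orthogonal_P0] for the patch with half the
    layers, where the decay hypothesis controls the averages. *)
Lemma sigmaT_le (psi : nat -> E -> R) (l : nat) (i : I) (c0 cs s S D : R) :
  steklov_basis A Om (mesh_patch K l i) psi -> 0 < c0 -> 0 < cs -> 0 <= s -> 0 < S -> 0 < D ->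
  (forall k, L2norm (lebesgue_rV R n.+1) (mesh_patch K l./2 i)° (Pi K (mesh_patch K l i) (psi k)) <=
    cs * expR (- (c0 * k%:R `^ s))) ->
  (forall m, \sum_(k < m) expR (- (c0 / 2 * k%:R `^ s)) <= S) ->
  16 * (patch_trace_cst n gamma kappa Hm / H) <= D ^+ 2 ->
  (sigmaT K A Om l i <= (2 * (D * cs *
    (expR (- (c0 / 2 * #|submesh K (mesh_patch K l./2 i)|.-1%:R `^ s)) * S)))%:E)%E.
Proof.
move=> hst c00 cs0 s0 S0 D0 hdec hS hD.
have w0w : mesh_patch K l./2 i `<=` mesh_patch K l i.
  by apply: mesh_patch_mono; rewrite -divn2 leq_div.
have fU := mesh_patch_measure mK bOm l i.
have mU : measurable (mesh_patch K l i)°.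
  by apply: open_measurable_rV; exact: open_interior.
have hpsi k := (steklov_H1 mK oOm lOm hst k).1.
have N0 : (0 < #|submesh K (mesh_patch K l./2 i)|)%N.
  apply/card_gt0P; exists i; rewrite inE; apply/asboolP.
  exact: (mesh_patch_mono (leq0n l./2)).
have [g [Pg g1 gs gorth]] := orthogonal_P0 mK g0 k0 w0w mU fU hpsi N0.
apply: le_trans (ereal_inf_lbound _) _.
  by exists g => //; split => //; rewrite /L2norm g1 sqrtr1.
apply: ge_ereal_sup => _ [v [Yv v1] <-]; rewrite lee_fin.
exact: (steklov_test_le mK g0 k0 oOm bOm lOm HHm hst w0w Pg g1 gs gorth cs0 c00 s0 hdec hS S0 D0 hD Yv v1).
Qed.

End sigma_bound.

Theorem theorem7p3 (R : realType) (d : nat) (Om : set 'rV[R]_d)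
    (alpha beta gamma kappa m M c0 : R) (Csd : R -> nat -> R) :
  (2 <= d)%N ->
  polyhedral_lipschitz_domain Om ->
  0 < alpha <= beta ->
  0 < gamma -> 0 < kappa -> 0 < m -> 0 < M -> 0 < c0 ->
  polynomial_dependence Csd ->
  (forall (H : R) (l : nat), 0 < H -> (0 < l)%N -> 0 < Csd H l) ->
  exists c C : R, [/\ 0 < c, 0 < C &
    forall (A : 'rV[R]_d -> 'M[R]_d) (I : finType) (K : I -> set 'rV[R]_d)
        (H : R) (psi : nat -> I -> nat -> 'rV[R]_d -> R),
      coefficient A Om alpha beta ->
      mesh K Om gamma kappa H ->
      (forall l i, admissible_patch K Om l i ->
         steklov_basis A Om (mesh_patch K l i) (psi l i)) ->
      steklov_decay K Om c0 (Csd H) psi ->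
      forall L : nat, largest_scaling_layer K m M L ->
      forall l : nat, (l <= L)%N ->
      (forall i, admissible_patch K Om l i) ->
      (sigma K A Om l <=
        (C * Csd H l * l%:R `^ (d%:R - d%:R / (d%:R - 1)) * H `^ (- 2^-1)
           * expR (- (c * l%:R `^ (d%:R / (d%:R - 1)))))%:E)%E].
Proof.
case: d Om => [|[|n]] Om // _ [[oOm _ _ bOm] lOm _] _ g0 k0 m0 _ c00 _ Csd0.
have dE : n.+2%:R - 1 = n.+1%:R :> R by rewrite -[n.+2%:R]natr1 addrK.
rewrite dE; pose s : R := n.+1%:R^-1; have s0 : 0 <= s by rewrite invr_ge0.
have [B B0 hB] := bounded_closure_coord bOm.
(* The bound of [mesh_size_le], fixed before the mesh, so that no constant depends on H. *)
pose Hm := n.+2%:R * (2 * B) / kappa.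
pose Cp := patch_trace_cst n.+1 gamma kappa Hm.
have Cp0 : 0 <= Cp by exact: patch_trace_cst_ge0.
have c02 : 0 < c0 / 2 by rewrite divr_gt0.
have [S S0 hS] := exp_root_series_bounded c02 (ltn0Sn n).
pose m1 := Num.min 1 m / 3 ^+ n.+2.
have m10 : 0 < m1 by rewrite divr_gt0 ?exprn_gt0// lt_min ltr01.
pose c := c0 / 2 * (m1 / 2) `^ s.
(* A positive number whose square is at least 16 Cp; thus D = Ct H^(-1/2) satisfies the requirement
   on D^2. *)
pose Ct := 1 + 16 * Cp; have Ct0 : 0 < Ct by rewrite ltr_pwDl// mulr_ge0.
pose C := 2 * Ct * S * expR (c0 / 2).
exists c, C; split.
- by rewrite mulr_gt0// powR_gt0// divr_gt0.
- by rewrite !mulr_gt0// expR_gt0.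
move=> A I K H psi _ mK hst hdec L [hL _] l lL adm.
have H0 : 0 < H by case: mK => -[].
have HHm : H <= Hm by exact: (mesh_size_le mK k0 B0 hB).
apply: bigmax_le => [|i _]; first exact: leNye.
have [l0 _] := adm i.
have cs0 := Csd0 H l H0 l0.
pose D := Ct * H `^ (- 2^-1); have D0 : 0 < D by rewrite mulr_gt0// powR_gt0.
have hD : 16 * (Cp / H) <= D ^+ 2.
  have -> : D ^+ 2 = Ct ^+ 2 / H.
    rewrite exprMn -[X in _ * X]powR_mulrn ?powR_ge0// -powRrM mulNr mulVf//.
    by rewrite powRN powRr1// ltW.
  rewrite mulrA ler_wpM2r ?invr_ge0 ?(ltW H0)// /Ct; nra.
have hd k : L2norm (lebesgue_rV R n.+2) (mesh_patch K l./2 i)°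
    (Pi K (mesh_patch K l i) (psi l i k)) <= Csd H l * expR (- (c0 * k%:R `^ s)).
  by have := hdec l i (adm i) k; rewrite dE.
apply: le_trans (sigmaT_le mK g0 k0 oOm bOm lOm HHm (hst l i (adm i)) c00 cs0 s0 S0 D0 hd hS hD) _.
rewrite lee_fin; set N := #|_|.
have N0 : (0 < N)%N.
  apply/card_gt0P; exists i; rewrite inE; apply/asboolP.
  exact: (mesh_patch_mono (leq0n l./2)).
have hN : m1 * l%:R ^+ n.+2 <= N%:R.
  (* The element count is available at [l./2] because it is at most L, unless [l./2] is 0, which
     happens only for l = 1. *)
  apply: half_layer_scale; rewrite ?(ltW m0)// => h2.
  have hl : (0 < l./2 <= L)%N by rewrite h2 (leq_trans _ lL)// -divn2 leq_div.
  by have /andP[] := hL _ i hl.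
have := layer_exponent c02 (ltW m10) N0 hN; rewrite -/s -/c => hexp.
(* The estimate is obtained with 1 in the place of this power, whose exponent d - d/(d-1) is
   nonnegative for d >= 2. *)
have h1 : 1 <= l%:R `^ (n.+2%:R - n.+2%:R / n.+1%:R) :> R.
  rewrite -[leLHS](powRr0 l%:R); apply: ler_powR; first by rewrite ler1n.
  rewrite subr_ge0 ler_pdivrMr// ler_peMr// ler1n.
  done.
set X := l%:R `^ _ in h1 *; set Y := expR _ in hexp *; set Z := expR (- (c * _)) in hexp *.
have Z0 : 0 < Z by exact: expR_gt0.
rewrite /C /D; set h := H `^ _; have h0 : 0 <= h by exact: powR_ge0.
apply: (@le_trans _ _ (2 * (Ct * h * Csd H l * (expR (c0 / 2) * Z * S)))).
  rewrite ler_wpM2l// ler_wpM2l ?ler_wpM2r ?(ltW S0)//.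
  by rewrite !mulr_ge0// ltW.
have -> : 2 * (Ct * h * Csd H l * (expR (c0 / 2) * Z * S)) =
  2 * Ct * S * expR (c0 / 2) * Csd H l * 1 * h * Z by ring.
rewrite ler_wpM2r ?(ltW Z0)// ler_wpM2r// ler_wpM2l//.
by rewrite !mulr_ge0 ?expR_ge0// ltW.
Qed.
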